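(* Let $d\geq 3$, let $L\subset\mathbb{P}^3$ be a line, and let $F$ be a rank 2 reflexive sheaf on $\mathbb{P}^3$ fitting in an exact sequence $$0\longrightarrow\mathcal{O}_{\mathbb{P}^3}\longrightarrow F\longrightarrow\mathcal{I}_L(2-d)\longrightarrow 0.$$ Then there exists a codimension one distribution $\mathcal{F}$ of degree $d$ on $\mathbb{P}^3$ with tangent sheaf $T_{\mathcal{F}}\cong F$.
   Context: Work over $\mathbb{C}$. A codimension one distribution $\mathcal{F}$ of degree $d\ge 0$ on $\mathbb{P}^3$ is an exact sequence $0\to T_{\mathcal{F}}\to T\mathbb{P}^3\to \mathcal{I}_Z(d+2)\to 0$, where $T_{\mathcal{F}}$ (the tangent sheaf) is a rank 2 reflexive sheaf and $\mathcal{I}_Z$ is the ideal sheaf of a closed subscheme $Z=\mathrm{Sing}(\mathcal{F})$ of codimension at least 2. No integrability is required. $\mathcal{I}_L$ denotes the ideal sheaf of $L$. *)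

(* Defs.v *)
From HB Require Import structures.
From mathcomp Require Import all_boot all_order all_algebra.
From mathcomp Require Import boolp classical_sets functions reals complex.
From mathcomp Require Import mpoly.
From mathcomp Require Import zify.

Set Implicit Arguments.
Unset Strict Implicit.
Unset Printing Implicit Defensive.

Import GRing.Theory.
Local Open Scope ring_scope.
Local Open Scope classical_set_scope.

(* P^3 over an algebraically closed field K is treated as a classical variety:
   its set of closed points with the Zariski topology and the sheaf of regular
   functions. *)

(* A point is given by homogeneous coordinates: v and c v (c != 0) represent the
   same point.  Subsets of P^3 are identified with their preimages; open and
   closed sets are scaling-invariant by construction, being defined by
   homogeneous polynomials. *)
Definition pt (K : closedFieldType) : Type := {v : 'rV[K]_4 | v != 0}.

Definition ev (K : closedFieldType) (p : {mpoly K[4]}) (x : pt K) : K :=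
  p.@[fun i => val x 0 i].

Definition zariski_open (K : closedFieldType) (U : set (pt K)) : Prop :=
  exists S : set {mpoly K[4]},
    (forall p, S p -> exists n, p \is n.-homog) /\
    (forall x, U x <-> exists2 p, S p & ev p x != 0).

Record open (K : closedFieldType) := Open {
  pts_of :> pt K -> Prop;
  open_zariski : zariski_open pts_of }.

Definition sub_open (K : closedFieldType) (V U : open K) : Prop :=
  pts_of V `<=` pts_of U.
Notation "V <<= U" := (sub_open V U) (at level 70, no associativity).

Definition locally (K : closedFieldType) (U : open K)
    (P : forall V : open K, V <<= U -> Prop) : Prop :=
  forall x, U x -> exists (V : open K) (h : V <<= U), V x /\ P V h.

Lemma zariski_openI (K : closedFieldType) (U V : open K) :
  zariski_open (pts_of U `&` pts_of V).
Proof.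
have [S [hS eS]] := open_zariski U; have [T [hT eT]] := open_zariski V.
exists [set r | exists p q, [/\ S p, T q & r = p * q]]; split.
  move=> _ [p [q [/hS[m hm] /hT[n hn] ->]]]; exists (m + n)%N.
  exact: dhomogM.
move=> x; split.
  move=> [/eS[p Sp px] /eT[q Tq qx]]; exists (p * q); first by exists p, q.
  by rewrite /ev mevalM mulf_neq0.
move=> [_ [p [q [Sp Tq ->]]]].
rewrite /ev mevalM mulf_eq0 negb_or => /andP[px qx].
by split; [apply/eS; exists p | apply/eT; exists q].
Qed.

Definition openI (K : closedFieldType) (U V : open K) : open K :=
  Open (zariski_openI U V).

Definition dom (K : closedFieldType) (U : open K) : Type := {x : pt K | U x}.

Definition dom_sub (K : closedFieldType) (U V : open K) (h : V <<= U)
    (x : dom V) : dom U :=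
  exist _ (sval x) (h _ (svalP x)).

Lemma dom_inj (K : closedFieldType) (U : open K) (x y : dom U) :
  sval x = sval y -> x = y.
Proof.
case: x y => x Ux [y Uy] /= e; subst y; congr exist.
exact: Prop_irrelevance.
Qed.

(* A section of O(k) over U is a function on the cone over U, homogeneous of
   degree k, which is locally a quotient of homogeneous polynomials. *)
Definition regular (K : closedFieldType) (k : int) (U : open K)
    (f : dom U -> K) : Prop :=
  forall x : dom U, exists (m n : nat) (p q : {mpoly K[4]}),
    [/\ p \is m.-homog, q \is n.-homog, m%:Z = n%:Z + k,
        ev q (sval x) != 0 &
        forall y : dom U, ev q (sval y) != 0 ->
          f y = ev p (sval y) / ev q (sval y)].

Definition regular_pred (K : closedFieldType) (k : int) (U : open K) :
  {pred (dom U -> K)} := fun f => `[< regular k f >].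
Arguments regular_pred : clear implicits.

Record reg (K : closedFieldType) (k : int) (U : open K) := Reg {
  regfun :> dom U -> K;
  regfunP : regular_pred K k U regfun }.
Arguments reg : clear implicits.
Arguments reg {K}.

HB.instance Definition _ (K : closedFieldType) k (U : open K) :=
  [isSub for @regfun K k U].
HB.instance Definition _ (K : closedFieldType) k (U : open K) :=
  [Choice of reg k U by <:].

Lemma regular0 (K : closedFieldType) k (U : open K) :
  regular k (0 : dom U -> K).
Proof.
move=> x.
case: k => k.
  exists k, 0%N, 0, 1; rewrite rpred0 dhomog1 add0r /ev meval1 oner_neq0.
  by split=> // y _; rewrite meval0 mul0r.
have [i xi] : exists i, val (sval x) 0 i != 0.
  apply: contrapT => nx; have /negP := valP (sval x); apply.
  apply/eqP/rowP => i; rewrite mxE; apply/eqP; apply: contrapT => /negP xi.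
  by apply: nx; exists i.
exists 0%N, k.+1, 0, ('X_i ^+ k.+1).
rewrite rpred0 /ev rmorphXn /= mevalXU expf_neq0 //; split=> //.
- have hX : ('X_i : {mpoly K[4]}) \is 1.-homog.
    by rewrite dhomogX; apply/eqP/mdeg1.
  by have := dhomogMn k.+1 hX; rewrite mul1n.
- by rewrite NegzE subrr.
- by move=> y _; rewrite meval0 mul0r.
Qed.

Lemma regularN (K : closedFieldType) k (U : open K) (f : dom U -> K) :
  regular k f -> regular k (- f).
Proof.
move=> hf x; have [m [n [p [q [hp hq e qx hy]]]]] := hf x.
exists m, n, (- p), q; split=> //; first by rewrite rpredN.
by move=> y qy; rewrite /ev mevalN mulNr -hy.
Qed.

Lemma regularD (K : closedFieldType) k (U : open K) (f g : dom U -> K) :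
  regular k f -> regular k g -> regular k (f + g).
Proof.
move=> hf hg x; have [m [n [p [q [hp hq e qx hy]]]]] := hf x.
have [m' [n' [p' [q' [hp' hq' e' qx' hy']]]]] := hg x.
exists (m + n')%N, (n + n')%N, (p * q' + p' * q), (q * q').
have em : (m + n' = m' + n)%N by move: e e'; lia.
split.
- by apply: rpredD; [exact: dhomogM | rewrite em; exact: dhomogM].
- exact: dhomogM.
- by rewrite !PoszD e addrAC.
- by rewrite /ev mevalM mulf_neq0.
- move=> y; rewrite /ev mevalM mulf_eq0 negb_or => /andP[qy qy'].
  by rewrite mevalD !mevalM -addf_div // -hy // -hy'.
Qed.

Lemma regularM (K : closedFieldType) k l (U : open K) (f g : dom U -> K) :
  regular k f -> regular l g -> regular (k + l) (f * g).
Proof.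
move=> hf hg x; have [m [n [p [q [hp hq e qx hy]]]]] := hf x.
have [m' [n' [p' [q' [hp' hq' e' qx' hy']]]]] := hg x.
exists (m + m')%N, (n + n')%N, (p * p'), (q * q'); split.
- exact: dhomogM.
- exact: dhomogM.
- by rewrite !PoszD e e' addrACA.
- by rewrite /ev mevalM mulf_neq0.
- move=> y; rewrite /ev mevalM mulf_eq0 negb_or => /andP[qy qy'].
  by rewrite mevalM -mulf_div -hy // -hy'.
Qed.

Lemma regular1 (K : closedFieldType) (U : open K) :
  regular 0 (1 : dom U -> K).
Proof.
move=> x; exists 0%N, 0%N, 1, 1; rewrite dhomog1 /ev meval1 oner_neq0.
by split=> // y _; rewrite meval1 divr1.
Qed.

Lemma regular_zmod_closed (K : closedFieldType) k (U : open K) :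
  zmod_closed (regular_pred K k U).
Proof.
split; first exact/asboolP/regular0.
by move=> f g /asboolP hf /asboolP hg; apply/asboolP/regularD/regularN.
Qed.

HB.instance Definition _ (K : closedFieldType) k (U : open K) :=
  GRing.isZmodClosed.Build (dom U -> K) (regular_pred K k U)
    (regular_zmod_closed k U).
HB.instance Definition _ (K : closedFieldType) k (U : open K) :=
  [SubChoice_isSubZmodule of reg k U by <:].

(* The structure sheaf; its sections are those of O(0). *)
Definition OP3 (K : closedFieldType) (U : open K) : Type := reg 0 U.
HB.instance Definition _ (K : closedFieldType) (U : open K) :=
  GRing.SubZmodule.copy (OP3 U) (reg 0 U).

Lemma regular_subring_closed (K : closedFieldType) (U : open K) :
  subring_closed (regular_pred K 0 U).
Proof.
split; first exact/asboolP/regular1.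
  by have [] := regular_zmod_closed 0 U.
move=> f g /asboolP hf /asboolP hg; apply/asboolP.
by rewrite -[0]addr0; apply: regularM.
Qed.

HB.instance Definition _ (K : closedFieldType) (U : open K) :=
  GRing.SubZmodule_isSubPzRing.Build (dom U -> K) (regular_pred K 0 U) (OP3 U)
    (regular_subring_closed U).
HB.instance Definition _ (K : closedFieldType) (U : open K) :=
  GRing.SubPzRing_isSubComPzRing.Build (dom U -> K) (regular_pred K 0 U)
    (OP3 U).

Lemma regular_scale (K : closedFieldType) k (U : open K) (a : OP3 U)
  (f : reg k U) : regular_pred K k U ((regfun a : dom U -> K) * regfun f).
Proof.
apply/asboolP; have /asboolP ha := regfunP a; have /asboolP hf := regfunP f.
by have := regularM ha hf; rewrite add0r.
Qed.

Definition reg_scale (K : closedFieldType) k (U : open K) (a : OP3 U)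
  (f : reg k U) : reg k U := Reg (regular_scale a f).

Lemma reg_scaleA (K : closedFieldType) k (U : open K) (a b : OP3 U)
  (f : reg k U) : reg_scale a (reg_scale b f) = reg_scale (a * b) f.
Proof. by apply: val_inj; rewrite /= mulrA. Qed.
Lemma reg_scale1 (K : closedFieldType) k (U : open K) :
  left_id (1 : OP3 U) (@reg_scale K k U).
Proof. by move=> f; apply: val_inj; rewrite /= mul1r. Qed.
Lemma reg_scaleDr (K : closedFieldType) k (U : open K) :
  right_distributive (@reg_scale K k U) +%R.
Proof. by move=> a f g; apply: val_inj; rewrite /= mulrDr. Qed.
Lemma reg_scaleDl (K : closedFieldType) k (U : open K) (f : reg k U) :
  {morph (@reg_scale K k U)^~ f : a b / a + b}.
Proof. by move=> a b; apply: val_inj; rewrite /= mulrDl. Qed.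

HB.instance Definition _ (K : closedFieldType) k (U : open K) :=
  GRing.Zmodule_isLmodule.Build (OP3 U) (reg k U)
    (@reg_scaleA K k U) (@reg_scale1 K k U) (@reg_scaleDr K k U)
    (@reg_scaleDl K k U).

Lemma regular_res (K : closedFieldType) k (U V : open K) (h : V <<= U)
  (f : reg k U) : regular_pred K k V (regfun f \o dom_sub h).
Proof.
apply/asboolP => x; have /asboolP/(_ (dom_sub h x)) := regfunP f.
move=> [m [n [p [q [hp hq e qx hy]]]]]; exists m, n, p, q; split=> // y qy.
exact: hy.
Qed.

Definition reg_res (K : closedFieldType) k (U V : open K) (h : V <<= U)
  (f : reg k U) : reg k V := Reg (regular_res h f).

Definition resO (K : closedFieldType) (U V : open K) (h : V <<= U)
  (a : OP3 U) : OP3 V := reg_res h a.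

(* Presheaves of modules over the structure sheaf. *)
Record omodule (K : closedFieldType) := OModule {
  sec :> forall U : open K, lmodType (OP3 U);
  res : forall U V : open K, V <<= U -> sec U -> sec V;
  res_linear : forall (U V : open K) (h : V <<= U) (a : OP3 U) (s t : sec U),
    res h (a *: s + t) = resO h a *: res h s + res h t;
  res_id : forall (U : open K) (h : U <<= U) (s : sec U), res h s = s;
  res_comp : forall (U V W : open K) (h : V <<= U) (h' : W <<= V)
    (h'' : W <<= U) (s : sec U), res h' (res h s) = res h'' s }.
Arguments res {K} o {U V} h s.

Definition is_sheaf (K : closedFieldType) (F : omodule K) : Prop :=
  forall (I : Type) (U : open K) (V : I -> open K) (h : forall i, V i <<= U),
    (forall x, U x -> exists i, V i x) ->
  forall s : forall i, F (V i),
    (forall i j (W : open K) (hi : W <<= V i) (hj : W <<= V j),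
      res F hi (s i) = res F hj (s j)) ->
  exists! t : F U, forall i, res F (h i) t = s i.

(* Morphisms; exactness is exactness as sheaves (images are taken locally). *)
Record omod_hom (K : closedFieldType) (F G : omodule K) := Hom {
  happ :> forall U : open K, F U -> G U;
  hom_linear : forall U : open K, linear (@happ U);
  hom_res : forall (U V : open K) (h : V <<= U) (s : F U),
    @happ V (res F h s) = res G h (@happ U s) }.
Arguments happ {K F G} _ U _.

Definition isomorphic (K : closedFieldType) (F G : omodule K) : Prop :=
  exists f : omod_hom F G, forall U : open K, bijective (f U).

Definition short_exact (K : closedFieldType) (A B C : omodule K)
    (f : omod_hom A B) (g : omod_hom B C) : Prop :=
  [/\ forall U : open K, injective (f U),
      forall (U : open K) (b : B U), g U b = 0 <->
        locally (fun (V : open K) (h : V <<= U) =>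
          exists a : A V, f V a = res B h b)
    & forall (U : open K) (c : C U),
        locally (fun (V : open K) (h : V <<= U) =>
          exists b : B V, g V b = res C h c)].

Lemma reg_res_linear (K : closedFieldType) k (U V : open K) (h : V <<= U)
  (a : OP3 U) (s t : reg k U) :
  reg_res h (a *: s + t) = resO h a *: reg_res h s + reg_res h t.
Proof. exact: val_inj. Qed.
Lemma reg_res_id (K : closedFieldType) k (U : open K) (h : U <<= U)
  (s : reg k U) : reg_res h s = s.
Proof.
by apply: val_inj; apply/funext => x; congr (regfun s _); apply: dom_inj.
Qed.
Lemma reg_res_comp (K : closedFieldType) k (U V W : open K) (h : V <<= U)
  (h' : W <<= V) (h'' : W <<= U) (s : reg k U) :
  reg_res h' (reg_res h s) = reg_res h'' s.
Proof.
by apply: val_inj; apply/funext => x; congr (regfun s _); apply: dom_inj.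
Qed.

Lemma reg_res_sum (K : closedFieldType) k (U V : open K) (h : V <<= U)
  (n : nat) (a : 'I_n -> OP3 U) (t : 'I_n -> reg k U) :
  reg_res h (\sum_j a j *: t j) = \sum_j resO h (a j) *: reg_res h (t j).
Proof.
elim: n a t => [|n IH] a t; first by rewrite !big_ord0; exact: val_inj.
by rewrite !big_ord_recl addrC [RHS]addrC -IH; exact: val_inj.
Qed.

Definition twist (K : closedFieldType) (k : int) : omodule K :=
  OModule (@reg_res_linear K k) (@reg_res_id K k) (@reg_res_comp K k).
Arguments twist {K} k.

(* Ideal sheaves: subsheaves of ideals of the structure sheaf. *)
Record ideal (K : closedFieldType) := Ideal {
  mem_ideal :> forall U : open K, OP3 U -> Prop;
  ideal0 : forall U : open K, @mem_ideal U 0;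
  idealD : forall (U : open K) (a b : OP3 U),
    mem_ideal a -> mem_ideal b -> mem_ideal (a + b);
  idealM : forall (U : open K) (a b : OP3 U),
    mem_ideal b -> mem_ideal (a * b);
  ideal_res : forall (U V : open K) (h : V <<= U) (a : OP3 U),
    mem_ideal a -> mem_ideal (resO h a);
  ideal_local : forall (U : open K) (a : OP3 U),
    locally (fun (V : open K) (h : V <<= U) => mem_ideal (resO h a)) ->
    mem_ideal a }.
Arguments mem_ideal {K} _ U _.

(* I(k), realised as the image of I (x) O(k) in O(k) (isomorphic to the tensor
   product, O(k) being invertible). *)
Definition in_itwist (K : closedFieldType) (I : ideal K) (k : int)
    (U : open K) : {pred (reg k U)} :=
  fun s => `[< locally (fun (V : open K) (h : V <<= U) =>
    exists (n : nat) (a : 'I_n -> OP3 V) (t : 'I_n -> reg k V),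
      (forall j, I V (a j)) /\ reg_res h s = \sum_j a j *: t j) >].
Arguments in_itwist {K} I k U _.

Lemma in_itwist_submod (K : closedFieldType) (I : ideal K) k (U : open K) :
  submod_closed (in_itwist I k U).
Proof.
split.
  apply/asboolP => x Ux; exists U, (fun _ h => h); split=> //.
  exists 0%N, (fun _ => 0), (fun _ => 0); split; first by case.
  by rewrite big_ord0; exact: val_inj.
move=> c s t /asboolP hs /asboolP ht; apply/asboolP => x Ux.
have [V [hV [Vx [n [a [u [Ia es]]]]]]] := hs _ Ux.
have [W [hW [Wx [m [b [v [Ib et]]]]]]] := ht _ Ux.
have iV : openI V W <<= V by move=> y [].
have iW : openI V W <<= W by move=> y [].
have iU : openI V W <<= U by move=> y [/hV].
exists (openI V W), iU; split=> //.
exists (n + m)%N.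
exists (fun j => match fintype.split j with inl j => resO iU c * resO iV (a j)
                                  | inr j => resO iW (b j) end).
exists (fun j => match fintype.split j with inl j => reg_res iV (u j)
                                  | inr j => reg_res iW (v j) end).
split.
  move=> j; case: fintype.split => i; last exact: ideal_res.
  exact/idealM/ideal_res.
have eql i : fintype.split (lshift m i) = inl i := unsplitK (inl i).
have eqr i : fintype.split (rshift n i) = inr i := unsplitK (inr i).
rewrite big_split_ord /= reg_res_linear.
under [X in _ = X + _]eq_bigr do rewrite eql -scalerA.
under [X in _ = _ + X]eq_bigr do rewrite eqr.
by rewrite -scaler_sumr -!reg_res_sum -es -et !(reg_res_comp _ _ iU).
Qed.

Record itwist_sec (K : closedFieldType) (I : ideal K) (k : int) (U : open K) :=
  ItwistSec { itwist_reg :> reg k U; itwist_secP : in_itwist I k U itwist_reg }.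

HB.instance Definition _ (K : closedFieldType) (I : ideal K) k (U : open K) :=
  [isSub for @itwist_reg K I k U].
HB.instance Definition _ (K : closedFieldType) (I : ideal K) k (U : open K) :=
  [Choice of itwist_sec I k U by <:].
HB.instance Definition _ (K : closedFieldType) (I : ideal K) k (U : open K) :=
  GRing.isSubmodClosed.Build (OP3 U) (reg k U) (in_itwist I k U)
    (in_itwist_submod I k U).
HB.instance Definition _ (K : closedFieldType) (I : ideal K) k (U : open K) :=
  [SubChoice_isSubLmodule of itwist_sec I k U by <:].

Lemma in_itwist_res (K : closedFieldType) (I : ideal K) k (U V : open K)
  (h : V <<= U) (s : itwist_sec I k U) : in_itwist I k V (reg_res h s).
Proof.
apply/asboolP => x Vx; have /asboolP hs := itwist_secP s.
have [W [hW [Wx [n [a [t [Ia es]]]]]]] := hs _ (h _ Vx).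
have iV : openI V W <<= V by move=> y [].
have iW : openI V W <<= W by move=> y [].
have iU : openI V W <<= U by move=> y [_ /hW].
exists (openI V W), iV; split=> //.
exists n, (fun j => resO iW (a j)), (fun j => reg_res iW (t j)); split.
  by move=> j; exact: ideal_res.
by rewrite -reg_res_sum -es !(reg_res_comp _ _ iU).
Qed.

Definition itwist_res (K : closedFieldType) (I : ideal K) k (U V : open K)
  (h : V <<= U) (s : itwist_sec I k U) : itwist_sec I k V :=
  ItwistSec (in_itwist_res h s).

Lemma itwist_res_linear (K : closedFieldType) (I : ideal K) k (U V : open K)
  (h : V <<= U) (a : OP3 U) (s t : itwist_sec I k U) :
  itwist_res h (a *: s + t) = resO h a *: itwist_res h s + itwist_res h t.
Proof. by apply: val_inj; exact: reg_res_linear. Qed.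
Lemma itwist_res_id (K : closedFieldType) (I : ideal K) k (U : open K)
  (h : U <<= U) (s : itwist_sec I k U) : itwist_res h s = s.
Proof. by apply: val_inj; exact: reg_res_id. Qed.
Lemma itwist_res_comp (K : closedFieldType) (I : ideal K) k (U V W : open K)
  (h : V <<= U) (h' : W <<= V) (h'' : W <<= U) (s : itwist_sec I k U) :
  itwist_res h' (itwist_res h s) = itwist_res h'' s.
Proof. by apply: val_inj; exact: reg_res_comp. Qed.

Definition itwist (K : closedFieldType) (I : ideal K) (k : int) : omodule K :=
  OModule (@itwist_res_linear K I k) (@itwist_res_id K I k)
    (@itwist_res_comp K I k).

(* Families of maps F(V) -> G(V), V in U; local homomorphisms and vector fields
   are such families. *)
Definition fam (K : closedFieldType) (F G : omodule K) (U : open K) : Type :=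
  forall V : open K, V <<= U -> F V -> G V.

HB.instance Definition _ (K : closedFieldType) (F G : omodule K) (U : open K) :=
  gen_eqMixin (fam F G U).
HB.instance Definition _ (K : closedFieldType) (F G : omodule K) (U : open K) :=
  gen_choiceMixin (fam F G U).

Lemma fam_ext (K : closedFieldType) (F G : omodule K) (U : open K)
  (f g : fam F G U) : (forall V h s, f V h s = g V h s) -> f = g.
Proof.
move=> e; apply: functional_extensionality_dep => V.
by apply: functional_extensionality_dep => h; apply/funext => s.
Qed.

Definition fam_zero (K : closedFieldType) (F G : omodule K) (U : open K) :
  fam F G U := fun _ _ _ => 0.
Definition fam_opp (K : closedFieldType) (F G : omodule K) (U : open K)
  (f : fam F G U) : fam F G U := fun V h s => - f V h s.
Definition fam_add (K : closedFieldType) (F G : omodule K) (U : open K)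
  (f g : fam F G U) : fam F G U := fun V h s => f V h s + g V h s.

Lemma fam_addA (K : closedFieldType) (F G : omodule K) (U : open K) :
  associative (@fam_add K F G U).
Proof. by move=> *; apply: fam_ext => *; exact: addrA. Qed.
Lemma fam_addC (K : closedFieldType) (F G : omodule K) (U : open K) :
  commutative (@fam_add K F G U).
Proof. by move=> *; apply: fam_ext => *; exact: addrC. Qed.
Lemma fam_add0 (K : closedFieldType) (F G : omodule K) (U : open K) :
  left_id (@fam_zero K F G U) (@fam_add K F G U).
Proof. by move=> *; apply: fam_ext => *; exact: add0r. Qed.
Lemma fam_addN (K : closedFieldType) (F G : omodule K) (U : open K) :
  left_inverse (@fam_zero K F G U) (@fam_opp K F G U) (@fam_add K F G U).
Proof. by move=> *; apply: fam_ext => *; exact: addNr. Qed.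

HB.instance Definition _ (K : closedFieldType) (F G : omodule K) (U : open K) :=
  GRing.isZmodule.Build (fam F G U) (@fam_addA K F G U) (@fam_addC K F G U)
    (@fam_add0 K F G U) (@fam_addN K F G U).

Lemma resO_zmod (K : closedFieldType) (U V : open K) (h : V <<= U)
  (a b : OP3 U) :
  [/\ resO h 1 = 1, resO h (a + b) = resO h a + resO h b
    & resO h (a * b) = resO h a * resO h b].
Proof. by split; exact: val_inj. Qed.

Definition fam_scale (K : closedFieldType) (F G : omodule K) (U : open K)
  (a : OP3 U) (f : fam F G U) : fam F G U := fun V h s => resO h a *: f V h s.

Lemma fam_scaleA (K : closedFieldType) (F G : omodule K) (U : open K)
  (a b : OP3 U) (f : fam F G U) :
  fam_scale a (fam_scale b f) = fam_scale (a * b) f.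
Proof.
apply: fam_ext => V h s; rewrite /fam_scale scalerA.
by have [_ _ ->] := resO_zmod h a b.
Qed.
Lemma fam_scale1 (K : closedFieldType) (F G : omodule K) (U : open K) :
  left_id (1 : OP3 U) (@fam_scale K F G U).
Proof.
move=> f; apply: fam_ext => V h s; rewrite /fam_scale.
by have [-> _ _] := resO_zmod h 1 1; rewrite scale1r.
Qed.
Lemma fam_scaleDr (K : closedFieldType) (F G : omodule K) (U : open K) :
  right_distributive (@fam_scale K F G U) +%R.
Proof. by move=> a f g; apply: fam_ext => *; exact: scalerDr. Qed.
Lemma fam_scaleDl (K : closedFieldType) (F G : omodule K) (U : open K)
  (f : fam F G U) : {morph (@fam_scale K F G U)^~ f : a b / a + b}.
Proof.
move=> a b; apply: fam_ext => V h s; rewrite /fam_scale.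
by have [_ -> _] := resO_zmod h a b; rewrite scalerDl.
Qed.

HB.instance Definition _ (K : closedFieldType) (F G : omodule K) (U : open K) :=
  GRing.Zmodule_isLmodule.Build (OP3 U) (fam F G U) (@fam_scaleA K F G U)
    (@fam_scale1 K F G U) (@fam_scaleDr K F G U) (@fam_scaleDl K F G U).

Lemma fam_scaleDE (K : closedFieldType) (F G : omodule K) (U : open K)
  (a : OP3 U) (f g : fam F G U) V h s :
  (a *: f + g) V h s = resO h a *: f V h s + g V h s.
Proof. by []. Qed.

Lemma sub_open_trans (K : closedFieldType) (U V W : open K) :
  V <<= U -> W <<= V -> W <<= U.
Proof. by move=> h h' x /h' /h. Qed.

Definition fam_res (K : closedFieldType) (F G : omodule K) (U V : open K)
  (h : V <<= U) (f : fam F G U) : fam F G V :=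
  fun W h' s => f W (sub_open_trans h h') s.

Definition compatible (K : closedFieldType) (F G : omodule K) (U : open K)
    (f : fam F G U) : Prop :=
  forall (V W : open K) (h : V <<= U) (h' : W <<= V) (h'' : W <<= U) (s : F V),
    f W h'' (res F h' s) = res G h' (f V h s).

Definition is_lochom (K : closedFieldType) (F G : omodule K) (U : open K) :
    {pred (fam F G U)} :=
  fun f => `[< compatible f /\
    forall (V : open K) (h : V <<= U), linear (f V h) >].
Arguments is_lochom {K} F G U _.

Lemma res0 (K : closedFieldType) (F : omodule K) (U V : open K) (h : V <<= U) :
  res F h 0 = 0.
Proof.
have := res_linear h (-1) (0 : F U) 0; rewrite scaler0 addr0.
have -> : resO h (-1) = -1 by exact: val_inj.
by rewrite scaleN1r addNr.
Qed.

Lemma is_lochom_submod (K : closedFieldType) (F G : omodule K) (U : open K) :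
  submod_closed (is_lochom F G U).
Proof.
split.
  apply/asboolP; split=> [V W h h' h'' s|V h a s t]; first by rewrite res0.
  by rewrite scaler0 addr0.
move=> a f g /asboolP[cf lf] /asboolP[cg lg]; apply/asboolP; split.
  move=> V W h h' h'' s; rewrite !fam_scaleDE.
  rewrite (cf _ _ h h') (cg _ _ h h') res_linear.
  by congr (_ *: _ + _); exact/esym/(reg_res_comp h h' h'').
move=> V h b s t; rewrite !fam_scaleDE lf lg !scalerDr !scalerA addrACA.
by rewrite [resO h a * b]mulrC.
Qed.

Record lochom (K : closedFieldType) (F G : omodule K) (U : open K) := Lochom {
  lochom_fam :> fam F G U;
  lochomP : is_lochom F G U lochom_fam }.
Arguments lochom_fam {K F G U} _ V _ _.

HB.instance Definition _ (K : closedFieldType) (F G : omodule K) (U : open K) :=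
  [isSub for @lochom_fam K F G U].
HB.instance Definition _ (K : closedFieldType) (F G : omodule K) (U : open K) :=
  [Choice of lochom F G U by <:].
HB.instance Definition _ (K : closedFieldType) (F G : omodule K) (U : open K) :=
  GRing.isSubmodClosed.Build (OP3 U) (fam F G U) (is_lochom F G U)
    (is_lochom_submod F G U).
HB.instance Definition _ (K : closedFieldType) (F G : omodule K) (U : open K) :=
  [SubChoice_isSubLmodule of lochom F G U by <:].

Lemma is_lochom_res (K : closedFieldType) (F G : omodule K) (U V : open K)
  (h : V <<= U) (f : lochom F G U) : is_lochom F G V (fam_res h f).
Proof.
have /asboolP[cf lf] := lochomP f.
by apply/asboolP; split=> [W W' k k' k'' s|W k]; [exact: cf | exact: lf].
Qed.

Definition lochom_res (K : closedFieldType) (F G : omodule K) (U V : open K)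
  (h : V <<= U) (f : lochom F G U) : lochom F G V := Lochom (is_lochom_res h f).

Lemma fam_res_linear (K : closedFieldType) (F G : omodule K) (U V : open K)
  (h : V <<= U) (a : OP3 U) (f g : fam F G U) :
  fam_res h (a *: f + g) = resO h a *: fam_res h f + fam_res h g.
Proof.
apply: fam_ext => W k s; congr (_ *: _ + _).
exact/esym/(reg_res_comp h k (sub_open_trans h k)).
Qed.
Lemma fam_res_id (K : closedFieldType) (F G : omodule K) (U : open K)
  (h : U <<= U) (f : fam F G U) : fam_res h f = f.
Proof.
by apply: fam_ext => V k s; congr (f V _ s); exact: Prop_irrelevance.
Qed.
Lemma fam_res_comp (K : closedFieldType) (F G : omodule K) (U V W : open K)
  (h : V <<= U) (h' : W <<= V) (h'' : W <<= U) (f : fam F G U) :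
  fam_res h' (fam_res h f) = fam_res h'' f.
Proof.
by apply: fam_ext => W' k s; congr (f W' _ s); exact: Prop_irrelevance.
Qed.

Lemma lochom_res_linear (K : closedFieldType) (F G : omodule K) (U V : open K)
  (h : V <<= U) (a : OP3 U) (f g : lochom F G U) :
  lochom_res h (a *: f + g) = resO h a *: lochom_res h f + lochom_res h g.
Proof. by apply: val_inj; exact: fam_res_linear. Qed.
Lemma lochom_res_id (K : closedFieldType) (F G : omodule K) (U : open K)
  (h : U <<= U) (f : lochom F G U) : lochom_res h f = f.
Proof. by apply: val_inj; exact: fam_res_id. Qed.
Lemma lochom_res_comp (K : closedFieldType) (F G : omodule K) (U V W : open K)
  (h : V <<= U) (h' : W <<= V) (h'' : W <<= U) (f : lochom F G U) :
  lochom_res h' (lochom_res h f) = lochom_res h'' f.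
Proof. by apply: val_inj; exact: fam_res_comp. Qed.

Definition sheafHom (K : closedFieldType) (F G : omodule K) : omodule K :=
  OModule (@lochom_res_linear K F G) (@lochom_res_id K F G)
    (@lochom_res_comp K F G).

Definition odual (K : closedFieldType) (F : omodule K) : omodule K :=
  sheafHom F (twist 0).

Definition bidual_fam (K : closedFieldType) (F : omodule K) (U : open K)
    (s : F U) : fam (odual F) (twist 0) U :=
  fun V h (phi : lochom F (twist 0) V) =>
    lochom_fam phi V (fun _ Vx => Vx) (res F h s).

Lemma bidual_lochom (K : closedFieldType) (F : omodule K) (U : open K)
  (s : F U) : is_lochom (odual F) (twist 0) U (bidual_fam s).
Proof.
apply/asboolP; split.
  move=> V W h h' h'' phi; rewrite /bidual_fam.
  have /asboolP[cphi _] := lochomP phi.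
  rewrite -(res_comp h h' h'') -(cphi _ _ _ _ h') /=.
  by congr (lochom_fam phi _ _); exact: Prop_irrelevance.
move=> V h a phi psi; rewrite /bidual_fam.
by congr (_ *: _ + _); exact: reg_res_id.
Qed.

Definition bidual_map (K : closedFieldType) (F : omodule K) (U : open K)
  (s : F U) : odual (odual F) U := Lochom (bidual_lochom s).
Arguments bidual_map {K} F U _.

(* The tangent sheaf: K-linear derivations of the structure sheaf. *)
Definition is_deriv (K : closedFieldType) (U : open K) :
    {pred (fam (twist 0) (twist 0) U)} :=
  fun D => `[< compatible D /\
    forall (V : open K) (h : V <<= U),
      [/\ forall a b, D V h (a + b) = D V h a + D V h b,
          forall (c : K) (a : reg 0 V), (forall x, a x = c) -> D V h a = 0
        & forall a b : OP3 V, D V h (a * b) = a *: D V h b + b *: D V h a] >].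
Arguments is_deriv {K} U _.

Lemma is_deriv_submod (K : closedFieldType) (U : open K) :
  submod_closed (@is_deriv K U).
Proof.
split.
  apply/asboolP; split=> [V W h h' h'' s|V h]; first by rewrite res0.
  by split=> *; rewrite ?scaler0 ?addr0.
move=> a f g /asboolP[cf lf] /asboolP[cg lg]; apply/asboolP; split.
  move=> V W h h' h'' s; rewrite !fam_scaleDE (cf _ _ h h') (cg _ _ h h').
  rewrite [RHS](@res_linear K (twist 0)).
  by congr (_ *: _ + _); exact/esym/(reg_res_comp h h' h'').
move=> V h; have [af kf df] := lf V h; have [ag kg dg] := lg V h; split.
- by move=> b c; rewrite !fam_scaleDE af ag scalerDr addrACA.
- by move=> c b hb; rewrite fam_scaleDE (kf c) // (kg c) // scaler0 addr0.
- move=> b c; rewrite !fam_scaleDE df dg !scalerDr !scalerA addrACA.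
  by rewrite [resO h a * b]mulrC [resO h a * c]mulrC.
Qed.

Record vfield (K : closedFieldType) (U : open K) := Vfield {
  vfield_fam :> fam (twist 0) (twist 0) U;
  vfieldP : is_deriv U vfield_fam }.
Arguments vfield_fam {K U} _ V _ _.

HB.instance Definition _ (K : closedFieldType) (U : open K) :=
  [isSub for @vfield_fam K U].
HB.instance Definition _ (K : closedFieldType) (U : open K) :=
  [Choice of vfield U by <:].
HB.instance Definition _ (K : closedFieldType) (U : open K) :=
  GRing.isSubmodClosed.Build (OP3 U) (fam (twist 0) (twist 0) U) (is_deriv U)
    (is_deriv_submod U).
HB.instance Definition _ (K : closedFieldType) (U : open K) :=
  [SubChoice_isSubLmodule of vfield U by <:].

Lemma is_deriv_res (K : closedFieldType) (U V : open K) (h : V <<= U)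
  (D : vfield U) : is_deriv V (fam_res h D).
Proof.
have /asboolP[cD lD] := vfieldP D.
by apply/asboolP; split=> [W W' k k' k'' s|W k]; [exact: cD | exact: lD].
Qed.

Definition vfield_res (K : closedFieldType) (U V : open K) (h : V <<= U)
  (D : vfield U) : vfield V := Vfield (is_deriv_res h D).

Lemma vfield_res_linear (K : closedFieldType) (U V : open K) (h : V <<= U)
  (a : OP3 U) (D E : vfield U) :
  vfield_res h (a *: D + E) = resO h a *: vfield_res h D + vfield_res h E.
Proof. by apply: val_inj; exact: fam_res_linear. Qed.
Lemma vfield_res_id (K : closedFieldType) (U : open K) (h : U <<= U)
  (D : vfield U) : vfield_res h D = D.
Proof. by apply: val_inj; exact: fam_res_id. Qed.
Lemma vfield_res_comp (K : closedFieldType) (U V W : open K) (h : V <<= U)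
  (h' : W <<= V) (h'' : W <<= U) (D : vfield U) :
  vfield_res h' (vfield_res h D) = vfield_res h'' D.
Proof. by apply: val_inj; exact: fam_res_comp. Qed.

Definition tangentP3 (K : closedFieldType) : omodule K :=
  OModule (@vfield_res_linear K) (@vfield_res_id K) (@vfield_res_comp K).

(* P^3 is Noetherian, so coherent means locally of finite presentation. *)
Definition coherent (K : closedFieldType) (F : omodule K) : Prop :=
  is_sheaf F /\
  forall x : pt K, exists (U : open K) (m n : nat) (s : 'I_n -> F U)
      (r : 'I_m -> 'I_n -> OP3 U),
    U x /\ forall (V : open K) (h : V <<= U),
      (forall t : F V, locally (fun (W : open K) (k : W <<= V) =>
         exists a : 'I_n -> OP3 W,
           res F k t = \sum_j a j *: res F (sub_open_trans h k) (s j))) /\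
      (forall a : 'I_n -> OP3 V, \sum_j a j *: res F h (s j) = 0 <->
         locally (fun (W : open K) (k : W <<= V) =>
           exists b : 'I_m -> OP3 W, forall j,
             resO k (a j) = \sum_i b i * resO (sub_open_trans h k) (r i j))).

Definition reflexive_sheaf (K : closedFieldType) (F : omodule K) : Prop :=
  coherent F /\ forall U : open K, bijective (bidual_map F U).

Definition nonempty (K : closedFieldType) (U : open K) : Prop := exists x, U x.

(* The generic stalk (the colimit of F(V) over nonempty open V) has dimension r
   over the function field: it has a basis of r germs, which may be taken to be
   germs of sections over a common open set. *)
Definition has_rank (K : closedFieldType) (F : omodule K) (r : nat) : Prop :=
  exists (U : open K) (s : 'I_r -> F U), nonempty U /\
    (forall (V : open K) (t : F V), nonempty V ->
       exists (W : open K) (h : W <<= U) (k : W <<= V) (a : 'I_r -> OP3 W),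
         nonempty W /\ res F k t = \sum_j a j *: res F h (s j)) /\
    (forall (V : open K) (h : V <<= U) (a : 'I_r -> OP3 V), nonempty V ->
       \sum_j a j *: res F h (s j) = 0 -> forall j, a j = 0).

Definition zariski_closed (K : closedFieldType) (Z : set (pt K)) : Prop :=
  zariski_open (~` Z).

Definition irreducible_closed (K : closedFieldType) (Z : set (pt K)) : Prop :=
  [/\ zariski_closed Z, Z !=set0 &
      forall A B : set (pt K), zariski_closed A -> zariski_closed B ->
        Z `<=` A `|` B -> Z `<=` A \/ Z `<=` B].

(* Every irreducible closed W in Z starts a chain W = c 0 < ... < c n of
   irreducible closed subsets of P^3. *)
Definition codim_ge (K : closedFieldType) (Z : set (pt K)) (n : nat) : Prop :=
  forall W : set (pt K), irreducible_closed W -> W `<=` Z ->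
    exists c : nat -> set (pt K),
      [/\ c 0%N = W, forall i, (i <= n)%N -> irreducible_closed (c i) &
          forall i, (i < n)%N -> c i `<` c i.+1].

Definition zero_locus (K : closedFieldType) (I : ideal K) : set (pt K) :=
  [set x | forall (U : open K) (a : OP3 U), I U a ->
     forall y : dom U, sval y = x -> a y = 0].

Definition is_line (K : closedFieldType) (L : set (pt K)) : Prop :=
  exists2 A : 'M[K]_(2, 4), \rank A = 2%N & L = [set x | (val x <= A)%MS].

(* The ideal sheaf of the closed set L with its reduced structure. *)
Definition vanishing (K : closedFieldType) (L : set (pt K)) (U : open K)
    (a : OP3 U) : Prop :=
  forall x : dom U, L (sval x) -> a x = 0.

Lemma vanishing_local (K : closedFieldType) (L : set (pt K)) (U : open K)
  (a : OP3 U) :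
  locally (fun (V : open K) (h : V <<= U) => vanishing L (resO h a)) ->
  vanishing L a.
Proof.
move=> ha x Lx; have [V [h [Vx /(_ (exist _ _ Vx) Lx) <-]]] := ha _ (svalP x).
by congr (regfun a _); exact: dom_inj.
Qed.

Lemma vanishing0 (K : closedFieldType) (L : set (pt K)) (U : open K) :
  vanishing L (0 : OP3 U).
Proof. by []. Qed.
Lemma vanishingD (K : closedFieldType) (L : set (pt K)) (U : open K)
  (a b : OP3 U) : vanishing L a -> vanishing L b -> vanishing L (a + b).
Proof.
move=> ha hb x Lx; have : a x + b x = 0 by rewrite ha // hb // addr0.
by [].
Qed.
Lemma vanishingM (K : closedFieldType) (L : set (pt K)) (U : open K)
  (a b : OP3 U) : vanishing L b -> vanishing L (a * b).
Proof.
move=> hb x Lx; have : a x * b x = 0 by rewrite hb // mulr0.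
by [].
Qed.
Lemma vanishing_res (K : closedFieldType) (L : set (pt K)) (U V : open K)
  (h : V <<= U) (a : OP3 U) : vanishing L a -> vanishing L (resO h a).
Proof. by move=> ha x Lx; exact: ha. Qed.

Definition ideal_of (K : closedFieldType) (L : set (pt K)) : ideal K :=
  Ideal (@vanishing0 K L) (@vanishingD K L) (@vanishingM K L)
    (@vanishing_res K L) (@vanishing_local K L).

(* 0 -> tangent -> TP^3 -> I_Z(d+2) -> 0.  The closed subscheme Z is given by
   its ideal sheaf [sing]; [itwist sing 0] is that ideal sheaf as a module. *)
Record distribution (K : closedFieldType) (d : nat) := Distribution {
  tangent : omodule K;
  sing : ideal K;
  dist_incl : omod_hom tangent (tangentP3 K);
  dist_form : omod_hom (tangentP3 K) (itwist sing (d%:Z + 2));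
  tangent_reflexive : reflexive_sheaf tangent;
  tangent_rank : has_rank tangent 2;
  sing_coherent : coherent (itwist sing 0);
  sing_codim : codim_ge (zero_locus sing) 2;
  dist_exact : short_exact dist_incl dist_form }.

(* Main.v *)
(* Let x, y, z, w be linear coordinates with L = {x = y = 0}.  The multiplications
   by x and y from O(1-d) to I_L(2-d) lift to maps sx, sy into F because
   H^1(O(d-1)) = 0, and x sy - y sx = f for a form f of degree d, the class of the
   extension.  Hence F is locally generated by the given section 1 and by the images
   of sx and sy, with this single relation.  As F is reflexive, f is not in (x, y);
   after a change of coordinates and of the lifts, f is a form in z and w that is
   not divisible by z.  The map
     1 |-> x d/dx + y d/dy,   sx |-> - f d/dy + z^(d-1) x d/dw,
     sy |-> f d/dx + z^(d-1) y d/dw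
   respects the relation and identifies F with the kernel of the contraction with
     f (z dw - w dz) + z^d (x dy - y dx).
   This 1-form vanishes only on the lines {x = y = 0} and {z = w = 0}. *)

(* Cohomology is replaced throughout by clearing denominators. To globalise a local assertion one
   collects the forms [g] for which it holds after multiplication by [g], or away from the zeros of
   [g]. They make up a homogeneous ideal, and the Nullstellensatz puts a power of a given form into
   it. This serves as finite subcover, partition of unity and common denominator alike. Reflexivity
   acts at one point. If [f] were in [(x, y)], the lifts could be changed to make it zero, and the
   double dual would supply a section of [F] whose image in [O(2-d)] does not vanish at some point
   of [L]. The exponent [d-1] is forced by degrees: [sx] starts from [O(1-d)], so the coefficient of
   [d/dw] in its image has degree [d]. The choice of [z] serves twice: [f] is prime to [z^d], which
   makes the kernel computable, and [f = z = 0] leaves only [z = w = 0]. The scheme [Z] is not given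
   by equations. Its ideal is by definition the image of the contraction, suitably twisted, so that
   surjectivity is built in; what has to be proved is that this ideal is coherent and that its zeros
   have codimension 2. *)
From HB Require Import structures.
Require Import Defs.
From mathcomp Require Import all_boot all_order all_algebra perm.
From mathcomp Require Import boolp classical_sets functions reals complex.
From mathcomp Require Import mpoly.
From mathcomp Require Import zify ring lra.

Set Implicit Arguments.
Unset Strict Implicit.
Unset Printing Implicit Defensive.

Import Order.TTheory GRing.Theory Num.Theory.
Local Open Scope ring_scope.
Local Open Scope classical_set_scope.

(* Uncountable types have this property, which replaces finiteness theorems for
   algebras in the proof of the Nullstellensatz. *)
Definition has_infinite_fibers (T : eqType) : Prop :=
  forall f : T -> nat, exists N, forall M : nat,
    exists2 s : seq T, uniq s & size s = M /\ all (fun c => f c == N) s.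

Lemma ideal_split (R : comPzRingType) (a b c u v : R) :
  a * b * c = a * c * (b - u * v) + u * (a * (v * c)).
Proof. ring. Qed.

(** * The Nullstellensatz over an uncountable field *)

Section Nullstellensatz.
Variables (K : closedFieldType) (n : nat).
Hypothesis K_fibers : has_infinite_fibers K.
Notation S := {mpoly K[n]}.

Record is_ideal (J : S -> Prop) : Prop := IsIdeal {
  is_ideal0 : J 0;
  is_idealD : forall p q, J p -> J q -> J (p + q);
  is_idealM : forall p q, J q -> J (p * q) }.

Lemma is_ideal_sum (J : S -> Prop) (I : Type) (r : seq I) (P : pred I)
  (F : I -> S) : is_ideal J -> (forall i, P i -> J (F i)) ->
  J (\sum_(i <- r | P i) F i).
Proof.
move=> hJ hF; apply: (big_ind J); first exact: is_ideal0.
  exact: is_idealD.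
exact: hF.
Qed.

(** Polynomials of bounded degree form a space of finite dimension; one more of them than this
    dimension gives a coefficient matrix with a left kernel. *)
Lemma linear_dependence (D : nat) : exists r, forall s : 'I_r -> S,
  (forall j, (msize (s j) <= D)%N) ->
  exists2 a : 'I_r -> K, exists j, a j != 0 & \sum_j a j *: s j = 0.
Proof.
pose T : finType := 'X_{1..n < D}; exists #|T|.+1 => s hs.
pose A := \matrix_(i < #|T|.+1, j < #|T|) (s i)@_(enum_val j : T).
have : kermx A != 0.
  rewrite kermx_eq0 /row_free; apply/eqP => e.
  by have := rank_leq_col A; rewrite e ltnn.
case/rowV0Pn => v /sub_kermxP vA v0.
exists (fun j => v 0 j).
  apply/existsP; apply: contraNT v0; rewrite negb_exists => /forallP h.
  by apply/eqP/rowP => j; rewrite mxE; apply/eqP; move: (h j); rewrite negbK.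
apply/mpolyP => m; rewrite mcoeff0 raddf_sum /=.
have [mD|mD] := ltnP (mdeg m) D; last first.
  rewrite big1 // => j _; rewrite mcoeffZ memN_msupp_eq0 ?mulr0 //.
  by apply/negP => /msize_mdeg_lt; rewrite ltnNge (leq_trans (hs j)).
have := congr1 (fun B : 'rV_ #|T| => B 0 (enum_rank (BMultinom mD : T))) vA.
rewrite !mxE => {2}<-; apply: eq_bigr => j _.
by rewrite mcoeffZ !mxE enum_rankK.
Qed.

Definition adjoin (J : S -> Prop) (q : S) : S -> Prop :=
  fun p => exists a b, J a /\ p = a + b * q.

Lemma adjoin_ideal J q : is_ideal J -> is_ideal (adjoin J q).
Proof.
move=> hJ; split.
- by exists 0, 0; rewrite mul0r addr0; split=> //; apply: is_ideal0.
- move=> _ _ [a [b [Ja ->]]] [a' [b' [Ja' ->]]]; exists (a + a'), (b + b').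
  by split; [apply: is_idealD | rewrite mulrDl addrACA].
- move=> p _ [a [b [Ja ->]]]; exists (p * a), (p * b).
  by split; [apply: is_idealM | rewrite mulrDr mulrA].
Qed.

Lemma adjoin_sub (J : S -> Prop) q p : J p -> adjoin J q p.
Proof. by move=> Jp; exists p, 0; rewrite mul0r addr0. Qed.

Lemma adjoin_mem (J : S -> Prop) q : is_ideal J -> adjoin J q q.
Proof.
by move=> hJ; exists 0, 1; rewrite mul1r add0r; split=> //; apply: is_ideal0.
Qed.

(* If [X_i - c] is invertible modulo [J] after inverting [h] for every [c],
   then infinitely many of the inverses have bounded degree, so that they are
   linearly dependent; clearing denominators gives a nonzero polynomial in [X_i]
   whose product with a power of [h] is in [J], and it splits into invertible
   factors. *)
Lemma nullstellensatz_step J (h : S) (i : 'I_n) : is_ideal J ->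
  (forall N, ~ J (h ^+ N)) ->
  exists c, forall N, ~ adjoin J ('X_i - c%:MP) (h ^+ N).
Proof.
move=> hJ nJ; apply: contrapT => nc.
have inv c : exists w : nat * S, J (h ^+ w.1 - w.2 * ('X_i - c%:MP)).
  apply: contrapT => nw; apply: nc; exists c => N [a [b [Ja e]]]; apply: nw.
  by exists (N, b); rewrite /= e addrK.
pose w c := projT1 (cid (inv c)).
have wP c : J (h ^+ (w c).1 - (w c).2 * ('X_i - c%:MP)) := projT2 (cid (inv c)).
(* Modulo [J] each linear factor is traded for a power of [h], until a power of [h] alone would lie
   in [J]. *)
have kill N (rs : seq K) : ~ J (h ^+ N * \prod_(r <- rs) ('X_i - r%:MP)).
  elim: rs N => [|r rs IH] N; first by rewrite big_nil mulr1; exact: nJ.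
  rewrite big_cons => Jr; apply: (IH (N + (w r).1)%N).
  have -> : h ^+ (N + (w r).1) * \prod_(r <- rs) ('X_i - r%:MP) =
     (h ^+ N * \prod_(r <- rs) ('X_i - r%:MP)) *
        (h ^+ (w r).1 - (w r).2 * ('X_i - r%:MP)) +
     (w r).2 * (h ^+ N * (('X_i - r%:MP) * \prod_(r <- rs) ('X_i - r%:MP))).
    by rewrite exprD; exact: ideal_split.
  by apply: is_idealD => //; apply: is_idealM.
(* The exponent of [h] and the size of the inverse are coded as one natural number, so that
   infinitely many [c] share both. *)
have [E hE] := K_fibers (fun c => pickle ((w c).1, msize (w c).2)).
have [c0 eN] : exists c0, pickle ((w c0).1, msize (w c0).2) = E.
  have [s _ [ss sE]] := hE 1%N.
  by case: s ss sE => [|c [|? ?]] //= _ /andP[/eqP h1 _]; exists c.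
pose N := (w c0).1; pose D := msize (w c0).2.
have hND c : pickle ((w c).1, msize (w c).2) == E -> (w c).1 = N /\ msize (w c).2 = D.
  by rewrite -eN => /eqP /(pcan_inj pickleK) [].
have [r hr] := linear_dependence D.
have [s us [ss /allP sE]] := hE r.
pose c (j : 'I_r) := s`_j.
have cE (j : 'I_r) : (w (c j)).1 = N /\ msize (w (c j)).2 = D.
  by apply/hND/sE/mem_nth; rewrite ss.
have c_inj : injective c.
  by move=> j k /eqP; rewrite nth_uniq ?ss // => /eqP /val_inj.
have [|a [j0 aj0] ea] := hr (fun j => (w (c j)).2).
  by move=> j; have [_ ->] := cE j.
(* Since [(w (c j)).2] stands for [h ^+ N / ('X_i - c j)], the linear relation concerns the sum of
   the [a j / ('X - c j)]; [P] is the numerator of that sum. *)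
pose P : {poly K} := \sum_j a j *: \prod_(k | k != j) ('X - (c k)%:P).
pose psi : {poly K} -> S := horner_alg ('X_i : S).
have psiX x : psi ('X - x%:P) = 'X_i - x%:MP.
  by rewrite /psi rmorphB /= horner_algX horner_algC alg_mpolyC.
have JP : J (h ^+ N * psi P).
  have -> : h ^+ N * psi P =
    \sum_j (a j *: \prod_(k | k != j) ('X_i - (c k)%:MP)) *
       (h ^+ (w (c j)).1 - (w (c j)).2 * ('X_i - (c j)%:MP)).
    have -> : psi P = \sum_j a j *: \prod_(k | k != j) ('X_i - (c k)%:MP).
      rewrite /psi rmorph_sum; apply: eq_bigr => j _.
      rewrite -mul_polyC rmorphM /= horner_algC mulr_algl rmorph_prod.
      congr (_ *: _); apply: eq_bigr => k _.
      exact: psiX.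
    rewrite mulr_sumr; under [RHS]eq_bigr => j _.
      have [-> _] := cE j; rewrite mulrBr mulrC.
      have -> : a j *: \prod_(k | k != j) ('X_i - (c k)%:MP) *
         ((w (c j)).2 * ('X_i - (c j)%:MP)) =
         (a j *: (w (c j)).2) * \prod_k ('X_i - (c k)%:MP).
        rewrite [in RHS](bigD1 j) //= -!scalerAl; congr (_ *: _).
        by rewrite mulrCA; congr (_ * _); rewrite mulrC.
      over.
    by rewrite sumrB -mulr_suml ea mul0r subr0.
  by apply: is_ideal_sum => // j _; apply: is_idealM.
have P0 : P != 0.
  (* At [c j0] only the summand [j0] survives, and its linear factors do not vanish there because
     [c] is injective. *)
  apply/eqP => e; have : P.[c j0] = 0 by rewrite e horner0.
  rewrite /P horner_sum (bigD1 j0) //= [X in _ + X]big1 ?addr0; last first.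
    move=> j jj0; rewrite hornerZ horner_prod (bigD1 j0) 1?eq_sym //=.
    by rewrite hornerXsubC subrr mul0r mulr0.
  move/eqP; rewrite hornerZ mulf_eq0 (negPf aj0) /= horner_prod.
  move=> /prodf_eq0 [k kj0]; rewrite hornerXsubC subr_eq0 => /eqP/c_inj ek.
  by rewrite ek eqxx in kj0.
have [rs ers] := closed_field_poly_normal P.
apply: (kill N rs).
have -> : h ^+ N * \prod_(r <- rs) ('X_i - r%:MP) =
    (lead_coef P)^-1%:MP * (h ^+ N * psi P).
  rewrite {2}ers /psi -mul_polyC rmorphM /= horner_algC mulr_algl rmorph_prod.
  rewrite -scalerAr mul_mpolyC scalerA mulVf ?lead_coef_eq0 // scale1r.
  by congr (_ * _); apply: eq_bigr => r0 _; rewrite -psiX.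
exact: is_idealM.
Qed.

(** Modulo [J] each variable is a constant, hence so is each monomial and each polynomial. *)
Lemma ideal_point J (c : 'I_n -> K) : is_ideal J ->
  (forall i, J ('X_i - (c i)%:MP)) -> forall p, J (p - (p.@[c])%:MP).
Proof.
move=> hJ hc p.
have mon (m : 'X_{1..n}) : J ('X_[m] - (('X_[m] : S).@[c])%:MP).
  rewrite mpolyXE_id rmorph_prod rmorph_prod /=.
  apply: (big_rec2 (fun a b => J (a - b))).
    by rewrite subrr; apply: is_ideal0.
  move=> i a b _ Jab; rewrite rmorphXn rmorphXn /= mevalXU.
  have Ji k : J ('X_i ^+ k - (c i)%:MP ^+ k).
    by rewrite subrXX mulrC; apply: is_idealM.
  rewrite (_ : _ - _ = b * ('X_i ^+ m i - (c i)%:MP ^+ m i) + 'X_i ^+ m i * (a - b)).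
    by apply: (is_idealD hJ); apply: (is_idealM hJ).
  by move: ('X_i ^+ _) ((c i)%:MP ^+ _) => u v; ring.
have -> : (p.@[c])%:MP = \sum_(m <- msupp p) ((p@_m *: 'X_[m]).@[c])%:MP :> S.
  by rewrite {1}(mpolyE p) (raddf_sum (meval c)) raddf_sum.
rewrite {1}(mpolyE p) -sumrB.
apply: is_ideal_sum => // m _.
by rewrite mevalZ mpolyCM -mul_mpolyC -mulrBr; apply: is_idealM.
Qed.

(** The variables are specialised one after another while the powers of [h] stay outside the ideal;
    the ideal reached at the end consists of polynomials vanishing at the point found. *)
Lemma nullstellensatz J (h : S) : is_ideal J -> (forall N, ~ J (h ^+ N)) ->
  exists2 c : 'I_n -> K, h.@[c] != 0 & forall p, J p -> p.@[c] = 0.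
Proof.
move=> hJ nJ.
have [J' [c [hJ' sub nJ' Jc]]] : exists J' (c : 'I_n -> K),
   [/\ is_ideal J', (forall p, J p -> J' p), (forall N, ~ J' (h ^+ N)) &
     forall i, i \in enum 'I_n -> J' ('X_i - (c i)%:MP)].
  elim: (enum _) (enum_uniq 'I_n) => [_|i s IH /= /andP[i_s us]].
    by exists J, (fun _ => 0).
  have [J' [c [hJ' sub nJ' Jc]]] := IH us.
  have [x hx] := nullstellensatz_step i hJ' nJ'.
  exists (adjoin J' ('X_i - x%:MP)), (fun j => if j == i then x else c j); split=> //.
  - exact: adjoin_ideal.
  - by move=> p /sub; exact: adjoin_sub.
  move=> j; rewrite inE; case: eqP => [-> _|_ /= js]; first exact: adjoin_mem.
  by apply/adjoin_sub/Jc.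
have {}Jc i : J' ('X_i - (c i)%:MP) by apply: Jc; rewrite mem_enum.
have Jp := ideal_point hJ' Jc.
have inv x : x != 0 -> ~ J' x%:MP.
  move=> x0 Jx; apply: (nJ' 0%N); rewrite expr0.
  have -> : 1 = (x^-1)%:MP * x%:MP :> S by rewrite -mpolyCM mulVf.
  exact: is_idealM.
exists c.
  apply/eqP => hc; apply: (nJ' 1%N); have := Jp h.
  by rewrite hc subr0 expr1.
move=> p /sub J'p; apply: contrapT => /eqP/inv; apply.
have -> : (p.@[c])%:MP = p + (-1) * (p - (p.@[c])%:MP) by rewrite mulN1r subKr.
by apply: is_idealD => //; apply: is_idealM.
Qed.

(** The ungraded ideal spanned by the graded pieces, to which [nullstellensatz] can be applied. *)
Inductive graded_span (P : nat -> S -> Prop) : S -> Prop :=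
| graded_span0 : graded_span P 0
| graded_spanD m a p : P m a -> graded_span P p -> graded_span P (a + p).

(* [P m] is the part of degree [m] of a homogeneous ideal whose zeros are zeros of
   [h]. *)
Lemma graded_nullstellensatz (P : nat -> S -> Prop) (e : nat) (h : S) :
  (forall m, P m 0) ->
  (forall m p q, P m p -> P m q -> P m (p + q)) ->
  (forall m k p q, q \is k.-homog -> P m p -> P (k + m)%N (q * p)) ->
  (forall m p, P m p -> p \is m.-homog) ->
  h \is e.-homog ->
  (forall c : 'I_n -> K, h.@[c] != 0 -> exists m p, P m p /\ p.@[c] != 0) ->
  exists N, P (e * N)%N (h ^+ N).
Proof.
move=> P0 PD PM Ph hh cov.
have spanD p q : graded_span P p -> graded_span P q -> graded_span P (p + q).
  elim=> [|m a {}p Pa _ IH] hq; first by rewrite add0r.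
  by rewrite -addrA; apply: graded_spanD Pa (IH hq).
have hJ : is_ideal (graded_span P).
  split; [exact: graded_span0|exact: spanD|].
  move=> p q; elim=> [|m a {}q Pa hq IH]; first by rewrite mulr0; exact: graded_span0.
  rewrite mulrDr; apply: (spanD) => //; rewrite {1}(mpolyE p) mulr_suml.
  apply: (big_ind (graded_span P)); [exact: graded_span0|exact: spanD|].
  move=> k _; rewrite -[X in graded_span P X]addr0.
  apply: (graded_spanD (m := (mdeg k + m)%N)); last exact: graded_span0.
  by apply: PM => //; apply: rpredZ; rewrite dhomogX.
(* Homogeneous components bring membership of [h ^+ N] in the span back to the piece of degree
   [e * N]. *)
have comp p : graded_span P p -> forall m, P m (pihomog [measure of mdeg] m p).
  elim=> [|k a {}p Pa _ IH] m; first by rewrite raddf0.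
  rewrite raddfD /=; apply: PD => //; have ha := Ph _ _ Pa.
  have [<-|km] := eqVneq k m; first by rewrite pihomog_dE.
  by rewrite (pihomog_ne0 km).
apply: contrapT => nN.
have [|c hc zc] := @nullstellensatz _ h hJ.
  move=> N JN; apply: nN; exists N; have := comp _ JN (e * N)%N.
  by rewrite pihomog_dE //; apply: dhomogMn.
have [m [p [Pp /eqP]]] := cov c hc; apply; apply: zc.
by rewrite -[p]addr0; apply: graded_spanD Pp (graded_span0 P).
Qed.

End Nullstellensatz.

(** * Uncountability of the real and complex numbers *)

Lemma finite_fiber (T : eqType) (f : T -> nat) (N M : nat) :
  (forall s : seq T, uniq s -> size s = M -> all (fun c => f c == N) s -> False) ->
  exists l : seq T, forall c, f c = N -> c \in l.
Proof.
move=> hM.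
have {hM} hM s : uniq s -> all (fun c => f c == N) s -> (size s < M)%N.
  move=> us sN; rewrite ltnNge; apply/negP => Ms.
  apply: (hM (take M s)); first exact: take_uniq.
    by rewrite size_takel.
  by apply/allP => c /mem_take; move/allP: sN; apply.
(* A duplicate-free list in the fibre grows one element at a time and must stop before length
   [M]. *)
suff: forall k s, uniq s -> all (fun c => f c == N) s -> (M - size s <= k)%N ->
    exists l : seq T, forall c, f c = N -> c \in l.
  by move=> /(_ M [::] isT isT); apply; rewrite leq_subr.
elim=> [|k IH] s us sN; first by rewrite leqn0 subn_eq0 leqNgt hM.
move=> hk; have [all_in|] := pselect (forall c, f c = N -> c \in s).
  by exists s.
move=> /existsNP[c /not_implyP[fc /negP cs]].
apply: (IH (c :: s)); rewrite /= ?cs ?fc ?eqxx //.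
by have := hM _ us sN; lia.
Qed.

Section Reals.
Variable R : realType.

Lemma avoid_seq (l : seq R) (a b : R) : a < b -> exists c : R * R,
  [/\ a <= c.1, c.1 < c.2, c.2 <= b & forall x, c.1 <= x <= c.2 -> x \notin l].
Proof.
elim: l a b => [|y l IH] a b ab; first by exists (a, b).
have [ym|ym] := ltP y ((a + b) / 2).
  have [|[a' b'] /= [h1 h2 h3 h4]] := IH ((a + b) / 2) b; first by lra.
  exists (a', b'); split=> //=; first by lra.
  move=> x hx; rewrite inE negb_or h4 // andbT; apply/eqP => e; subst.
  by move: hx => /andP[]; lra.
(* Here [y] may be the midpoint itself; the first quarter stays strictly to its left. *)
have [|[a' b'] /= [h1 h2 h3 h4]] := IH a ((3 * a + b) / 4); first by lra.
exists (a', b'); split=> //=; first by lra.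
move=> x hx; rewrite inE negb_or h4 // andbT; apply/eqP => e; subst.
by move: hx => /andP[]; lra.
Qed.

(** Cantor's nested intervals: if every fibre were finite, the interval of index [N.+1] could be
    chosen to avoid the fibre over [N], and the common point [x] would avoid the fibre over
    [f x]. *)
Lemma real_infinite_fibers : has_infinite_fibers R.
Proof.
move=> f; apply: contrapT => nf.
have fib N : exists l : seq R, forall c, f c = N -> c \in l.
  have /existsNP[M hM] : ~ forall M : nat,
      exists2 s : seq R, uniq s & size s = M /\ all (fun c => f c == N) s.
    by move=> h; apply: nf; exists N.
  apply: (@finite_fiber _ f N M) => s us ss sN.
  by apply: hM; exists s.
pose l N := projT1 (cid (fib N)).
have lP N c : f c = N -> c \in l N := projT2 (cid (fib N)) c.
have step N (ab : {x : R * R | x.1 < x.2}) : exists cd : {x : R * R | x.1 < x.2},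
   [/\ (sval ab).1 <= (sval cd).1, (sval cd).2 <= (sval ab).2 &
      forall x, (sval cd).1 <= x <= (sval cd).2 -> x \notin l N].
  have [c [h1 h2 h3 h4]] := avoid_seq (l N) (svalP ab).
  by exists (exist _ c h2); split.
pose I := fix I N := match N with
  | 0%N => exist (fun x : R * R => x.1 < x.2) (0, 1) ltr01
  | n.+1 => projT1 (cid (step n (I n))) end.
pose a N := (sval (I N)).1; pose b N := (sval (I N)).2.
have ab N : a N < b N := svalP (I N).
have IP N : [/\ a N <= a N.+1, b N.+1 <= b N &
      forall x, a N.+1 <= x <= b N.+1 -> x \notin l N] := projT2 (cid (step N (I N))).
have a_mono m n : a m <= a (m + n)%N.
  elim: n => [|n IH]; first by rewrite addn0.
  by rewrite addnS (le_trans IH) //; have [] := IP (m + n)%N.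
have b_mono m n : b (m + n)%N <= b m.
  elim: n => [|n IH]; first by rewrite addn0.
  by rewrite addnS (le_trans _ IH) //; have [] := IP (m + n)%N.
have a_le_b m n : a m <= b n.
  apply: (le_trans (a_mono m n)); apply: (le_trans (ltW (ab _))).
  by rewrite addnC.
pose x := sup [set a N | N in [set: nat]].
have ax N : a N <= x.
  by apply: ub_le_sup; [exists (b 0%N) => _ [m _ <-]|exists N].
have xb N : x <= b N.
  by apply: ge_sup; [exists (a 0%N), 0%N|move=> _ [m _ <-]].
have [_ _ /(_ x)] := IP (f x).
by rewrite ax xb => /(_ isT) /negP; apply; apply: lP.
Qed.

Lemma complex_infinite_fibers : has_infinite_fibers R[i].
Proof.
move=> f; have [N hN] := real_infinite_fibers (fun x : R => f (x%:C)%C).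
exists N => M; have [s us [ss sN]] := hN M.
exists [seq (x%:C)%C | x <- s]; last by rewrite size_map all_map.
by rewrite map_inj_uniq // => x y [].
Qed.
End Reals.

(** This identity and the next three are stated over an abstract ring so that powers of coordinates
    appear as plain variables; they serve [regular_seq3] and [cech_H1]. *)
Lemma syzygy_split (R : comPzRingType) (x y z q r a b : R) :
  y * q + z * r - x * (y * a) - x * (z * b) =
  y * (q - x * a) + z * (r - x * b).
Proof. ring. Qed.

Lemma cech_step (R : comPzRingType) (a b c d x0 x1 x2 : R) :
  a * x2 + (b * x2 - c * x1) * x0 = d * x1 -> x2 * (a + b * x0) = x1 * (d + c * x0).
Proof. by move=> h; rewrite mulrDr [x1 * _]mulrDr [x1 * d]mulrC -h; ring. Qed.

Lemma cech_step2 (R : comPzRingType) (a b c d x0 x1 x3 : R) :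
  (a * x1 - b * x0) * x3 + c * x0 = d * x1 ->
  x1 * (a * x3 - d) = x0 * (b * x3 - c).
Proof. by move=> h; rewrite mulrBr [x1 * d]mulrC -h; ring. Qed.

Lemma cech_step3 (R : comPzRingType) (a b c d x0 x2 x3 : R) :
  (a * x2 - b * x0) * x3 + c * x0 = (a * x3 - d * x0) * x2 ->
  c * x0 = (b * x3 - d * x2) * x0.
Proof. by move=> h; rewrite -[LHS](addKr ((a * x2 - b * x0) * x3)) h; ring. Qed.

(** * Polynomials in a linear frame *)

Section Monomials.
Variables (n : nat) (R : idomainType).
Notation S := {mpoly R[n]}.
Implicit Types (p q : S) (i j k : 'I_n) (N : nat).

Lemma mcoeff_part p (P : pred 'X_{1..n}) m :
  (\sum_(a <- msupp p | P a) p@_a *: 'X_[a])@_m = if P m then p@_m else 0.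
Proof.
rewrite raddf_sum /=.
have [Pm|Pm] := boolP (P m); last first.
  rewrite big1 // => a Pa; rewrite mcoeffZ mcoeffX.
  by case: eqP => [e|_]; [rewrite -e Pa in Pm | rewrite mulr0].
have [mp|mp] := boolP (m \in msupp p); last first.
  rewrite [RHS]memN_msupp_eq0 // big_seq_cond big1 // => a /andP[ap _].
  rewrite mcoeffZ mcoeffX; case: eqP => [e|_]; last by rewrite mulr0.
  by rewrite -e ap in mp.
rewrite big_mkcond (bigD1_seq m) ?msupp_uniq //= Pm mcoeffZ mcoeffX eqxx mulr1.
rewrite big1 ?addr0 // => a am; case: ifP => // _.
by rewrite mcoeffZ mcoeffX (negPf am) mulr0.
Qed.

Lemma X_neq0 i : 'X_i != 0 :> S.
Proof.
apply/eqP => /(congr1 (mcoeff U_(i)%MM)).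
by rewrite mcoeffX eqxx mcoeff0; move/eqP; rewrite oner_eq0.
Qed.

Lemma mcoeffXnM i N p m : ('X_i ^+ N * p)@_(U_(i) *+ N + m) = p@_m.
Proof. by rewrite mpolyXn mulrC mcoeffMX. Qed.

Lemma mcoeffXnM0 i N p (m : 'X_{1..n}) : (m i < N)%N -> ('X_i ^+ N * p)@_m = 0.
Proof.
move=> mN; rewrite {1}(mpolyE p) mulr_sumr raddf_sum big1 // => a _ /=.
rewrite mpolyXn -scalerAr -mpolyXD mcoeffZ mcoeffX; case: eqP => [e|_].
  by move: mN; rewrite -e mnmDE mulmnE mnm1E eqxx; lia.
by rewrite mulr0.
Qed.

(** Division by ['X_i ^+ N] monomial by monomial; the remainder keeps exactly the monomials whose
    exponent at [i] is below [N]. *)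
Lemma mdivX p i N : exists q, forall m,
  (p - 'X_i ^+ N * q)@_m = if (m i < N)%N then p@_m else 0.
Proof.
exists (\sum_(a <- msupp p | (N <= (a : 'X_{1..n}) i)%N) p@_a *: 'X_[a - U_(i) *+ N]).
move=> m; rewrite -(mcoeff_part _ (fun a => (a i < N)%N)); congr (_@_m).
rewrite {1}(mpolyE p) (bigID (fun a : 'X_{1..n} => (a i < N)%N)) /= -addrA.
rewrite [X in _ + X](_ : _ = 0) ?addr0 //; apply/eqP; rewrite subr_eq0.
apply/eqP; rewrite mulr_sumr; apply: eq_big => [a|a]; rewrite -leqNgt // => Na.
rewrite -scalerAr mpolyXn -mpolyXD; congr (_ *: 'X_[_]).
apply/mnmP => j; rewrite mnmDE mnmBE mulmnE mnm1E.
by case: eqP => [<-|]; lia.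
Qed.

(** A monomial of [p] with exponent below [N] at [j] keeps that exponent after multiplication by
    ['X_i ^+ N], whereas the right-hand side has no such monomial. *)
Lemma regular_seq2 i j N p q : i != j ->
  'X_i ^+ N * p = 'X_j ^+ N * q -> exists r, p = 'X_j ^+ N * r /\ q = 'X_i ^+ N * r.
Proof.
move=> ij e; have [r hr] := mdivX p j N; exists r.
have e1 : p = 'X_j ^+ N * r.
  apply/eqP; rewrite -subr_eq0; apply/eqP/mpolyP => m.
  rewrite mcoeff0; have := hr m; case: ltnP => // mN _.
  rewrite -(mcoeffXnM i N) mulrBr e mulrCA -mulrBr mcoeffXnM0 //.
  by rewrite mnmDE mulmnE mnm1E (negPf ij) mul0n.
split=> //; move: e; rewrite e1 mulrCA => /mulfI -> //.
by rewrite expf_neq0 // X_neq0.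
Qed.

(** The power of ['X_i] is a nonzerodivisor modulo the powers of ['X_j] and ['X_k], seen on the
    monomials that are small at both [j] and [k]. *)
Lemma regular_seq3 i j k N p q r : i != j -> i != k ->
  'X_i ^+ N * p = 'X_j ^+ N * q + 'X_k ^+ N * r ->
  exists a b, p = 'X_j ^+ N * a + 'X_k ^+ N * b.
Proof.
move=> ij ik e; have [a ha] := mdivX p j N.
have [b hb] := mdivX (p - 'X_j ^+ N * a) k N; exists a, b.
apply/eqP; rewrite -subr_eq0 opprD addrA; apply/eqP/mpolyP => m.
rewrite mcoeff0; have [mk|mk] := ltnP (m k) N; last by rewrite hb ltnNge mk.
have [mj|mj] := ltnP (m j) N; last by rewrite hb mk ha ltnNge mj.
rewrite -(mcoeffXnM i N) !mulrBr e.
rewrite (_ : _ - _ = 'X_j ^+ N * (q - 'X_i ^+ N * a) +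
  'X_k ^+ N * (r - 'X_i ^+ N * b)).
  by rewrite mcoeffD !mcoeffXnM0 ?addr0 // mnmDE mulmnE mnm1E ?(negPf ij) ?(negPf ik) mul0n.
exact: syzygy_split.
Qed.

End Monomials.

Section Homogeneous.
Variables (n : nat) (K : fieldType).
Notation S := {mpoly K[n]}.
Notation proj m := (pihomog [measure of mdeg] m).

(** Used to make cofactors homogeneous: in an equation between forms, each cofactor may be replaced
    by its component of the right degree. *)
Lemma pihomogM k m (p q : S) : q \is k.-homog ->
  proj (k + m)%N (q * p) = q * proj m p.
Proof.
move=> hq.
have projZ d c r : proj d (c *: r) = c *: proj d r :> S by exact: linearZ.
have projS d (s : seq 'X_{1..n}) (F : _ -> S) :
  proj d (\sum_(a <- s) F a) = \sum_(a <- s) proj d (F a) by exact: raddf_sum.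
rewrite [in LHS](mpolyE p) [in RHS](mpolyE p) mulr_sumr !projS mulr_sumr.
apply: eq_bigr => a _; rewrite -scalerAr !projZ -scalerAr; congr (_ *: _).
rewrite pihomogX.
have hqa : q * 'X_[a] \is (k + mdeg a)%N.-homog by apply: dhomogM => //; rewrite dhomogX.
case: eqP => [<-|am]; first exact: pihomog_dE.
by rewrite mulr0 (pihomog_ne0 _ hqa) // eqn_add2l; apply/eqP.
Qed.
End Homogeneous.

Section Substitution.
Variables (K : closedFieldType).
Hypothesis K_fibers : has_infinite_fibers K.
Notation S := {mpoly K[4]}.
Implicit Types (B : 'M[K]_4) (c : 'rV[K]_4) (p q : S).

Definition mev p c : K := p.@[fun i => c 0 i].

Lemma mev_neq0 p : p != 0 -> exists c, mev p c != 0.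
Proof.
move=> p0; have hJ : is_ideal (fun q : S => q = 0).
  by split=> // [? ? -> ->|? ? ->]; rewrite ?addr0 ?mulr0.
have [|c hc _] := @nullstellensatz K 4 K_fibers _ p hJ.
  by move=> N /eqP; rewrite expf_eq0 (negPf p0) andbF.
by exists (\row_i c i); rewrite /mev (@meval_eq _ _ _ c) // => i; rewrite mxE.
Qed.

Lemma mev_ext p q : (forall c, mev p c = mev q c) -> p = q.
Proof.
move=> e; apply/eqP; rewrite -subr_eq0; apply: contrapT => /negP /mev_neq0[c].
by rewrite /mev mevalB -/(mev p c) e subrr eqxx.
Qed.

(** The columns of [B] are read as linear forms; for invertible [B] they are the coordinates of a
    frame. *)
Definition lf B (i : 'I_4) : S := \sum_j B j i *: 'X_j.

Lemma mev_lf B i c : mev (lf B i) c = (c *m B) 0 i.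
Proof.
rewrite /mev raddf_sum mxE; apply: eq_bigr => j _ /=.
by rewrite mevalZ mevalXU mulrC.
Qed.

Lemma lf_homog B i : lf B i \is 1.-homog.
Proof. by apply: rpred_sum => j _; apply: rpredZ; rewrite dhomogX /= mdeg1. Qed.

Lemma lf1 i : lf 1%:M i = 'X_i.
Proof.
rewrite /lf (bigD1 i) //= mxE eqxx scale1r big1 ?addr0 // => j ji.
by rewrite mxE (negPf ji) scale0r.
Qed.

Definition subst B p : S := p \mPo [tuple lf B i | i < 4].

Lemma mev_subst B p c : mev (subst B p) c = mev p (c *m B).
Proof.
rewrite /mev comp_mpoly_meval; apply: meval_eq => i.
by rewrite tnth_mktuple -/(mev _ _) mev_lf.
Qed.

Lemma substK B C p : C *m B = 1%:M -> subst C (subst B p) = p.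
Proof. by move=> CB; apply: mev_ext => c; rewrite !mev_subst -mulmxA CB mulmx1. Qed.

Lemma substM B p q : subst B (p * q) = subst B p * subst B q.
Proof. exact: rmorphM. Qed.
Lemma substX B N p : subst B (p ^+ N) = subst B p ^+ N.
Proof. exact: rmorphXn. Qed.
Lemma subst_lf B C i : subst C (lf B i) = lf (C *m B) i.
Proof. by apply: mev_ext => c; rewrite mev_subst !mev_lf mulmxA. Qed.

Lemma subst_homog B m p : p \is m.-homog -> subst B p \is m.-homog.
Proof.
move=> hp; rewrite /subst comp_mpolyEX; rewrite big_seq; apply: rpred_sum => a ap.
apply: rpredZ; rewrite comp_mpolyX.
have -> : m = (\sum_i a i)%N by rewrite -mdegE; exact/esym/(dhomog_mf hp ap).
elim/big_rec2: _ => [|i u v _ huv]; first exact: dhomog1.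
apply: dhomogM => //; rewrite tnth_mktuple.
by have := dhomogMn (a i) (lf_homog B i); rewrite mul1n.
Qed.

(** The image of a linear map is irreducible: pulled back along the map, the product vanishes in the
    polynomial ring, which is a domain. *)
Lemma vanish_on_prime B p q : (forall c, mev (p * q) (c *m B) = 0) ->
  (forall c, mev p (c *m B) = 0) \/ (forall c, mev q (c *m B) = 0).
Proof.
move=> h; have : subst B p * subst B q = 0.
  by apply: mev_ext => c; rewrite -substM mev_subst h /mev meval0.
move/eqP; rewrite mulf_eq0 => /orP[] /eqP e; [left|right] => c;
  by rewrite -mev_subst e /mev meval0.
Qed.

Section Frame.
Variables (B C : 'M[K]_4).
Hypotheses (CB : C *m B = 1%:M) (BC : B *m C = 1%:M).
Notation l := (lf B).

Lemma subst_frame i : subst B 'X_i = l i.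
Proof. by rewrite -lf1 subst_lf mulmx1. Qed.
Lemma subst_frameV i : subst C (l i) = 'X_i.
Proof. by rewrite subst_lf CB lf1. Qed.
Lemma frame_neq0 i : l i != 0.
Proof.
apply/eqP => e; have := X_neq0 K i; rewrite -(subst_frameV i) e /subst.
by rewrite comp_mpoly0 eqxx.
Qed.

Lemma frame_regular2 i j N p q : i != j ->
  l i ^+ N * p = l j ^+ N * q -> exists r, p = l j ^+ N * r /\ q = l i ^+ N * r.
Proof.
move=> ij /(congr1 (subst C)); rewrite !substM !substX !subst_frameV.
move=> /(regular_seq2 ij) [r [ep eq]]; exists (subst B r).
rewrite -(substK p BC) -(substK q BC) ep eq.
by rewrite !substM !substX !subst_frame.
Qed.

(** In frame coordinates [l i] is a variable. The remainder of division by it does not involve that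
    variable, so its values are those on the hyperplane, which are zero. *)
Lemma frame_vanish1 i p : (forall c, (c *m B) 0 i = 0 -> mev p c = 0) ->
  exists q, p = l i * q.
Proof.
move=> hp; have [r hr] := mdivX (subst C p) i 1; exists (subst B r).
suff e : subst C p - 'X_i ^+ 1 * r = 0.
  rewrite -[LHS](substK _ BC) (subr0_eq e) substM expr1 subst_frame //.
apply: mev_ext => c.
pose c' : 'rV_4 := \row_j if j == i then 0 else c 0 j.
have -> : mev (subst C p - 'X_i ^+ 1 * r) c = mev (subst C p - 'X_i ^+ 1 * r) c'.
  rewrite /mev !mevalE !big_seq; apply: eq_bigr => a.
  rewrite mcoeff_msupp hr; case: ltnP; rewrite ?eqxx // => ai _; congr (_ * _).
  apply: eq_bigr => j _; rewrite mxE; case: eqP => // ->.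
  by move: ai; rewrite ltnS leqn0 => /eqP ->.
rewrite {1}/mev mevalB mevalM expr1 mevalXU mxE eqxx mul0r subr0 -/(mev _ c').
rewrite mev_subst hp /mev ?meval0 //.
by rewrite -mulmxA CB mulmx1 mxE eqxx.
Qed.

(** In the frame, [D i] erases the coordinate [i]; [proj i] is the resulting projection onto the
    hyperplane [l i = 0]. *)
Let D i : 'M[K]_4 := \matrix_(a, b) if (a == b) && (a != i) then 1 else 0.
Let proj i := B *m D i *m C.

Lemma projE c i a : (c *m proj i *m B) 0 a = if a == i then 0 else (c *m B) 0 a.
Proof.
rewrite /proj -!mulmxA CB mulmx1 mulmxA mxE (bigD1 a) //= [X in _ + X]big1.
  by rewrite /D [X in _ * X]mxE eqxx /=; case: eqP => _; rewrite ?mulr0 ?mulr1 addr0.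
by move=> b ba; rewrite /D [X in _ * X]mxE (negPf ba) mulr0.
Qed.

Lemma proj_id c i : (c *m B) 0 i = 0 -> c *m proj i = c.
Proof.
move=> ci; suff e : c *m proj i *m B = c *m B.
  by rewrite -[LHS]mulmx1 -BC mulmxA e -mulmxA BC mulmx1.
by apply/rowP => a; rewrite projE; case: eqP => // ->.
Qed.

(** The difference of [p] and its pullback along [proj i] vanishes on [l i = 0], and the pullback
    itself vanishes on [l j = 0]. *)
Lemma frame_vanish2 i j p :
  (forall c, (c *m B) 0 i = 0 -> (c *m B) 0 j = 0 -> mev p c = 0) ->
  exists q r, p = l i * q + l j * r.
Proof.
move=> hp; pose p' := subst (proj i) p.
have [q eq] : exists q, p - p' = l i * q.
  apply: frame_vanish1 => c ci; rewrite /mev mevalB -!/(mev _ c) mev_subst.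
  by rewrite proj_id // subrr.
have [r er] : exists r, p' = l j * r.
  apply: frame_vanish1 => c cj; rewrite mev_subst.
  by apply: hp; rewrite projE ?eqxx //; case: eqP.
by exists q, r; rewrite -eq -er subrK.
Qed.

Lemma frame_vanish1_prime i p q r : p * q = l i * r ->
  (exists p', p = l i * p') \/ (exists q', q = l i * q').
Proof.
move=> e; have [c|h|h] := @vanish_on_prime (proj i) p q.
- by rewrite e /mev mevalM -!/(mev _ _) mev_lf projE eqxx mul0r.
- by left; apply: frame_vanish1 => c /proj_id <-.
- by right; apply: frame_vanish1 => c /proj_id <-.
Qed.

Lemma frame_vanish2_prime i j p q r s : p * q = l i * r + l j * s ->
  (exists a b, p = l i * a + l j * b) \/ (exists a b, q = l i * a + l j * b).
Proof.
move=> e; have fix_ c : (c *m B) 0 i = 0 -> (c *m B) 0 j = 0 ->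
    c *m (proj i *m proj j) = c.
  by move=> ci cj; rewrite mulmxA !proj_id.
have [c|h|h] := @vanish_on_prime (proj i *m proj j) p q.
- rewrite e /mev mevalD !mevalM -!/(mev _ _) !mev_lf mulmxA.
  rewrite !projE !eqxx mul0r addr0; case: eqP => _; by rewrite mul0r.
- by left; apply: frame_vanish2 => c ci cj; rewrite -(fix_ c ci cj).
- by right; apply: frame_vanish2 => c ci cj; rewrite -(fix_ c ci cj).
Qed.

(** The ideal of [l i] is prime and does not contain [f], so the factors [l i] can be split off [p]
    one by one. *)
Lemma frame_coprime i N f p q : (forall f', f <> l i * f') ->
  f * p = l i ^+ N * q -> exists r, p = l i ^+ N * r /\ q = f * r.
Proof.
move=> fi; elim: N p q => [|N IH] p q e.
  by exists p; rewrite mul1r e mul1r.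
have [] : (exists f', f = l i * f') \/ (exists p', p = l i * p').
    by apply: (@frame_vanish1_prime _ _ _ (l i ^+ N * q)); rewrite e exprS mulrA.
  by move=> [f' /fi].
move=> [p' ep]; have [|r [er eq]] := IH p' q.
  by apply: (mulfI (frame_neq0 i)); rewrite mulrCA -ep e exprS mulrA.
by exists r; rewrite ep er exprS mulrA.
Qed.

End Frame.
End Substitution.

(* Vanishing of the first Cech cohomology of a twisting sheaf for the standard
   covering, after clearing denominators. *)
Lemma cech_H1 (K : fieldType) (N : nat) (A : 'I_4 -> 'I_4 -> {mpoly K[4]}) :
  (forall i j k, A i j * 'X_k ^+ N + A j k * 'X_i ^+ N = A i k * 'X_j ^+ N) ->
  exists B : 'I_4 -> {mpoly K[4]},
    forall i j, A i j = B i * 'X_j ^+ N - B j * 'X_i ^+ N.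
Proof.
move=> cA.
have XN0 k : 'X_k ^+ N != 0 :> {mpoly K[4]} by rewrite expf_neq0 ?X_neq0.
pose i0 : 'I_4 := @Ordinal 4 0 isT; pose i1 : 'I_4 := @Ordinal 4 1 isT.
pose i2 : 'I_4 := @Ordinal 4 2 isT; pose i3 : 'I_4 := @Ordinal 4 3 isT.
(* The cocycle condition puts ['X_i0 ^+ N * A i1 i2] into the ideal of the powers of ['X_i1] and
   ['X_i2], hence also [A i1 i2]; its cofactors are [B1] and [B2] up to sign. *)
have [|||a [b e12]] := @regular_seq3 4 K i0 i1 i2 N (A i1 i2) (A i0 i2) (- A i0 i1) => //.
  by rewrite mulrN mulrC [in RHS]mulrC -(cA i0 i1 i2) [X in _ - X]mulrC addrAC subrr add0r.
pose B1 := b; pose B2 := - a.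
have {e12} e12 : A i1 i2 = B1 * 'X_i2 ^+ N - B2 * 'X_i1 ^+ N.
  by rewrite e12 /B1 /B2 mulNr opprK addrC ![_ * 'X__ ^+ _]mulrC.
(* After correction by [B1] and [B2] the cocycle condition is a two-term relation, which yields
   [B0]; the indices 0, 1, 3 yield [B3] likewise. *)
have [||B0 [e01 e02]] := @regular_seq2 4 K i2 i1 N (A i0 i1 + B1 * 'X_i0 ^+ N)
    (A i0 i2 + B2 * 'X_i0 ^+ N) => //.
  by move: (cA i0 i1 i2); rewrite e12 => h; apply: cech_step h.
have {}e01 : A i0 i1 = B0 * 'X_i1 ^+ N - B1 * 'X_i0 ^+ N.
  by rewrite mulrC -e01 addrK.
have {}e02 : A i0 i2 = B0 * 'X_i2 ^+ N - B2 * 'X_i0 ^+ N.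
  by rewrite mulrC -e02 addrK.
have [||B3 [e03 e13]] := @regular_seq2 4 K i1 i0 N (B0 * 'X_i3 ^+ N - A i0 i3)
    (B1 * 'X_i3 ^+ N - A i1 i3) => //.
  by move: (cA i0 i1 i3); rewrite e01 => h; apply: cech_step2 h.
have {}e03 : A i0 i3 = B0 * 'X_i3 ^+ N - B3 * 'X_i0 ^+ N.
  by rewrite [B3 * _]mulrC -e03 subKr.
have {}e13 : A i1 i3 = B1 * 'X_i3 ^+ N - B3 * 'X_i1 ^+ N.
  by rewrite [B3 * _]mulrC -e13 subKr.
have e23 : A i2 i3 = B2 * 'X_i3 ^+ N - B3 * 'X_i2 ^+ N.
  apply: (mulIf (XN0 i0)); move: (cA i0 i2 i3); rewrite e02 e03 => h.
  by apply: cech_step3 h.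
have diag i : A i i = 0.
  by apply: (mulIf (XN0 i)); rewrite mul0r; have := cA i i i; move/eqP; rewrite -subr_eq0 addrK => /eqP.
have anti i j : A j i = - A i j.
  apply: (mulIf (XN0 i)); rewrite mulNr; apply/eqP; rewrite -addr_eq0 addrC.
  by rewrite cA diag mul0r.
have full (B : 'I_4 -> {mpoly K[4]}) :
    (forall i j : 'I_4, (i < j)%N -> A i j = B i * 'X_j ^+ N - B j * 'X_i ^+ N) ->
    forall i j, A i j = B i * 'X_j ^+ N - B j * 'X_i ^+ N.
  move=> key i j; case: (ltngtP i j) => ij; first exact: key.
    rewrite (anti j i).
    rewrite (key j i ij).
    exact: opprB.
  by rewrite (val_inj ij) diag subrr.
pose B (i : 'I_4) := nth 0 [:: B0; B1; B2; B3] i; exists B; apply: full.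
have c4 (i : 'I_4) : [\/ i = i0, i = i1, i = i2 | i = i3].
  by case: i => [[|[|[|[|?]]]] hi] //; [constructor 1|constructor 2|constructor 3|constructor 4];
    apply: val_inj.
move=> i j;
  case: (c4 i) (c4 j) => -> [] -> h;
    [exfalso; exact: (notF h) | exact: e01 | exact: e02 | exact: e03
    |exfalso; exact: (notF h) | exfalso; exact: (notF h) | exact: e12 | exact: e13
    |exfalso; exact: (notF h) | exfalso; exact: (notF h) | exfalso; exact: (notF h) | exact: e23
    |exfalso; exact: (notF h) | exfalso; exact: (notF h) | exfalso; exact: (notF h) | exfalso; exact: (notF h)].
Qed.

(** The degree [m + k] as a natural number; used only where [m + k] is non-negative. *)
Definition shift (m : nat) (k : int) : nat := absz (m%:Z + k).

Lemma meval0_homog (K : closedFieldType) e (h : {mpoly K[4]}) : h \is e.-homog -> (0 < e)%N ->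
  h.@[fun=> 0] = 0.
Proof.
move=> hh e0; rewrite mevalE big_seq big1 // => a ah.
have := dhomog_mf hh ah; rewrite /= mdegE => ea.
have [i ai] : exists i, (0 < a i)%N.
  apply: contrapT => na; move: e0; rewrite -ea big1 // => i _.
  by apply/eqP; rewrite -leqn0 leqNgt; apply/negP => ai; apply: na; exists i.
by rewrite (bigD1 i) //= expr0n eqn0Ngt ai mul0r mulr0.
Qed.

(** * Regular functions and sheaves *)

Section Regular.
Variables (K : closedFieldType).
Hypothesis K_fibers : has_infinite_fibers K.
Notation S := {mpoly K[4]}.
Implicit Types (U V W : open K) (p q h : S) (x y : pt K).

Lemma evM p q x : ev (p * q) x = ev p x * ev q x.
Proof. exact: mevalM. Qed.
Lemma evD p q x : ev (p + q) x = ev p x + ev q x.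
Proof. exact: mevalD. Qed.
Lemma evB p q x : ev (p - q) x = ev p x - ev q x.
Proof. exact: mevalB. Qed.
Lemma evN p x : ev (- p) x = - ev p x.
Proof. exact: mevalN. Qed.
Lemma evX n p x : ev (p ^+ n) x = ev p x ^+ n.
Proof. exact: rmorphXn. Qed.
Lemma ev1 x : ev (1 : S) x = 1.
Proof. exact: meval1. Qed.
Lemma ev0 x : ev (0 : S) x = 0.
Proof. exact: meval0. Qed.
Lemma evXU i x : ev ('X_i : S) x = val x 0 i.
Proof. exact: mevalXU. Qed.
Lemma ev_lf (B : 'M[K]_4) i x : ev (lf B i) x = (val x *m B) 0 i.
Proof. exact: mev_lf. Qed.

Lemma exists_pt (c : 'rV[K]_4) : c != 0 -> exists x : pt K, val x = c.
Proof. by move=> c0; exists (exist _ c c0). Qed.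

Lemma pt_coord x : exists i, val x 0 i != 0.
Proof.
apply: contrapT => nx; have /negP := valP x; apply.
apply/eqP/rowP => i; rewrite mxE; apply/eqP; apply: contrapT => /negP xi.
by apply: nx; exists i.
Qed.

(** The factor ['X_0] takes care of the zero vector, which is not a point. *)
Lemma ev_ext0 p : (forall x, ev p x = 0) -> p = 0.
Proof.
move=> hp; have /eqP : p * 'X_0 = 0.
  apply: (mev_ext K_fibers) => c; rewrite /mev mevalM mevalXU meval0.
  have [->|c0] := eqVneq c 0; first by rewrite mxE mulr0.
  by have [x ex] := exists_pt c0; have := hp x; rewrite /ev ex => ->; rewrite mul0r.
by rewrite mulf_eq0 (negPf (X_neq0 _ _)) orbF => /eqP.
Qed.

Lemma ev_ext0_on p q : q != 0 -> (forall x, ev q x != 0 -> ev p x = 0) -> p = 0.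
Proof.
move=> q0 hp; have /eqP : p * q = 0.
  apply: ev_ext0 => x; rewrite evM; have [->|/hp->] := eqVneq (ev q x) 0.
    by rewrite mulr0.
  by rewrite mul0r.
by rewrite mulf_eq0 (negPf q0) orbF => /eqP.
Qed.

Lemma ev_neq0 p x : ev p x != 0 -> p != 0.
Proof. by apply: contraNneq => ->; rewrite ev0. Qed.

(* The empty set if [h] is not homogeneous. *)
Lemma zariski_basic h : zariski_open [set x | (exists n, h \is n.-homog) /\ ev h x != 0].
Proof.
exists [set p | p = h /\ exists n, h \is n.-homog]; split=> [p [-> //]|x].
by split=> [[hh hx]|[p [-> hh]]] //; exists h.
Qed.

Definition basic h : open K := Open (zariski_basic h).

Lemma basic_nbhd U x : U x -> exists n h, [/\ h \is n.-homog, ev h x != 0 & basic h <<= U].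
Proof.
move=> Ux; have [T [hT eT]] := open_zariski U; have [h Th hx] := (eT x).1 Ux.
have [n hn] := hT h Th; exists n, h; split=> // y [_ hy].
by apply/eT; exists h.
Qed.

Lemma regularE k U (f : dom U -> K) m n p q :
  p \is m.-homog -> q \is n.-homog -> m%:Z = n%:Z + k ->
  (forall y : dom U, ev q (sval y) != 0) ->
  (forall y : dom U, f y = ev p (sval y) / ev q (sval y)) -> regular k f.
Proof. by move=> hp hq e q0 hf x; exists m, n, p, q; split. Qed.

Lemma regular_poly m U p : p \is m.-homog ->
  regular m%:Z (fun x : dom U => ev p (sval x)).
Proof.
move=> hp; apply: (@regularE m%:Z U _ m 0%N p 1); rewrite ?dhomog1 ?add0r // => y.
  by rewrite ev1 oner_neq0.
by rewrite ev1 divr1.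
Qed.

Lemma regular_local k U (f : dom U -> K) :
  (forall x : dom U, exists V (h : V <<= U), V (sval x) /\ regular k (f \o dom_sub h)) ->
  regular k f.
Proof.
move=> hf x; have [V [hV [Vx /(_ (exist _ _ Vx))]]] := hf x.
move=> [m [n [p [q [hp hq e qx hy]]]]].
have [n' [g [hg gx gV]]] := basic_nbhd Vx.
exists (m + n')%N, (n + n')%N, (p * g), (q * g); split.
- exact: dhomogM.
- exact: dhomogM.
- by rewrite !PoszD e; ring.
- by rewrite evM mulf_neq0.
move=> y; rewrite evM mulf_eq0 negb_or => /andP[qy gy].
have Vy : V (sval y) by apply: gV; split=> //; exists n'.
rewrite !evM.
have -> : f y = f (dom_sub hV (exist _ _ Vy)) by congr (f _); exact: dom_inj.
have /= -> := hy (exist _ _ Vy) qy; field.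
by rewrite qy gy.
Qed.

Lemma regular_sub k U V (h : V <<= U) (f : dom U -> K) :
  regular k f -> regular k (f \o dom_sub h).
Proof.
move=> hf x; have [m [n [p [q [hp hq e qx hy]]]]] := hf (dom_sub h x).
by exists m, n, p, q; split=> // y qy; exact: hy.
Qed.

(** The lower bound [N] on the degree of the denominator is reached by multiplying with a power of a
    coordinate that is nonzero at [x]. It keeps the degrees of numerators and cofactors large enough
    for subtraction in [nat]. *)
Lemma common_denominator U (x : dom U) (r : nat) (k : 'I_r -> int)
    (f : 'I_r -> dom U -> K) (N : nat) :
  (forall j, regular (k j) (f j)) ->
  exists n q (p : 'I_r -> S), [/\ (N <= n)%N, q \is n.-homog, ev q (sval x) != 0,
    basic q <<= U & forall j, exists m, [/\ p j \is m.-homog, m%:Z = n%:Z + k j &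
      forall y : dom U, ev q (sval y) != 0 -> f j y = ev (p j) (sval y) / ev q (sval y)]].
Proof.
elim: r k f => [|r IH] k f hf.
  have [n [h [hh hx hU]]] := basic_nbhd (svalP x).
  have [i xi] := pt_coord (sval x).
  exists (n + N)%N, (h * 'X_i ^+ N), (fun _ => 0); split; first exact: leq_addl.
  - apply: dhomogM => //; rewrite -[X in X.-homog]mul1n; apply: dhomogMn.
    by rewrite dhomogX /= mdeg1.
  - by rewrite evM evX evXU mulf_neq0 ?expf_neq0.
  - move=> y [_ hy]; apply: hU; split; first by exists n.
    by move: hy; rewrite evM mulf_eq0 negb_or => /andP[].
  - by case.
have [n [q [p [Nn hq qx qU hp]]]] := IH (fun j => k (lift ord0 j)) (fun j => f (lift ord0 j))
   (fun j => hf (lift ord0 j)).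
have [m' [n' [p' [q' [hp' hq' e' qx' hy']]]]] := hf ord0 x.
exists (n + n')%N, (q * q'), (fun j => if unlift ord0 j is Some j' then p j' * q' else p' * q).
split; first by rewrite (leq_trans Nn) ?leq_addr.
- exact: dhomogM.
- by rewrite evM mulf_neq0.
- move=> y [_ hy]; apply: qU; split; first by exists n.
  by move: hy; rewrite evM mulf_eq0 negb_or => /andP[].
move=> j; case: unliftP => [j' ->|->].
  have [m [hm em hy]] := hp j'; exists (m + n')%N; split; first exact: dhomogM.
    by rewrite !PoszD em; ring.
  move=> y; rewrite evM mulf_eq0 negb_or => /andP[qy qy']; rewrite hy // evM.
  by rewrite -mulf_div divff // mulr1.
exists (m' + n)%N; split; first exact: dhomogM.
  by rewrite !PoszD e'; ring.
move=> y; rewrite evM mulf_eq0 negb_or => /andP[qy qy']; rewrite hy' // evM.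
by rewrite [ev q _ * _]mulrC -mulf_div divff // mulr1.
Qed.

(** Principal open sets are dense: a local numerator vanishes wherever [q] and the denominator do
    not, hence is the zero polynomial. *)
Lemma regular_eq0 k U (f : dom U -> K) q : regular k f -> q != 0 ->
  (forall y : dom U, ev q (sval y) != 0 -> f y = 0) -> forall y : dom U, f y = 0.
Proof.
move=> hf q0 fq y.
have [n [g [p [_ hg gy gU /(_ ord0)]]]] :=
  @common_denominator U y 1 (fun=> k) (fun=> f) 0 (fun=> hf).
move=> [m [_ _ hpy]]; rewrite (hpy y gy).
suff -> : p ord0 = 0 by rewrite ev0 mul0r.
apply: (@ev_ext0_on _ (q * g)); first by rewrite mulf_neq0 // (ev_neq0 gy).
move=> z; rewrite evM mulf_eq0 negb_or => /andP[qz gz].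
have Uz : U z by apply: gU; split=> //; exists n.
have := fq (exist _ z Uz) qz; rewrite (hpy (exist _ z Uz)) //= => /eqP.
by rewrite mulf_eq0 invr_eq0 (negPf gz) orbF => /eqP.
Qed.

Lemma regular_cast k l U (f : dom U -> K) : k = l -> regular k f -> regular l f.
Proof. by move=> ->. Qed.

(* The denominators of [f] form a homogeneous ideal without zeros in [basic h]. *)
Lemma regular_basic k U (f : dom U -> K) e h (N0 : nat) : regular k f ->
  (0 < e)%N -> h \is e.-homog -> basic h <<= U ->
  exists N a m, [/\ (N0 <= N)%N, a \is m.-homog, m%:Z = (e * N)%:Z + k &
    forall y : dom U, ev h (sval y) != 0 -> f y = ev a (sval y) / ev h (sval y) ^+ N].
Proof.
move=> hf e0 hh hU.
pose P (m : nat) (g : S) := g \is m.-homog /\ exists a : S,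
   [/\ forall m', m'%:Z = m%:Z + k -> a \is m'.-homog, m%:Z + k < 0 -> a = 0 &
     forall y : dom U, ev h (sval y) != 0 -> ev g (sval y) * f y = ev a (sval y)].
have PM m l p q : q \is l.-homog -> P m p -> P (l + m)%N (q * p).
  move=> hq [hp [a [ha na ya]]]; split; first exact: dhomogM.
  exists (q * a); split.
  - move=> m' em'; have [neg|pos] := ltP (m%:Z + k) 0.
      by rewrite na // mulr0 rpred0.
    have /ha : (shift m k)%:Z = m%:Z + k by rewrite /shift; lia.
    move=> {}ha; have -> : m' = (l + shift m k)%N by rewrite /shift; lia.
    exact: dhomogM.
  - by move=> neg; rewrite na ?mulr0 //; lia.
  - by move=> y hy; rewrite !evM -mulrA ya.
have [||||||N PN] := @graded_nullstellensatz K 4 K_fibers P e h.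
- move=> m; split; first exact: rpred0.
  by exists 0; split=> // [? _|y _]; rewrite ?rpred0 ?ev0 ?mul0r.
- move=> m p q [hp [a [ha na ya]]] [hq [b [hb nb yb]]]; split; first exact: rpredD.
  exists (a + b); split.
  + by move=> m' em'; apply: rpredD; [apply: ha|apply: hb].
  + by move=> neg; rewrite na ?nb ?addr0.
  + by move=> y hy; rewrite !evD mulrDl ya ?yb.
- by move=> m l p q; apply: PM.
- by move=> m p [].
- by [].
- move=> c hc.
  have c0 : (\row_i c i) != 0.
    apply: contraNneq hc => c0.
    rewrite (@meval_eq _ _ _ (fun=> 0)) ?(meval0_homog hh) // => i.
    by have := congr1 (fun v : 'rV_4 => v 0 i) c0; rewrite !mxE.
  have [x ex] := exists_pt c0.
  have evc p : p.@[c] = ev p x.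
    by rewrite /ev ex; apply: meval_eq => i; rewrite mxE.
  have hx : ev h x != 0 by rewrite -evc.
  have Ux : U x by apply: hU; split=> //; exists e.
  have [m [n [p [q [hp hq em qx hy]]]]] := hf (exist _ x Ux).
  (* The equation [q * f = p] is known only where [q] is nonzero; after one more factor [q] it holds
     everywhere on [basic h]. *)
  exists (n + n)%N, (q * q); rewrite evc evM mulf_neq0 //; split=> //.
  split; first exact: dhomogM.
  exists (p * q); split.
  + move=> m' em'; have -> : m' = (m + n)%N by lia.
    exact: dhomogM.
  + by move=> neg; lia.
  + move=> y hhy; rewrite !evM; have [->|qy] := eqVneq (ev q (sval y)) 0.
      by rewrite !mulr0 mul0r.
    by rewrite hy // mulrC mulrA divfK // mulrC.
(* The extra factor [h ^+ M] lifts the exponent above [N0] and makes the degree of the numerator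
   non-negative. *)
pose M := (N0 + absz k)%N.
have hM : h ^+ M \is (e * M)%N.-homog by apply: dhomogMn.
have := PM _ _ _ _ hM PN; rewrite -exprD -mulnDr => -[_ [a [ha _ ya]]].
exists (M + N)%N, a, (shift (e * (M + N)) k).
have eM : (shift (e * (M + N)) k)%:Z = (e * (M + N))%N%:Z + k.
  have : (M <= e * (M + N))%N by rewrite (leq_trans (leq_addr N M)) // leq_pmull.
  by rewrite /M /shift; lia.
split=> //.
- by rewrite /M; lia.
- exact: ha.
- by move=> y hy; rewrite -ya // evX mulrAC divff ?mul1r // expf_neq0.
Qed.

End Regular.

Section Sheaves.
Variable K : closedFieldType.
Implicit Types (U V W : open K) (F G : omodule K).

Definition at_pt U x (Ux : U x) : dom U := exist (pts_of U) x Ux.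

Lemma sub_open_refl U : U <<= U. Proof. by []. Qed.
Lemma sub_openIl U V : openI U V <<= U. Proof. by move=> x []. Qed.
Lemma sub_openIr U V : openI U V <<= V. Proof. by move=> x []. Qed.
Lemma sub_openI U V W : W <<= U -> W <<= V -> W <<= openI U V.
Proof. by move=> h h' x Wx; split; [exact: h | exact: h']. Qed.

Lemma regP k U (f : reg k U) : regular k f.
Proof. exact/asboolP/regfunP. Qed.

Lemma reg_ext k U (f g : reg k U) : (forall x, f x = g x) -> f = g.
Proof. by move=> e; apply/val_inj/funext. Qed.

(* Only meaningful if [f] is regular of degree [k]. *)
Definition toreg k U (f : dom U -> K) : reg k U := insubd (0 : reg k U) f.

Lemma toregE k U (f : dom U -> K) x : regular k f -> toreg k f x = f x.
Proof.
move=> hf; have mem : regular_pred K k U f by exact/asboolP.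
suff -> : toreg k f = Reg mem by [].
by apply: val_inj; rewrite val_insubd ifT.
Qed.

Lemma reg_resE k U V (h : V <<= U) (f : reg k U) x :
  reg_res h f x = f (dom_sub h x).
Proof. by []. Qed.

Lemma regDE k U (f g : reg k U) x : (f + g) x = f x + g x. Proof. by []. Qed.
Lemma regNE k U (f : reg k U) x : (- f) x = - f x. Proof. by []. Qed.
Lemma reg0E k U x : (0 : reg k U) x = 0. Proof. by []. Qed.
Lemma regZE k U (a : OP3 U) (f : reg k U) x : (a *: f) x = a x * f x.
Proof. by []. Qed.

Lemma regME U (a b : OP3 U) x : regfun (a * b : OP3 U) x = a x * b x.
Proof. by []. Qed.

Lemma reg_local_ext k U (f g : reg k U) :
  locally (fun V (h : V <<= U) => reg_res h f = reg_res h g) -> f = g.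
Proof.
move=> e; apply: reg_ext => x; have [V [h [Vx hV]]] := e _ (svalP x).
have := congr1 (fun r : reg k V => r (at_pt Vx)) hV; rewrite !reg_resE.
by have -> : dom_sub h (at_pt Vx) = x by apply: dom_inj.
Qed.

Lemma twist_sheaf k : is_sheaf (twist k : omodule K).
Proof.
move=> I U V h cov s comp.
pose f (x : dom U) : K :=
  let c := cid (cov _ (svalP x)) in
  s (projT1 c) (at_pt (projT2 c)).
have fE i (x : dom (V i)) : f (dom_sub (h i) x) = s i x.
  rewrite /f /=; case: cid => j /= Vj.
  have := comp i j (openI (V i) (V j)) (@sub_openIl _ _) (@sub_openIr _ _).
  have Vij : openI (V i) (V j) (sval x) by split=> //; exact: svalP.
  move=> /(congr1 (fun r : reg k _ => r (at_pt Vij))) /= e.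
  transitivity (s i (dom_sub (@sub_openIl (V i) (V j)) (at_pt Vij))).
    by rewrite e; congr (regfun (s j) _); exact: dom_inj.
  by congr (regfun (s i) _); exact: dom_inj.
have fR : regular k f.
  apply: regular_local => x; have [i Vi] := cov _ (svalP x).
  exists (V i), (h i); split=> //.
  have -> : f \o dom_sub (h i) = s i by apply/funext => y; exact: fE.
  exact: regP.
exists (toreg k f); split=> [i|t ht].
  by apply: reg_ext => x; rewrite reg_resE toregE.
apply: reg_ext => x; rewrite toregE //; have [i Vi] := cov _ (svalP x).
have -> : x = dom_sub (h i) (at_pt Vi) by apply: dom_inj.
rewrite fE -(ht i); congr (regfun t _); exact: dom_inj.
Qed.

Lemma sheaf_ext F U (s t : F U) : is_sheaf F ->
  locally (fun V (h : V <<= U) => res F h s = res F h t) -> s = t.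
Proof.
move=> sF e.
pose V (x : dom U) := projT1 (cid (e _ (svalP x))).
pose h (x : dom U) : V x <<= U := projT1 (cid (projT2 (cid (e _ (svalP x))))).
have hP (x : dom U) : V x (sval x) /\ res F (h x) s = res F (h x) t
  := projT2 (cid (projT2 (cid (e _ (svalP x))))).
have [|i j W hi hj|u [_ hu]] := sF _ U V h _ (fun x => res F (h x) s).
- by move=> x Ux; exists (at_pt Ux); have [] := hP (at_pt Ux).
- by rewrite (res_comp _ _ (sub_open_trans (h i) hi)) (res_comp _ _ (sub_open_trans (h i) hi)).
- by rewrite -(hu s) // -(hu t) // => x; have [] := hP x.
Qed.

Lemma sheaf_glue F U (P : forall V, V <<= U -> F V -> Prop) : is_sheaf F ->
  (forall x, U x -> exists V (h : V <<= U) s, V x /\ P V h s) ->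
  (forall V V' (h : V <<= U) (h' : V' <<= U) s s', P V h s -> P V' h' s' ->
     forall W (k : W <<= V) (k' : W <<= V'), res F k s = res F k' s') ->
  exists t : F U, forall x, U x -> exists V (h : V <<= U),
     V x /\ P V h (res F h t).
Proof.
move=> sF ex comp.
pose V (x : dom U) := projT1 (cid (ex _ (svalP x))).
pose hx (x : dom U) := cid (projT2 (cid (ex _ (svalP x)))).
pose h (x : dom U) : V x <<= U := projT1 (hx x).
pose s (x : dom U) : F (V x) := projT1 (cid (projT2 (hx x))).
have sP (x : dom U) : V x (sval x) /\ P _ (h x) (s x)
  := projT2 (cid (projT2 (hx x))).
have [|i j W hi hj|t [ht _]] := sF _ U V h _ s.
- by move=> x Ux; exists (at_pt Ux); have [] := sP (at_pt Ux).
- by have [_ Pi] := sP i; have [_ Pj] := sP j; exact: comp Pi Pj _ _ _.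
exists t => x Ux; exists (V (at_pt Ux)), (h (at_pt Ux)).
by have := sP (at_pt Ux); rewrite ht.
Qed.

Lemma resD F U V (h : V <<= U) (s t : F U) : res F h (s + t) = res F h s + res F h t.
Proof.
have := res_linear h 1 s t; rewrite scale1r.
by have [-> _ _] := resO_zmod h 1 1; rewrite scale1r.
Qed.
Lemma resZ F U V (h : V <<= U) a (s : F U) : res F h (a *: s) = resO h a *: res F h s.
Proof. by rewrite -[a *: s]addr0 res_linear res0 addr0. Qed.
Lemma resN F U V (h : V <<= U) (s : F U) : res F h (- s) = - res F h s.
Proof. by apply/eqP; rewrite -addr_eq0 -resD addNr res0. Qed.
Lemma resB F U V (h : V <<= U) (s t : F U) : res F h (s - t) = res F h s - res F h t.
Proof. by rewrite resD resN. Qed.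

Lemma homD F G (f : omod_hom F G) U (s t : F U) : f U (s + t) = f U s + f U t.
Proof. by have := hom_linear f 1 s t; rewrite !scale1r. Qed.
Lemma hom0 F G (f : omod_hom F G) U : f U 0 = 0.
Proof. by apply: (addIr (f U 0)); rewrite -homD !add0r. Qed.
Lemma homZ F G (f : omod_hom F G) U a (s : F U) : f U (a *: s) = a *: f U s.
Proof. by have := hom_linear f a s 0; rewrite hom0 !addr0. Qed.
Lemma homN F G (f : omod_hom F G) U (s : F U) : f U (- s) = - f U s.
Proof. by apply/eqP; rewrite -addr_eq0 -homD addNr hom0. Qed.
Lemma homB F G (f : omod_hom F G) U (s t : F U) : f U (s - t) = f U s - f U t.
Proof. by rewrite homD homN. Qed.

(** [Rel] is the graph of a homomorphism up to localisation: by linearity, relating zero only to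
    zero makes it single-valued, and local values glue. Homomorphisms given by formulas on local
    generators are built this way. *)
Lemma glue_hom F G (Rel : forall U, F U -> G U -> Prop) : is_sheaf G ->
  (forall U V (h : V <<= U) s t, Rel U s t -> Rel V (res F h s) (res G h t)) ->
  (forall U a s s' t t', Rel U s t -> Rel U s' t' ->
     Rel U (a *: s + s') (a *: t + t')) ->
  (forall U t, Rel U 0 t -> t = 0) ->
  (forall U (s : F U), locally (fun V (h : V <<= U) => exists t, Rel V (res F h s) t)) ->
  exists f : omod_hom F G,
    (forall U s, locally (fun V (h : V <<= U) => Rel V (res F h s) (res G h (f U s)))) /\
    (forall U s t, Rel U s t -> f U s = t).
Proof.
move=> sG Rres Rlin R0 Rex.
pose LR U (s : F U) (t : G U) :=
  locally (fun V (h : V <<= U) => Rel V (res F h s) (res G h t)).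
have Runiq U s t t' : Rel U s t -> Rel U s t' -> t = t'.
  move=> r r'; have := Rlin _ (-1) _ _ _ _ r r'.
  by rewrite !scaleN1r addNr => /R0 /eqP; rewrite addrC subr_eq0 => /eqP ->.
have Luniq U s t t' : LR U s t -> LR U s t' -> t = t'.
  move=> r r'; apply: sheaf_ext => // x Ux.
  have [V [h [Vx hV]]] := r x Ux; have [V' [h' [Vx' hV']]] := r' x Ux.
  pose W := openI V V'; have hW : W <<= U by exact: sub_open_trans h (@sub_openIl V V').
  exists W, hW; split; first by [].
  have := Rres _ _ (@sub_openIl V V') _ _ hV; have := Rres _ _ (@sub_openIr V V') _ _ hV'.
  rewrite !(res_comp _ _ hW) => q q'; exact: Runiq q' q.
have Lex U s : exists t, LR U s t.
  have [| | t ht] := @sheaf_glue G U (fun V h t => Rel V (res F h s) t) sG.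
  - move=> x Ux; have [V [h [Vx [t ht]]]] := Rex U s x Ux; by exists V, h, t.
  - move=> V V' h h' t t' r r' W k k'.
    have := Rres _ _ k _ _ r; have := Rres _ _ k' _ _ r'.
    rewrite !(res_comp _ _ (sub_open_trans h k)) => q q'; exact: Runiq q' q.
  by exists t => x Ux; have [V [h [Vx r]]] := ht x Ux; exists V, h.
pose f U s := projT1 (cid (Lex U s)).
have fP U s : LR U s (f U s) := projT2 (cid (Lex U s)).
have f_lin U : linear (@f U).
  move=> a s t; apply: (Luniq _ (a *: s + t)); first exact: fP.
  move=> x Ux; have [V [h [Vx hV]]] := fP U s x Ux.
  have [V' [h' [Vx' hV']]] := fP U t x Ux.
  pose W := openI V V'; have hW : W <<= U by exact: sub_open_trans h (@sub_openIl V V').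
  exists W, hW; split; first by [].
  have := Rres _ _ (@sub_openIl V V') _ _ hV; have := Rres _ _ (@sub_openIr V V') _ _ hV'.
  rewrite !(res_comp _ _ hW) !res_linear => q q'; exact: Rlin.
have f_res U V (h : V <<= U) s : f V (res F h s) = res G h (f U s).
  apply: (Luniq _ (res F h s)); first exact: fP.
  move=> x Vx; have [W [k [Wx hW]]] := fP U s x (h x Vx).
  pose W' := openI V W; have hk : W' <<= U by exact: sub_open_trans k (@sub_openIr V W).
  exists W', (@sub_openIl V W); split; first by [].
  have := Rres _ _ (@sub_openIr V W) _ _ hW.
  by rewrite !(res_comp _ _ hk).
exists (Defs.Hom f_lin f_res); split=> // U s t r.
apply: (Luniq _ s); first exact: fP.
by move=> x Ux; exists U, (@sub_open_refl U); split=> //; rewrite !res_id.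
Qed.

(** Left exactness on sections: local preimages are unique by injectivity, so they glue. *)
Lemma exact_ker (A B C : omodule K) (f : omod_hom A B) (g : omod_hom B C) U (b : B U) :
  is_sheaf A -> is_sheaf B -> short_exact f g -> g U b = 0 -> exists a, f U a = b.
Proof.
move=> sA sB [inj ker _] /ker hb.
have [||a ha] := @sheaf_glue A U (fun V h a => f V a = res B h b) sA.
- by move=> x Ux; have [V [h [Vx [a ea]]]] := hb x Ux; exists V, h, a.
- move=> V V' h h' s s' e e' W k k'; apply: (inj W).
  by rewrite !hom_res e e' !(res_comp _ _ (sub_open_trans h k)).
exists a; apply: sheaf_ext => // x Ux; have [V [h [Vx e]]] := ha x Ux.
by exists V, h; split=> //; rewrite -hom_res.
Qed.

Lemma exact_comp (A B C : omodule K) (f : omod_hom A B) (g : omod_hom B C) U (a : A U) :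
  short_exact f g -> g U (f U a) = 0.
Proof.
move=> [_ ker _]; apply/ker => x Ux; exists U, (@sub_open_refl U); split=> //.
by exists a; rewrite res_id.
Qed.

Lemma itwist_sheaf (I : ideal K) k : is_sheaf (itwist I k).
Proof.
move=> T U V h cov s comp.
have [i j W hi hj|t [ht tu]] := @twist_sheaf k T U V h cov (fun i => itwist_reg (s i)).
  exact: (congr1 (fun r => itwist_reg r) (comp i j W hi hj)).
have tP : in_itwist I k U t.
  apply/asboolP => x Ux; have [i Vi] := cov x Ux.
  have /asboolP/(_ x Vi) [W [k' [Wx [n [a [u [Ia e]]]]]]] := itwist_secP (s i).
  exists W, (sub_open_trans (h i) k'); split=> //; exists n, a, u; split=> //.
  by rewrite -e -(ht i); apply/esym/(reg_res_comp (h i) k').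
exists (ItwistSec tP); split=> [i|t' ht']; first by apply: val_inj; exact: ht.
apply: val_inj; apply: tu => i; by rewrite -(ht' i).
Qed.

End Sheaves.

(** * Lifting sections of the ideal of the line *)

Section Lifting.
Variables (K : closedFieldType) (L : set (pt K)) (e : int).
Hypothesis K_fibers : has_infinite_fibers K.
Variables (F : omodule K) (i : omod_hom (twist 0) F)
  (p : omod_hom F (itwist (ideal_of L) e)).
Hypotheses (sF : is_sheaf F) (ex : short_exact i p).
Notation S := {mpoly K[4]}.
Implicit Types (U V W : open K).

Definition proj_val U (s : F U) : reg e U := itwist_reg (p U s).

Lemma pvD U (s t : F U) x : proj_val (s + t) x = proj_val s x + proj_val t x.
Proof. by rewrite /proj_val homD. Qed.
Lemma pvB U (s t : F U) x : proj_val (s - t) x = proj_val s x - proj_val t x.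
Proof. by rewrite /proj_val homB. Qed.
Lemma pvZ U a (s : F U) x : proj_val (a *: s) x = a x * proj_val s x.
Proof. by rewrite /proj_val homZ. Qed.
Lemma pv_res U V (h : V <<= U) (s : F U) x : proj_val (res F h s) x = proj_val s (dom_sub h x).
Proof. by rewrite /proj_val hom_res. Qed.
Lemma pv_i U a x : proj_val (i U a) x = 0.
Proof. by rewrite /proj_val (exact_comp _ ex). Qed.

Lemma pv_ker U (s : F U) : (forall x, proj_val s x = 0) -> exists a, i U a = s.
Proof.
move=> s0; apply: (exact_ker _ sF ex); first exact: twist_sheaf.
by apply/val_inj/reg_ext => x; rewrite -/(proj_val s) s0.
Qed.

Lemma i_inj U : injective (i U).
Proof. by have [h _ _] := ex. Qed.

Section Affine.
Variables (h : S).
Hypothesis h_homog : h \is 1.-homog.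
Notation U0 := (basic h).

Lemma regular_ratio m W (g : S) : g \is m.-homog -> W <<= U0 ->
  regular 0 (fun x : dom W => ev g (sval x) / ev h (sval x) ^+ m).
Proof.
move=> hg WU; apply: (regularE hg (n := m) (q := h ^+ m)); rewrite ?addr0 //.
- by have := dhomogMn m h_homog; rewrite mul1n.
- by move=> y; rewrite evX expf_neq0 //; have [_] := WU _ (svalP y).
- by move=> y; rewrite evX.
Qed.

Section Extend.
Variable T : dom U0 -> K.
Variables (h0 : S) (e0 : nat) (s0 : F (basic h0)).
Hypotheses (h0_homog : h0 \is e0.-homog) (h0_neq0 : h0 != 0) (e0_gt0 : (0 < e0)%N)
  (h0U : basic h0 <<= U0).
Hypothesis s0T : forall x : dom (basic h0), proj_val s0 x = T (dom_sub h0U x).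
Hypothesis lifts : forall x : pt K, U0 x -> exists V (k : V <<= U0) (s : F V),
  V x /\ forall y : dom V, proj_val s y = T (dom_sub k y).

(** The form [h0] read as a function on [U0]. *)
Let u W (x : dom W) : K := ev h0 (sval x) / ev h (sval x) ^+ e0.

Let u_regular W N : W <<= U0 -> regular 0 (fun x : dom W => u x ^+ N).
Proof.
move=> WU; have hN : h0 ^+ N \is (e0 * N).-homog by apply: dhomogMn.
have := regular_ratio hN WU; congr (regular _ _); apply/funext => x.
by rewrite /u evX expr_div_n exprM.
Qed.

(** [t] lifts [u ^+ N] times [T] over [W] and equals [u ^+ N] times the given lift [s0] wherever
    [s0] is defined. The second condition is what makes [t] unique. *)
Definition extends N W (WU : W <<= U0) (t : F W) : Prop :=
  (forall x : dom W, proj_val t x = u x ^+ N * T (dom_sub WU x)) /\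
  forall V (k : V <<= W) (k0 : V <<= basic h0),
    res F k t = (toreg 0 (fun x : dom V => u x ^+ N) : OP3 V) *: res F k0 s0.

Lemma extends_res N W W' (WU : W <<= U0) (WU' : W' <<= U0) (k : W' <<= W) t :
  extends N WU t -> extends N WU' (res F k t).
Proof.
move=> [tT t0]; split=> [x|V k' k0].
  by rewrite pv_res tT; congr (_ * T _); exact: dom_inj.
by rewrite (res_comp _ _ (sub_open_trans k k')) t0.
Qed.

Lemma extends_scale N M W (WU : W <<= U0) t : extends N WU t ->
  extends (N + M) WU ((toreg 0 (fun x : dom W => u x ^+ M) : OP3 W) *: t).
Proof.
move=> [tT t0]; split=> [x|V k k0].
  by rewrite pvZ tT toregE ?exprD; [ring|exact: u_regular].
have VU : V <<= U0 by exact: sub_open_trans WU k.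
rewrite resZ (t0 V k k0) scalerA; congr (_ *: _).
apply: reg_ext => x; rewrite regME !toregE ?exprD; try exact: u_regular.
by rewrite reg_resE toregE 1?mulrC //; exact: u_regular.
Qed.

(** The difference comes from a regular function, and this function vanishes on the dense set
    [basic h0]. *)
Lemma extends_uniq N W (WU : W <<= U0) t t' : extends N WU t -> extends N WU t' -> t = t'.
Proof.
move=> [tT t0] [tT' t0']; have [|a ea] := @pv_ker W (t - t').
  by move=> x; rewrite pvB tT tT' subrr.
suff a0 : a = 0 by apply/eqP; rewrite -subr_eq0 -ea a0 hom0.
have e1 : reg_res (@sub_openIl _ W (basic h0)) a = 0.
  apply: i_inj; rewrite (hom_res i) ea resB.
  by rewrite (t0 _ _ (@sub_openIr _ W (basic h0))) (t0' _ _ (@sub_openIr _ W (basic h0))) subrr hom0.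
apply: reg_ext; apply: (regular_eq0 K_fibers (regP a) h0_neq0) => y hy.
have Wy : openI W (basic h0) (sval y).
  by split; [exact: svalP|split=> //; exists e0].
have := congr1 (fun r : reg 0 _ => r (at_pt Wy)) e1; rewrite reg0E => <-.
by rewrite reg_resE; congr (regfun a _); exact: dom_inj.
Qed.

Lemma extends_glue N W (WU : W <<= U0) :
  (forall x, W x -> exists V (k : V <<= W) t, V x /\ extends N (sub_open_trans WU k) t) ->
  exists t, extends N WU t.
Proof.
move=> hW.
have [//||t ht] := @sheaf_glue K F W (fun V k t => extends N (sub_open_trans WU k) t) sF.
  move=> V V' k k' t t' tV tV' X l l'.
  have XU : X <<= U0 by exact: sub_open_trans WU (sub_open_trans k l).
  by apply: (@extends_uniq N X XU); [exact: extends_res tV|exact: extends_res tV'].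
exists t; split=> [x|V k k0].
  have [V [k [Vx [tT _]]]] := ht _ (svalP x).
  have := tT (at_pt Vx); rewrite pv_res.
  have -> : dom_sub k (at_pt Vx) = x by apply: dom_inj.
  by move=> ->; congr (_ * T _); exact: dom_inj.
apply: sheaf_ext => // x Vx; have [X [l [Xx [_ tX]]]] := ht _ (k _ Vx).
exists (openI V X), (@sub_openIl _ V X); split=> //.
have VU : V <<= U0 by exact: sub_open_trans WU k.
rewrite resZ (res_comp _ _ (sub_open_trans k (@sub_openIl _ V X))).
rewrite (res_comp _ _ (sub_open_trans k0 (@sub_openIl _ V X))).
rewrite -(res_comp l (@sub_openIr _ V X) (sub_open_trans k (@sub_openIl _ V X))).
rewrite (tX _ _ (sub_open_trans k0 (@sub_openIl _ V X))); congr (_ *: _).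
apply: reg_ext => y; rewrite [RHS]reg_resE !toregE //; apply: u_regular => //.
exact: sub_open_trans VU (@sub_openIl _ V X).
Qed.

(** Near a point, a local lift of [T] differs from [s0] by a regular function on the part where [h0]
    is nonzero; a power of [u] clears its pole along [h0]. The exponent depends on the point, and
    the Nullstellensatz reduces to finitely many points. *)
Lemma lift_extend : exists N (t : F U0), extends N (@sub_open_refl _ U0) t.
Proof.
(* For a sum [g + g'] the two extensions are brought to the exponent [N + N'] and glued by
   uniqueness. *)
pose Q m (g : S) := g \is m.-homog /\ exists N (t : F (basic (g * h))) (k : basic (g * h) <<= U0),
  extends N k t.
have gU g m : g \is m.-homog -> basic (g * h) <<= U0.
  move=> _ x [_]; rewrite evM mulf_eq0 negb_or => /andP[_ hx].
  by split=> //; exists 1%N.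
have [||||||M [_ [N [t [k hk]]]]] := @graded_nullstellensatz K 4 K_fibers Q 1 h.
- move=> m; split; first exact: rpred0.
  have k : basic (0 * h) <<= U0 by apply: (gU 0 0%N); exact: rpred0.
  have [x|t ht] := @extends_glue 0 _ k; last by exists 0%N, t, k.
  by move=> [_ hx]; exfalso; move: hx; rewrite mul0r ev0 eqxx.
- move=> m g g' [hg [N [t [k hk]]]] [hg' [N' [t' [k' hk']]]]; split; first exact: rpredD.
  have kk := gU _ _ (rpredD hg hg').
  have [x|t1 ht1] := @extends_glue (N + N') _ kk; last by exists (N + N')%N, t1, kk.
  move=> [_ hx0]; have [gx hx] : ev g x + ev g' x != 0 /\ ev h x != 0.
    by move: hx0; rewrite evM evD mulf_eq0 negb_or => /andP[].
  have in1 (g1 : S) m1 : g1 \is m1.-homog -> ev g1 x != 0 -> basic (g1 * h) x.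
    move=> hg1 g1x; split; last by rewrite evM mulf_neq0.
    by exists (m1 + 1)%N; apply: dhomogM.
  have [gx0|gx0] := eqVneq (ev g x) 0.
    have g'x : ev g' x != 0 by move: gx; rewrite gx0 add0r.
    exists (openI (basic ((g + g') * h)) (basic (g' * h))), (@sub_openIl _ _ _).
    have := extends_scale N hk'; rewrite addnC => h1.
    eexists; split; last exact: (@extends_res _ _ _ _ _ (@sub_openIr _ _ _) _ h1).
    split; last exact: in1 hg' g'x.
    split; last by rewrite evM evD mulf_neq0.
    by exists (m + 1)%N; apply: dhomogM => //; apply: rpredD.
  exists (openI (basic ((g + g') * h)) (basic (g * h))), (@sub_openIl _ _ _).
  have h1 := extends_scale N' hk.
  eexists; split; last exact: (@extends_res _ _ _ _ _ (@sub_openIr _ _ _) _ h1).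
  split; last exact: in1 hg gx0.
  split; last by rewrite evM evD mulf_neq0.
  by exists (m + 1)%N; apply: dhomogM => //; apply: rpredD.
- move=> m l g q hq [hg [N [t [k hk]]]]; split; first exact: dhomogM.
  have k1 := gU _ _ (dhomogM hq hg).
  have k2 : basic (q * g * h) <<= basic (g * h).
    move=> x [_]; rewrite !evM !mulf_eq0 !negb_or -andbA => /and3P[_ gx hx].
    by split; [exists (m + 1)%N; apply: dhomogM|rewrite evM mulf_neq0].
  by exists N, (res F k2 t), k1; exact: extends_res hk.
- by move=> m g [].
- by [].
- move=> c hc.
  have c0 : (\row_i c i) != 0.
    apply: contraNneq hc => c0.
    rewrite (@meval_eq _ _ _ (fun=> 0)) ?(meval0_homog h_homog) // => j.
    by have := congr1 (fun v : 'rV_4 => v 0 j) c0; rewrite !mxE.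
  have [x ex'] := exists_pt c0.
  have evc g : g.@[c] = ev g x.
    by rewrite /ev ex'; apply: meval_eq => j; rewrite mxE.
  have Ux : U0 x by split; [exists 1%N|rewrite -evc].
  have [V [k [s [Vx sT]]]] := lifts Ux.
  have [m [g [hg gx gV]]] := basic_nbhd Vx.
  exists m, g; rewrite evc; split=> //; split=> //.
  have [N [t ht]] : exists N (t : F (basic g)), extends N (sub_open_trans k gV) t; last first.
    have kk : basic (g * h) <<= basic g.
      move=> y [_]; rewrite evM mulf_eq0 negb_or => /andP[gy _].
      by split=> //; exists m.
    by exists N, (res F kk t), (gU _ _ hg); apply: extends_res ht.
  have kW := gV; pose W := openI (basic g) (basic h0).
  have [|b eb] := @pv_ker W (res F (sub_open_trans gV (@sub_openIl _ _ _)) s - res F (@sub_openIr _ _ _) s0).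
    move=> y; rewrite pvB !pv_res sT s0T; apply/eqP; rewrite subr_eq0; apply/eqP.
    by congr (T _); exact: dom_inj.
  have gh0 : g * h0 \is (m + e0)%N.-homog by apply: dhomogM.
  have subW : basic (g * h0) <<= W.
    move=> y [_]; rewrite evM mulf_eq0 negb_or => /andP[gy hy].
    by split; split=> //; [exists m|exists e0].
  have [||||N [a [m' [_ ha em' ba]]]] := @regular_basic K K_fibers 0 W b (m + e0) (g * h0) 0 => //.
  - exact: regP.
  - by rewrite addn_gt0 e0_gt0 orbT.
  exists N.
  (* This is [u ^+ N * b] with [b = a / (g * h0) ^+ N]: the powers of [h0] cancel, so it is regular
     on all of [basic g]. *)
  pose a' (y : dom (basic g)) := ev a (sval y) / (ev g (sval y) ^+ N * ev h (sval y) ^+ (e0 * N)).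
  have ra' : regular 0 a'.
    apply: (regularE ha (n := (m * N + 1 * (e0 * N))%N) (q := g ^+ N * h ^+ (e0 * N))).
    - by apply: dhomogM; apply: dhomogMn.
    - by rewrite em'; lia.
    - move=> y; have [_ gy] := svalP y; have [_ hy] := k _ (gV _ (svalP y)).
      by rewrite evM !evX mulf_neq0 ?expf_neq0.
    - by move=> y; rewrite /a' evM !evX.
  have UN : regular 0 (fun y : dom (basic g) => u y ^+ N).
    by apply: u_regular; exact: sub_open_trans k gV.
  exists ((toreg 0 (fun y : dom (basic g) => u y ^+ N) : OP3 _) *: res F gV s - i _ (toreg 0 a')).
  split=> [y|X l l0].
    rewrite pvB pv_i subr0 pvZ toregE // pv_res sT; congr (_ * T _).
    exact: dom_inj.
  have XW : X <<= W by exact: sub_openI.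
  have XU : X <<= U0 by exact: sub_open_trans h0U l0.
  rewrite resB resZ -hom_res (res_comp _ _ (sub_open_trans gV l)).
  have -> : res F (sub_open_trans gV l) s = i X (reg_res XW b) + res F l0 s0.
    have /eqP := congr1 (res F XW) eb; rewrite resB -(hom_res i).
    rewrite (res_comp _ _ (sub_open_trans gV l)) (res_comp _ _ l0).
    by rewrite eq_sym subr_eq => /eqP.
  rewrite scalerDr -homZ addrAC -homB.
  have -> : resO l (toreg 0 (fun y : dom (basic g) => u y ^+ N)) =
            toreg 0 (fun x : dom X => u x ^+ N).
    by apply: reg_ext => y; rewrite [LHS]reg_resE !toregE //; exact: u_regular.
  rewrite (_ : _ - _ = 0) ?hom0 ?add0r //.
  apply: reg_ext => y; rewrite regDE regNE regZE !toregE //; last exact: u_regular.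
  have [_ gy] := l _ (svalP y); have [_ hy] := l0 _ (svalP y); have [_ hhy] := XU _ (svalP y).
  rewrite !reg_resE toregE // ba; last by rewrite evM mulf_neq0.
  rewrite /u /a' evM /= expr_div_n exprMn exprM; apply/eqP; rewrite subr_eq0; apply/eqP.
  have := expf_neq0 N gy; have := expf_neq0 N hy; have := expf_neq0 N (expf_neq0 e0 hhy).
  move: (ev g _ ^+ N) (ev h0 _ ^+ N) (_ ^+ N) (ev a _) => A B C D nA nB nC; field.
  by rewrite nA nB nC.
have kk : U0 <<= basic (h ^+ M * h).
  move=> x [_ hx]; split; last by rewrite evM evX mulf_neq0 ?expf_neq0.
  by exists (1 * M + 1)%N; apply: dhomogM => //; apply: dhomogMn.
by exists N, (res F kk t); exact: extends_res hk.
Qed.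

End Extend.

(** A partition of unity: the forms [g] for which [g / h ^+ m] times [T] lifts to [U0] make up an
    ideal, and [lift_extend] provides one that is nonzero at any prescribed point of [U0]. *)
Lemma affine_lift (T : itwist (ideal_of L) e U0) : exists s : F U0, p U0 s = T.
Proof.
pose T' : reg e U0 := itwist_reg T.
have lifts x : U0 x -> exists V (k : V <<= U0) (s : F V),
    V x /\ forall y : dom V, proj_val s y = T' (dom_sub k y).
  move=> Ux; have [_ _ /(_ _ T x Ux) [V [k [Vx [s es]]]]] := ex.
  by exists V, k, s; split=> // y; rewrite /proj_val es.
pose P m (g : S) := g \is m.-homog /\ exists s : F U0, forall x,
   proj_val s x = ev g (sval x) / ev h (sval x) ^+ m * T' x.
have [||||||M [_ [s hs]]] := @graded_nullstellensatz K 4 K_fibers P 1 h.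
- move=> m; split; first exact: rpred0.
  by exists 0 => x; rewrite /proj_val hom0 ev0 !mul0r.
- move=> m g g' [hg [s hs]] [hg' [s' hs']]; split; first exact: rpredD.
  by exists (s + s') => x; rewrite pvD hs hs' evD !mulrDl.
- move=> m l g q hq [hg [s hs]]; split; first exact: dhomogM.
  exists ((toreg 0 (fun x : dom U0 => ev q (sval x) / ev h (sval x) ^+ l) : OP3 U0) *: s).
  move=> x; rewrite pvZ hs toregE; last exact: regular_ratio.
  by rewrite evM exprD invfM; ring.
- by move=> m g [].
- by [].
- move=> c hc.
  have c0 : (\row_i c i) != 0.
    apply: contraNneq hc => c0.
    rewrite (@meval_eq _ _ _ (fun=> 0)) ?(meval0_homog h_homog) // => j.
    by have := congr1 (fun v : 'rV_4 => v 0 j) c0; rewrite !mxE.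
  have [x ex'] := exists_pt c0.
  have evc g : g.@[c] = ev g x.
    by rewrite /ev ex'; apply: meval_eq => j; rewrite mxE.
  have Ux : U0 x by split; [exists 1%N|rewrite -evc].
  have [V [k [s [Vx sT]]]] := lifts x Ux.
  have [m [g [hg gx gV]]] := basic_nbhd Vx.
  pose h0 := g * h.
  have hh0 : h0 \is (m + 1)%N.-homog by apply: dhomogM.
  have h0x : ev h0 x != 0 by rewrite evM mulf_neq0 // -evc.
  have h0V : basic h0 <<= V.
    move=> y [_]; rewrite evM mulf_eq0 negb_or => /andP[gy _].
    by apply: gV; split=> //; exists m.
  have [|||N [t [tT _]]] := @lift_extend T' h0 (m + 1) (res F h0V s) hh0 _ _
     (sub_open_trans k h0V) _ lifts.
  + exact: ev_neq0 h0x.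
  + by rewrite addn1.
  + by move=> y; rewrite pv_res sT; congr (regfun T' _); exact: dom_inj.
  exists ((m + 1) * N)%N, (h0 ^+ N); rewrite evc evX expf_neq0 //; split=> //.
  split; first exact: dhomogMn.
  exists t => y; rewrite tT evX expr_div_n exprM; congr (_ * regfun T' _).
  exact: dom_inj.
exists s; apply/val_inj/reg_ext => x; have := hs x; rewrite evX mul1n divff ?mul1r //.
by rewrite expf_neq0 //; have [] := svalP x.
Qed.

End Affine.
End Lifting.

(** * Sections over the coordinate charts *)

Section Powers.
Variable K : closedFieldType.
Implicit Types (U V W : open K).

Lemma X_homog j : 'X_j \is [in K[4], 1.-homog].
Proof. by rewrite dhomogX /= mdeg1. Qed.

Lemma basicX j (x : pt K) : val x 0 j != 0 -> basic 'X_j x.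
Proof. by move=> xj; split; [exists 1%N; exact: X_homog|rewrite evXU]. Qed.

Lemma basicXE U j (h : U <<= basic 'X_j) (x : dom U) : val (sval x) 0 j != 0.
Proof. by have [_] := h _ (svalP x); rewrite evXU. Qed.

Lemma pt_basicX (x : pt K) : exists j, basic 'X_j x.
Proof. by have [j xj] := pt_coord x; exists j; apply: basicX. Qed.

Lemma regular_pow j z U : U <<= basic 'X_j ->
  regular z (fun x : dom U => val (sval x) 0 j ^ z).
Proof.
move=> h; have hX n : ('X_j : {mpoly K[4]}) ^+ n \is n.-homog.
  by have := dhomogMn n (X_homog j); rewrite mul1n.
case: z => n.
  apply: (regularE (hX n) (dhomog1 _ _)); rewrite ?add0r // => y.
    by rewrite ev1 oner_neq0.
  by rewrite ev1 divr1 evX evXU.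
apply: (regularE (dhomog1 _ _) (hX n.+1)); rewrite ?NegzE ?subrr // => y.
  by rewrite evX evXU expf_neq0 // (basicXE h).
by rewrite ev1 evX evXU mul1r exprnN.
Qed.

(** On a chart [l * g] is the product of [l / 'X_j], a function vanishing on [L], and the section
    ['X_j * g] of [O(k)]. *)
Lemma itwist_product (L : set (pt K)) k U l (g : dom U -> K) :
  l \is 1.-homog -> (forall x, L x -> ev l x = 0) -> regular (k - 1) g ->
  exists T : itwist_sec (ideal_of L) k U, forall x, T x = ev l (sval x) * g x.
Proof.
move=> hl lL hg.
have r1 : regular k (fun x : dom U => ev l (sval x) * g x).
  by apply: (regular_cast (k := 1 + (k - 1))); [lia|apply: regularM => //; exact: regular_poly].
suff hT : in_itwist (ideal_of L) k U (toreg k (fun x : dom U => ev l (sval x) * g x)).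
  by exists (ItwistSec hT) => x /=; rewrite toregE.
apply/asboolP => x Ux; have [j xj] := pt_basicX x.
pose V := openI U (basic 'X_j); exists V, (@sub_openIl _ _ _); split=> //.
have ra : regular 0 (fun y : dom V => ev l (sval y) * val (sval y) 0 j ^ (-1)).
  apply: (regular_cast (k := 1 + (-1))) => //; apply: regularM; first exact: regular_poly.
  by apply: regular_pow; exact: sub_openIr.
have rt : regular k (fun y : dom V => val (sval y) 0 j * g (dom_sub (@sub_openIl _ _ _) y)).
  apply: (regular_cast (k := 1 + (k - 1))); first lia.
  apply: regularM; last exact: regular_sub.
  by have := @regular_poly K 1 V 'X_j (X_homog j); congr (regular _ _); apply/funext => y; rewrite evXU.
exists 1%N, (fun=> toreg 0 (fun y : dom V => ev l (sval y) * val (sval y) 0 j ^ (-1))),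
  (fun=> toreg k (fun y : dom V => val (sval y) 0 j * g (dom_sub (@sub_openIl _ _ _) y))).
split=> [_ y Ly|]; first by rewrite toregE // lL // mul0r.
rewrite big_ord1; apply: reg_ext => y; rewrite reg_resE regZE !toregE //=.
have yj := basicXE (@sub_openIr _ U (basic 'X_j)) y.
by rewrite exprN1 -mulrA; congr (_ * _); rewrite mulKf.
Qed.

End Powers.

(** * Global lifts of the equations of the line *)

Lemma cocycle_clear (K : fieldType) N (x y z a b c : K) :
  x != 0 -> y != 0 -> z != 0 ->
  c / (x * z) ^+ N = a / (x * y) ^+ N + b / (y * z) ^+ N ->
  a * z ^+ N + b * x ^+ N - c * y ^+ N = 0.
Proof.
rewrite !exprMn => /(expf_neq0 N) + /(expf_neq0 N) + /(expf_neq0 N).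
move: (x ^+ N) (y ^+ N) (z ^+ N) => X Y Z X0 Y0 Z0 e.
have -> : c = (a / (X * Y) + b / (Y * Z)) * (X * Z).
  by rewrite -e divfK // mulf_neq0.
by field; rewrite X0 Y0 Z0.
Qed.

Lemma coboundary_clear (K : fieldType) N (z : int) (x y a b c : K) :
  x != 0 -> y != 0 ->
  x ^ (- z) * a = (b * y ^+ N - c * x ^+ N) / (x * y) ^+ N ->
  a = b / x ^+ N * x ^ z - x ^ z * y ^ (- z) * (c / y ^+ N * y ^ z).
Proof.
move=> x0 y0 e.
have -> : a = x ^ z * (x ^ (- z) * a) by rewrite mulrA -expfzDr // subrr mul1r.
have ey : y ^ (- z) * y ^ z = 1 by rewrite -expfzDr // addNr.
rewrite e -[in RHS](mulrA (x ^ z)) [c / _ * _]mulrC (mulrA (y ^ (- z))) ey mul1r.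
have := expf_neq0 N x0; have := expf_neq0 N y0; rewrite exprMn.
by move: (x ^+ N) (y ^+ N) (x ^ z) => X Y Z Y0 X0; field; rewrite X0 Y0.
Qed.

Lemma transition_clear (K : fieldType) (z : int) (x y b : K) : x != 0 ->
  x ^ (- z) * b * (x ^ z * y ^ (- z)) = y ^ (- z) * b.
Proof.
move=> x0; rewrite mulrACA -expfzDr // addNr mul1r mulrC //.
Qed.

Lemma subr_swap (V : zmodType) (u v x y : V) : u - v = x - y -> u - x = v - y.
Proof.
move=> e; have -> : u = x - y + v by rewrite -e subrK.
by rewrite addrC addrA addKr addrC.
Qed.

Section GlobalLift.
Variables (K : closedFieldType) (L : set (pt K)) (e : int).
Hypothesis K_fibers : has_infinite_fibers K.
Variables (F : omodule K) (i : omod_hom (twist 0) F)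
  (p : omod_hom F (itwist (ideal_of L) e)).
Hypotheses (sF : is_sheaf F) (ex : short_exact i p).
Notation S := {mpoly K[4]}.
Implicit Types (U V W : open K).
Notation pv s := (proj_val p s).
Let z := e - 1.
Variable l : S.
Hypotheses (l_homog : l \is 1.-homog) (lL : forall x, L x -> ev l x = 0).

Let co (j : 'I_4) U (x : dom U) : K := val (sval x) 0 j.
Arguments co : clear implicits.
(** The transition function of [O(e - 1)] between the trivialisations by powers of the coordinates
    [j] and [k]. *)
Let tr (j k : 'I_4) U (x : dom U) : K := co j U x ^ z * co k U x ^ (- z).
Arguments tr : clear implicits.

Let tr_regular j k U : U <<= basic 'X_j -> U <<= basic 'X_k ->
  regular 0 (tr j k U).
Proof.
move=> hj hk; apply: (regular_cast (k := z + - z)); first by rewrite subrr.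
by apply: regularM; apply: regular_pow.
Qed.

Let trO j k U : OP3 U := toreg 0 (tr j k U).

Let basic_lift j : exists s : F (basic 'X_j),
  forall x, pv s x = ev l (sval x) * co j _ x ^ z.
Proof.
have [|T hT] := @itwist_product K L e (basic 'X_j) l (fun x => co j _ x ^ z) l_homog lL.
  exact: regular_pow.
have [s es] := affine_lift K_fibers sF ex (X_homog K j) (T : itwist (ideal_of L) e (basic 'X_j)).
by exists s => x; rewrite /Defs.happ -hT /proj_val es.
Qed.

(** The chartwise lifts of [l] times ['X_j ^ z] disagree by functions [a j k]. Divided by ['X_j ^ z]
    these form a Cech 1-cocycle of [O(-z)], and a cochain bounding it corrects the lifts. *)
Lemma global_lift : exists s : omod_hom (twist (e - 1)) F,
  forall U (b : reg (e - 1) U) x, pv (s U b) x = ev l (sval x) * b x.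
Proof.
pose s0 j := projT1 (cid (basic_lift j)).
have s0P j x : pv (s0 j) x = ev l (sval x) * co j _ x ^ z := projT2 (cid (basic_lift j)) x.
pose W j k := openI (basic ('X_j : S)) (basic ('X_k : S)).
have Wl j k : W j k <<= basic 'X_j by exact: sub_openIl.
have Wr j k : W j k <<= basic 'X_k by exact: sub_openIr.
have diff j k : exists a : OP3 (W j k),
    i _ a = res F (Wl j k) (s0 j) - trO j k _ *: res F (Wr j k) (s0 k).
  apply: (pv_ker sF ex) => x; rewrite pvB pvZ !pv_res !s0P toregE; last exact: tr_regular.
  rewrite /tr /co /= mulrCA -!mulrA -expfzDr ?addNr ?mulr1 ?subrr //.
  exact: (basicXE (Wr j k)).
pose a j k := projT1 (cid (diff j k)).
have aP j k : i _ (a j k) = _ := projT2 (cid (diff j k)).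
have aV j k V (hj : V <<= basic 'X_j) (hk : V <<= basic 'X_k) (h : V <<= W j k) :
    i V (reg_res h (a j k)) = res F hj (s0 j) - trO j k V *: res F hk (s0 k).
  rewrite (hom_res i) aP resB resZ (res_comp _ _ hj) (res_comp _ _ hk).
  congr (_ - _ *: _); apply: reg_ext => x; rewrite reg_resE !toregE //; exact: tr_regular.
have a_cocycle j k m (x : pt K) (xjk : W j k x) (xkm : W k m x) (xjm : W j m x) :
    a j m (at_pt xjm) = a j k (at_pt xjk) + tr j k _ (at_pt xjk) * a k m (at_pt xkm).
  pose V := openI (W j k) (W k m); have Vx : V x by [].
  have Vj : V <<= basic 'X_j by move=> y [[]].
  have Vk : V <<= basic 'X_k by move=> y [[]].
  have Vm : V <<= basic 'X_m by move=> y [_ []].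
  have Vjm : V <<= W j m by exact: sub_openI.
  have eq : reg_res Vjm (a j m) = reg_res (@sub_openIl _ _ _) (a j k) +
      trO j k V *: (reg_res (@sub_openIr _ _ _) (a k m) : twist 0 V).
    apply: (i_inj ex); rewrite homD homZ !aV scalerBr addrA subrK scalerA.
    congr (_ - _ *: _); apply: reg_ext => y; rewrite regME !toregE; try exact: tr_regular.
    have ck : co k V y ^ (- z) * co k V y ^ z = 1.
      by rewrite -expfzDr ?addNr ?(basicXE Vk).
    by rewrite /tr -mulrA (mulrA (co k V y ^ (- z))) ck mul1r.
  have := congr1 (fun r : reg 0 V => r (at_pt Vx)) eq.
  rewrite regDE regZE !reg_resE toregE; last exact: tr_regular.
  move=> q; transitivity (a j m (dom_sub Vjm (at_pt Vx))).
    by congr (regfun _ _); exact: dom_inj.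
  by rewrite q; congr (_ + _ * _); congr (regfun _ _); exact: dom_inj.
pose a' j k (x : dom (W j k)) := co j _ x ^ (- z) * a j k x.
have a'R j k : regular (- z) (a' j k).
  apply: (regular_cast (k := - z + 0)); first by rewrite addr0.
  by apply: regularM; [apply: regular_pow; exact: Wl|exact: regP].
have XX j k : 'X_j * 'X_k \is [in K[4], 2.-homog].
  by apply: (@dhomogM _ _ _ 1 _ 1); exact: X_homog.
have WXX j k : basic ('X_j * 'X_k) <<= W j k.
  move=> y [_]; rewrite evM mulf_eq0 negb_or !evXU => /andP[yj yk].
  by split; apply: basicX.
have coN j k (y : dom (W j k)) : co j _ y != 0 /\ co k _ y != 0.
  by split; [exact: (basicXE (Wl j k))|exact: (basicXE (Wr j k))].
have frac j k := @regular_basic K K_fibers (- z) (W j k) (a' j k) 2 ('X_j * 'X_k) 0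
  (a'R j k) isT (XX j k) (WXX j k).
pose N0 j k := projT1 (cid (frac j k)).
(* One exponent for all denominators; the summand [absz z] makes [N - z] non-negative, so that [nb]
   is this difference. *)
pose N := (absz z + \sum_j \sum_k N0 j k)%N.
have N0N j k : (N0 j k <= N)%N.
  rewrite /N (bigD1 j) //= (bigD1 k) //= addnC -!addnA leq_addr //.
pose nb := absz (N%:Z - z).
have nbE : nb%:Z = N%:Z - z by rewrite /nb /N; lia.
have AE j k : exists A : S, A \is (N + nb)%N.-homog /\ forall y : dom (W j k),
    a' j k y = ev A (sval y) / (co j _ y * co k _ y) ^+ N.
  have [A [m [_ hA em AP]]] := projT2 (cid (frac j k)).
  rewrite -/(N0 j k) in em AP.
  exists (A * ('X_j * 'X_k) ^+ (N - N0 j k)); split.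
    have -> : (N + nb)%N = (m + 2 * (N - N0 j k))%N by have := N0N j k; lia.
    by apply: dhomogM => //; apply: dhomogMn.
  move=> y; have [yj yk] := coN j k y; rewrite AP evM !evXU ?mulf_neq0 //.
  rewrite evM evX evM !evXU -/(co j _ y) -/(co k _ y).
  rewrite -[X in _ = _ / _ ^+ X](subnK (N0N j k)) exprD.
  by rewrite [X in _ = _ / X]mulrC -mulf_div divff ?mulr1 // expf_neq0 ?mulf_neq0.
pose A j k := projT1 (cid (AE j k)).
have A_homog j k : A j k \is (N + nb)%N.-homog by have [] := projT2 (cid (AE j k)).
have AP j k (y : dom (W j k)) : a' j k y = ev (A j k) (sval y) / (co j _ y * co k _ y) ^+ N.
  by have [_] := projT2 (cid (AE j k)); apply.
have A_cocycle j k m : A j k * 'X_m ^+ N + A k m * 'X_j ^+ N = A j m * 'X_k ^+ N.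
  apply/eqP; rewrite -subr_eq0; apply/eqP.
  apply: (@ev_ext0_on K K_fibers _ ('X_j * 'X_k * 'X_m)).
    by rewrite !mulf_neq0 ?X_neq0.
  move=> x; rewrite !evM !mulf_eq0 !negb_or !evXU -andbA => /and3P[xj xk xm].
  have xjk : W j k x by split; apply: basicX.
  have xkm : W k m x by split; apply: basicX.
  have xjm : W j m x by split; apply: basicX.
  have := a_cocycle j k m x xjk xkm xjm.
  have := AP j k (at_pt xjk); have := AP k m (at_pt xkm); have := AP j m (at_pt xjm).
  rewrite /a' /tr /co /= => e1 e2 e3 e4.
  have {e2} e2 : val x 0 k ^ (- z) * a k m (at_pt xkm) =
     ev (A k m) x / (val x 0 k * val x 0 m) ^+ N by exact: e2.
  have {e4} e4 : val x 0 j ^ (- z) * a j m (at_pt xjm) =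
     val x 0 j ^ (- z) * a j k (at_pt xjk) + val x 0 k ^ (- z) * a k m (at_pt xkm).
    rewrite e4 mulrDr !mulrA -expfzDr // addNr mul1r //.
  rewrite e1 e2 e3 in e4.
  rewrite evB evD !evM !evX !evXU.
  exact: cocycle_clear e4; exact.
have [B0 B0P] := cech_H1 A_cocycle.
(* [cech_H1] does not keep track of degrees; as the cocycle is homogeneous, the components of degree
   [nb] bound it too. *)
pose B j := pihomog [measure of mdeg] nb (B0 j).
have XN j : 'X_j ^+ N \is [in K[4], N.-homog].
  by have := dhomogMn N (X_homog K j); rewrite mul1n.
have BP j k : A j k = B j * 'X_k ^+ N - B k * 'X_j ^+ N.
  rewrite -[LHS](pihomog_dE (A_homog j k)) B0P raddfB /= ![_ * 'X__ ^+ _]mulrC.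
  by rewrite !pihomogM.
have B_homog j : B j \is nb.-homog by exact: pihomogP.
pose b0f j (x : dom (basic 'X_j)) := ev (B j) (sval x) / co j _ x ^+ N * co j _ x ^ z.
have b0R j : regular 0 (b0f j).
  apply: (regular_cast (k := (nb%:Z - N%:Z) + z)); first by rewrite nbE; ring.
  apply: regularM; last exact: regular_pow.
  apply: (regularE (B_homog j) (XN j)); first by rewrite addrC subrK.
    by move=> y; rewrite evX evXU expf_neq0 // (basicXE (@sub_open_refl _ _) y).
  by move=> y; rewrite evX evXU.
pose b0 j : OP3 (basic 'X_j) := toreg 0 (b0f j).
pose s1 j := s0 j - i _ (b0 j).
have s1P j x : pv (s1 j) x = ev l (sval x) * co j _ x ^ z.
  by rewrite pvB (pv_i ex) subr0 s0P.
have s1V j k V (hj : V <<= basic 'X_j) (hk : V <<= basic 'X_k) :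
    res F hj (s1 j) = trO j k V *: res F hk (s1 k).
  have hW : V <<= W j k by exact: sub_openI.
  have ea : i V (reg_res hW (a j k)) =
      i V (reg_res hj (b0 j)) - trO j k V *: i V (reg_res hk (b0 k)).
    rewrite -homZ -homB; congr (i V _); apply: reg_ext => x.
    rewrite regDE regNE regZE !reg_resE !toregE //; last exact: tr_regular.
    have xj : co j V x != 0 by exact: (basicXE hj).
    have xk : co k V x != 0 by exact: (basicXE hk).
    have := AP j k (dom_sub hW x); rewrite BP evB !evM !evX !evXU /a'.
    by move=> h; exact: (coboundary_clear xj xk h).
  rewrite (aV _ _ _ hj hk) in ea; rewrite !resB -!hom_res scalerBr.
  exact: subr_swap ea.
(* On the chart [k], [b] is a function times ['X_k ^ z], and that function multiplies the corrected
   lift [s1 k]. *)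
pose Rel U (b : twist (e - 1) U) (t : F U) := forall k V (h : V <<= U) (hk : V <<= basic 'X_k),
  res F h t = (toreg 0 (fun x : dom V => co k V x ^ (- z) * (b : reg _ _) (dom_sub h x)) : OP3 V)
     *: res F hk (s1 k).
have bR k V U (h : V <<= U) (b : reg (e - 1) U) : V <<= basic 'X_k ->
    regular 0 (fun x : dom V => co k V x ^ (- z) * b (dom_sub h x)).
  move=> hk; apply: (regular_cast (k := - z + z)); first by rewrite addNr.
  apply: regularM; first exact: regular_pow.
  exact: regular_sub (regP b).
have [||||f [f1 f2]] := @glue_hom K (twist (e - 1)) F Rel sF.
- move=> U V h b t r k V2 h' hk; rewrite (res_comp _ _ (sub_open_trans h h')) (r k).
  congr (_ *: _); congr (toreg 0 _); apply/funext => x.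
  by congr (_ * _); rewrite [in RHS]reg_resE; congr (regfun b _); exact: dom_inj.
- move=> U c b b' t t' r r' k V h hk; rewrite resD resZ (r k V h hk) (r' k V h hk).
  rewrite scalerA -scalerDl; congr (_ *: _); apply: reg_ext => x.
  rewrite regDE regME reg_resE !toregE; try exact: bR.
  by rewrite regDE regZE mulrDr mulrCA.
- move=> U t r; apply: sheaf_ext => // x Ux; have [k xk] := pt_basicX x.
  exists (openI U (basic 'X_k)), (@sub_openIl _ _ _); split=> //.
  rewrite (r k _ _ (@sub_openIr _ _ _)) res0.
  rewrite (_ : toreg _ _ = 0) ?scale0r //; apply: reg_ext => y.
  rewrite toregE ?mulr0 //; apply: (bR k _ _ _ 0); exact: sub_openIr.
- move=> U b x Ux; have [k xk] := pt_basicX x.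
  pose V := openI U (basic ('X_k : S)); have hk : V <<= basic 'X_k by exact: sub_openIr.
  exists V, (@sub_openIl _ _ _); split=> //.
  exists ((toreg 0 (fun x : dom V => co k V x ^ (- z) * (b : reg _ _) (dom_sub (@sub_openIl _ _ _) x)) : OP3 V) *: res F hk (s1 k)).
  move=> k' V' h hk'; rewrite resZ (res_comp _ _ (sub_open_trans hk h)).
  rewrite (s1V _ _ _ (sub_open_trans hk h) hk') scalerA; congr (_ *: _); apply: reg_ext => y.
  rewrite regME reg_resE !toregE.
  + exact: transition_clear (basicXE (sub_open_trans hk h) y).
  + by apply: tr_regular => //; exact: sub_open_trans hk h.
  + exact: bR hk'.
  + exact: bR hk.
exists f => U b x; have [V [h [Vx r]]] := f1 U b _ (svalP x).
have [k xk] := pt_basicX (sval x).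
pose W' := openI V (basic ('X_k : S)); have hk : W' <<= basic 'X_k by exact: sub_openIr.
have Wx : W' (sval x) by [].
have := r k W' (@sub_openIl _ _ _) hk; rewrite (res_comp _ _ (sub_open_trans h (@sub_openIl _ _ _))).
move=> /(congr1 (fun t => pv t (at_pt Wx))); rewrite pv_res pvZ pv_res s1P toregE.
  have -> : dom_sub (sub_open_trans h (@sub_openIl _ _ _)) (at_pt Wx) = x by exact: dom_inj.
  move=> ->; have x0 : val (sval x) 0 k != 0 by exact: (basicXE hk (at_pt Wx)).
  transitivity (val (sval x) 0 k ^ (- z) * b x * (ev l (sval x) * val (sval x) 0 k ^ z)).
    by congr (_ * _ * _); rewrite reg_resE; congr (regfun b _); exact: dom_inj.
  by rewrite [ev l _ * _]mulrC mulrACA -expfzDr // addNr mul1r mulrC.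
by apply: bR.
Qed.

End GlobalLift.

Definition o0 : 'I_4 := @Ordinal 4 0 isT.
Definition o1 : 'I_4 := @Ordinal 4 1 isT.
Definition o2 : 'I_4 := @Ordinal 4 2 isT.
Definition o3 : 'I_4 := @Ordinal 4 3 isT.

Section Division.
Variables (K : closedFieldType) (B C : 'M[K]_4).
Hypothesis K_fibers : has_infinite_fibers K.
Hypotheses (CB : C *m B = 1%:M) (BC : B *m C = 1%:M).
Notation S := {mpoly K[4]}.
Notation l := (lf B).
Implicit Types (U V W : open K).

Lemma regular_mulp m k k' U (q : S) (g : dom U -> K) : q \is m.-homog -> k' = m%:Z + k ->
  regular k g -> regular k' (fun x => ev q (sval x) * g x).
Proof. by move=> hq -> hg; apply: regularM => //; exact: regular_poly. Qed.

(** Two coordinates form a regular sequence: over a common denominator the quotient is found among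
    polynomials, and it is unique because [l i] is nonzero on a dense set. *)
Lemma regular_divide i j k U (f g : dom U -> K) : i != j ->
  regular k f -> regular k g ->
  (forall x, ev (l i) (sval x) * g x = ev (l j) (sval x) * f x) ->
  exists2 h : dom U -> K, regular (k - 1) h &
    forall x, f x = ev (l i) (sval x) * h x /\ g x = ev (l j) (sval x) * h x.
Proof.
move=> ij hf hg e.
pose P V (hV : V <<= U) (h : reg (k - 1) V) := forall x : dom V,
  f (dom_sub hV x) = ev (l i) (sval x) * h x /\ g (dom_sub hV x) = ev (l j) (sval x) * h x.
have [||h hh] := @sheaf_glue K (twist (k - 1)) U P (@twist_sheaf _ _).
- move=> x Ux.
  (* The bound [absz (k - 1)] makes the degree [n + k] of the numerators positive, as the quotient
     by a linear form requires. *)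
  have [|n [q [p [n0 hq qx qU hp]]]] := @common_denominator K U (at_pt Ux) 2 (fun=> k)
    (fun a => if a == ord0 then f else g) (absz (k - 1)).
    by move=> a; case: ifP.
  have [m [hm em hpf]] := hp ord0; have [m' [hm' em' hpg]] := hp (lift ord0 ord0).
  have em'm : m' = m by lia.
  rewrite em'm in hm'; rewrite /= in hpf hpg.
  have inU y : ev q y != 0 -> U y by move=> qy; apply: qU; split=> //; exists n.
  have eP : l i ^+ 1 * p (lift ord0 ord0) = l j ^+ 1 * p ord0.
    apply/eqP; rewrite -subr_eq0; apply/eqP.
    apply: (ev_ext0_on K_fibers (ev_neq0 qx)) => y qy.
    have := e (at_pt (inU y qy)); rewrite (hpf (at_pt (inU y qy))) // (hpg (at_pt (inU y qy))) //=.
    rewrite !mulrA => /(mulIf (invr_neq0 qy)) ey.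
    by rewrite !expr1 evB !evM ey subrr.
  have [M [e1 e0]] := frame_regular2 K_fibers CB BC ij eP.
  have m0 : (0 < m)%N by lia.
  pose M' := pihomog [measure of mdeg] m.-1 M.
  have hM' : M' \is m.-1.-homog by exact: pihomogP.
  have eM a p' : p' \is m.-homog -> p' = l a ^+ 1 * M -> p' = l a * M'.
    move=> hp' ep'; rewrite -(pihomog_dE hp') ep' expr1.
    have em1 : m = (1 + m.-1)%N by lia.
    by rewrite {1}em1 (pihomogM _ _ (lf_homog B a)).
  have {}e1 := eM _ _ hm' e1; have {}e0 := eM _ _ hm e0.
  have xb : basic q x by split=> //; exists n.
  have rM : regular (k - 1) (fun y : dom (basic q) => ev M' (sval y) / ev q (sval y)).
    apply: (regularE hM' hq); [by lia| |by []].
    by move=> y; have [] := svalP y.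
  exists (basic q), qU, (toreg (k - 1) (fun y => ev M' (sval y) / ev q (sval y))).
  split=> // y; rewrite toregE //.
  have qy : ev q (sval y) != 0 by have [] := svalP y.
  by rewrite (hpf (dom_sub qU y)) // (hpg (dom_sub qU y)) //= e0 e1 !evM !mulrA.
- move=> V V' hV hV' s s' hs hs' X kX kX'; apply: reg_ext => x.
  apply/eqP; rewrite -subr_eq0; apply/eqP.
  have := regular_eq0 K_fibers (regP (reg_res kX s - reg_res kX' s')) (frame_neq0 K_fibers CB i).
  move=> /(_ _ x); apply => y ly; apply: (mulfI ly); rewrite mulr0 regDE regNE mulrBr.
  rewrite !reg_resE; have [<- _] := hs (dom_sub kX y); have [<- _] := hs' (dom_sub kX' y).
  by rewrite (dom_inj (x := dom_sub hV _) (y := dom_sub hV' (dom_sub kX' y))) ?subrr.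
exists h; first exact: regP.
move=> x; have [V [hV [Vx hP]]] := hh _ (svalP x).
have ex0 : dom_sub hV (at_pt Vx) = x by exact: dom_inj.
have <- : reg_res hV h (at_pt Vx) = h x by rewrite reg_resE ex0.
by have := hP (at_pt Vx); rewrite ex0.
Qed.

End Division.

Lemma untwist_clear (K : fieldType) (e : int) (x y a b : K) : x != 0 ->
  a = x ^ (e - 2) * y ^ (2 - e) * b -> a * x ^ (2 - e) = b * y ^ (2 - e).
Proof.
move=> x0 ->; have ex : x ^ (e - 2) * x ^ (2 - e) = 1.
  by rewrite -expfzDr // (_ : e - 2 + (2 - e) = 0) //; ring.
transitivity (x ^ (e - 2) * x ^ (2 - e) * (b * y ^ (2 - e))).
  by move: (x ^ (e - 2)) (x ^ (2 - e)) (y ^ (2 - e)) => X Y Z; ring.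
by rewrite ex mul1r.
Qed.

(** * The extension class *)

Section Syzygy.
Variables (K : closedFieldType) (L : set (pt K)) (d : nat).
Hypothesis K_fibers : has_infinite_fibers K.
Notation e := (2 - d%:Z).
Variables (F : omodule K) (i : omod_hom (twist 0) F)
  (p : omod_hom F (itwist (ideal_of L) e)).
Hypotheses (sF : is_sheaf F) (ex : short_exact i p).
Notation S := {mpoly K[4]}.
Implicit Types (U V W : open K).
Notation pv s := (proj_val p s).
Variables (x y : S) (sx sy : omod_hom (twist (e - 1)) F).
Hypotheses (x_homog : x \is 1.-homog) (y_homog : y \is 1.-homog).
Hypotheses (sxP : forall U (b : reg (e - 1) U) c, pv (sx U b) c = ev x (sval c) * b c)
  (syP : forall U (b : reg (e - 1) U) c, pv (sy U b) c = ev y (sval c) * b c).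

Definition mulsec (q : S) k U (g : dom U -> K) : reg k U :=
  toreg k (fun c => ev q (sval c) * g c).
Arguments mulsec q k U g : clear implicits.

(** The combination [x sy - y sx] on a section [g] of [O(-d)]; the two terms have the same
    projection, so it lies in the image of [i]. *)
Definition syz U (g : dom U -> K) : F U :=
  sy U (mulsec x (e - 1) U g) - sx U (mulsec y (e - 1) U g).

Lemma mulsecE m k k' (q : S) U (g : dom U -> K) c : q \is m.-homog -> k' = m%:Z + k ->
  regular k g -> mulsec q k' U g c = ev q (sval c) * g c.
Proof. by move=> hq ek hg; rewrite toregE //; exact: (regular_mulp hq ek hg). Qed.

Let mulE q U (g : dom U -> K) c : q \is 1.-homog -> regular (e - 2) g ->
  mulsec q (e - 1) U g c = ev q (sval c) * g c.
Proof. by move=> hq; apply: mulsecE hq _; lia. Qed.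

Lemma syz_res U V (h : V <<= U) (g : dom U -> K) : regular (e - 2) g ->
  res F h (syz g) = syz (g \o dom_sub h).
Proof.
move=> hg; rewrite /syz resB -!hom_res; congr (sy V _ - sx V _);
  by apply: reg_ext => c; rewrite reg_resE !mulE //; exact: regular_sub.
Qed.

Lemma syzZ U (a : OP3 U) (g : dom U -> K) : regular (e - 2) g ->
  syz (fun c => a c * g c) = a *: syz g.
Proof.
move=> hg; have hag : regular (e - 2) (fun c => a c * g c).
  by apply: (regular_cast (k := 0 + (e - 2))); [rewrite add0r|apply: regularM => //; exact: regP].
rewrite /syz scalerBr -!homZ; congr (sy U _ - sx U _);
  by apply: reg_ext => c; rewrite regZE !mulE // mulrCA.
Qed.

Lemma pv_syz U (g : dom U -> K) c : regular (e - 2) g -> pv (syz g) c = 0.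
Proof. by move=> hg; rewrite pvB sxP syP !mulE // mulrCA subrr. Qed.

(* The extension class, as a form of degree [d]. *)
Lemma syzygy : exists2 f : S, f \is d.-homog &
  forall U (g : dom U -> K), regular (e - 2) g -> syz g = i U (mulsec f 0 U g).
Proof.
pose co (j : 'I_4) U (c : dom U) : K := val (sval c) 0 j.
pose g j U (c : dom U) := co j U c ^ (e - 2).
have gR j U : U <<= basic 'X_j -> regular (e - 2) (g j U).
  exact: regular_pow.
have ker j : exists a : OP3 (basic 'X_j), i _ a = syz (g j (basic 'X_j)).
  by apply: (pv_ker sF ex) => c; rewrite pv_syz //; exact: gR.
pose a j := projT1 (cid (ker j)).
have aP j : i _ (a j) = syz (g j (basic 'X_j)) := projT2 (cid (ker j)).
(* Here [2 - e] is [d]: on the chart [j] the class is the value of [syz] on ['X_j ^ (- d)],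
   multiplied back by ['X_j ^ d]. *)
pose fl j (c : dom (basic 'X_j)) := a j c * co j _ c ^ (2 - e).
have flR j : regular d%:Z (fl j).
  apply: (regular_cast (k := 0 + (2 - e))); first by lia.
  by apply: regularM; [exact: regP|exact: regular_pow].
have frac j := @regular_basic K K_fibers d%:Z (basic 'X_j) (fl j) 1 'X_j 0
  (flR j) isT (X_homog K j) (@sub_open_refl _ _).
pose N0 j := projT1 (cid (frac j)).
pose N := (\sum_j N0 j)%N.
have N0N j : (N0 j <= N)%N by rewrite /N (bigD1 j) //= leq_addr.
have XN k j : 'X_j ^+ k \is [in K[4], k.-homog].
  by have := dhomogMn k (X_homog K j); rewrite mul1n.
have co0 j (c : dom (basic 'X_j)) : co j _ c != 0.
  exact: (basicXE (@sub_open_refl _ (basic 'X_j))).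
have AE j : exists A : S, A \is (N + d)%N.-homog /\
    forall c, fl j c = ev A (sval c) / co j _ c ^+ N.
  have [A [m [_ hA em AP]]] := projT2 (cid (frac j)).
  rewrite -/(N0 j) in em AP.
  exists (A * 'X_j ^+ (N - N0 j)); split.
    have -> : (N + d)%N = (m + (N - N0 j))%N by have := N0N j; lia.
    by apply: dhomogM.
  move=> c; rewrite AP ?evXU ?co0 // evM evX !evXU -/(co j _ c).
  rewrite -[X in _ = _ / _ ^+ X](subnK (N0N j)) exprD.
  by rewrite [X in _ = _ / X]mulrC -mulf_div divff ?mulr1 // expf_neq0 ?co0.
pose A j := projT1 (cid (AE j)).
have A_homog j : A j \is (N + d)%N.-homog by have [] := projT2 (cid (AE j)).
have AP j c : fl j c = ev (A j) (sval c) / co j _ c ^+ N.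
  by have [_] := projT2 (cid (AE j)); apply.
have fl_eq j k (z : pt K) (zj : basic 'X_j z) (zk : basic 'X_k z) :
    fl j (at_pt zj) = fl k (at_pt zk).
  pose V := openI (basic ('X_j : S)) (basic ('X_k : S)); have Vz : V z by [].
  have hj : V <<= basic 'X_j by exact: sub_openIl.
  have hk : V <<= basic 'X_k by exact: sub_openIr.
  pose u : OP3 V := toreg 0 (fun c : dom V => co j V c ^ (e - 2) * co k V c ^ (2 - e)).
  have uE c : u c = co j V c ^ (e - 2) * co k V c ^ (2 - e).
    rewrite toregE //; apply: (regular_cast (k := (e - 2) + (2 - e))); first by ring.
    by apply: regularM; apply: regular_pow.
  have eu : reg_res hj (a j) = u *: (reg_res hk (a k) : twist 0 V).
    apply: (i_inj ex); rewrite homZ.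
    rewrite !(hom_res i) !aP !syz_res; [|exact: gR|exact: gR].
    rewrite -syzZ; last exact/regular_sub/gR.
    congr syz; apply/funext => c; rewrite uE /= /g.
    have ck : co k V c != 0 by exact: (basicXE hk).
    have -> : co k (basic 'X_k) (dom_sub hk c) = co k V c by [].
    rewrite -mulrA -expfzDr //.
    by rewrite (_ : 2 - e + (e - 2) = 0) ?mulr1 //; ring.
  have := congr1 (fun r : reg 0 V => r (at_pt Vz)) eu; rewrite regZE uE !reg_resE => e1.
  have -> : fl j (at_pt zj) = a j (dom_sub hj (at_pt Vz)) * val z 0 j ^ (2 - e).
    by congr (regfun (a j) _ * _); exact: dom_inj.
  have -> : fl k (at_pt zk) = a k (dom_sub hk (at_pt Vz)) * val z 0 k ^ (2 - e).
    by congr (regfun (a k) _ * _); exact: dom_inj.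
  have zj0 : val z 0 j != 0 by exact: (basicXE hj (at_pt Vz)).
  exact: untwist_clear zj0 e1.
have clear j k : A j * 'X_k ^+ N = A k * 'X_j ^+ N.
  apply/eqP; rewrite -subr_eq0; apply/eqP.
  apply: (@ev_ext0_on K K_fibers _ ('X_j * 'X_k)).
    by rewrite mulf_neq0 ?X_neq0.
  move=> z; rewrite evM mulf_eq0 negb_or !evXU => /andP[zj zk].
  have := fl_eq j k z (basicX zj) (basicX zk); rewrite !AP => e1.
  rewrite evB !evM !evX !evXU; apply/eqP; rewrite subr_eq0; apply/eqP.
  have := expf_neq0 N zj; have := expf_neq0 N zk.
  move: e1; rewrite /co /=; move: (val z 0 j ^+ N) (val z 0 k ^+ N) => X Y e1 Y0 X0.
  by apply: (mulIf (mulf_neq0 (invr_neq0 X0) (invr_neq0 Y0))); rewrite mulrACA divff // mulr1 e1 [X^-1 * _]mulrC mulrACA divff // mulr1.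
(* A section of [O(d)] over the whole space is a form: its fractions agree on two charts, so the
   power of ['X_o0] divides its numerator. *)
have [f0 f0P] : exists f0, A o0 = 'X_o0 ^+ N * f0.
  have [|r [-> _]] := @regular_seq2 4 K o1 o0 N (A o0) (A o1) isT; last by exists r.
  by rewrite mulrC clear mulrC.
pose f := pihomog [measure of mdeg] d f0.
have f_homog : f \is d.-homog by exact: pihomogP.
have A0f : A o0 = 'X_o0 ^+ N * f.
  by rewrite -(pihomog_dE (A_homog o0)) f0P pihomogM.
have Af j : A j = 'X_j ^+ N * f.
  apply: (mulIf (expf_neq0 N (X_neq0 K o0))); rewrite -clear A0f.
  by rewrite mulrAC [in RHS]mulrAC [X in X * _ = _]mulrC.
exists f => // U h hh; apply: sheaf_ext => // z Uz; have [j zj] := pt_basicX z.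
pose V := openI U (basic ('X_j : S)); have hj : V <<= basic 'X_j by exact: sub_openIr.
pose hU : V <<= U := @sub_openIl _ _ _.
exists V, hU; split=> //.
pose c0 : OP3 V := toreg 0 (fun c : dom V => h (dom_sub hU c) * co j V c ^ (2 - e)).
have c0E c : c0 c = h (dom_sub hU c) * co j V c ^ (2 - e).
  rewrite toregE //; apply: (regular_cast (k := (e - 2) + (2 - e))); first by ring.
  by apply: regularM; [exact: regular_sub|exact: regular_pow].
rewrite syz_res //.
have -> : h \o dom_sub hU = (fun c => c0 c * (g j _ \o dom_sub hj) c).
  apply/funext => c; rewrite c0E /= /g -[LHS]mulr1 -[RHS]mulrA; congr (_ * _).
  have -> : co j (basic 'X_j) (dom_sub hj c) = co j V c by [].
  rewrite -expfzDr ?(basicXE hj) //.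
  by rewrite (_ : 2 - e + (e - 2) = 0) //; ring.
rewrite syzZ; last exact/regular_sub/gR.
rewrite -syz_res -?aP -?(hom_res i) -?homZ; last exact: gR.
congr (i V _); apply: reg_ext => c; rewrite regZE !reg_resE c0E.
rewrite (mulsecE _ f_homog _ hh) //; last by lia.
have := AP j (dom_sub hj c); rewrite Af evM evX evXU -/(co j _ (dom_sub hj c)).
rewrite mulrAC divff ?expf_neq0 ?co0 // mul1r /fl => <-.
by rewrite -mulrA mulrC; congr (_ * _); rewrite mulrC.
Qed.

End Syzygy.

(** * Reflexivity and the extension class *)

Lemma regular_lpow (K : closedFieldType) (l : {mpoly K[4]}) z (U : open K) :
  l \is 1.-homog -> U <<= basic l -> regular z (fun x : dom U => ev l (sval x) ^ z).
Proof.
move=> hl h; have hX n : l ^+ n \is n.-homog by have := dhomogMn n hl; rewrite mul1n.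
case: z => n.
  apply: (regularE (hX n) (dhomog1 _ _)); rewrite ?add0r // => y.
    by rewrite ev1 oner_neq0.
  by rewrite ev1 divr1 evX.
apply: (regularE (dhomog1 _ _) (hX n.+1)); rewrite ?NegzE ?subrr // => y.
  by rewrite evX expf_neq0 //; have [] := h _ (svalP y).
by rewrite ev1 evX mul1r exprnN.
Qed.

Lemma itwist_vanish (K : closedFieldType) (L : set (pt K)) k (U : open K)
  (s : itwist_sec (ideal_of L) k U) (c : dom U) : L (sval c) -> s c = 0.
Proof.
move=> Lc; have /asboolP/(_ _ (svalP c)) [V [h [Vc [n [a [t [Ia es]]]]]]] := itwist_secP s.
have := congr1 (fun r : reg k V => r (at_pt Vc)) es; rewrite reg_resE.
have -> : dom_sub h (at_pt Vc) = c by exact: dom_inj.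
move=> ->; elim: n a t Ia {es} => [|n IH] a t Ia; first by rewrite big_ord0.
by rewrite big_ord_recl regDE regZE Ia // mul0r add0r IH.
Qed.

Lemma frame_pt (K : closedFieldType) (B C : 'M[K]_4) (v : 'rV[K]_4) :
  C *m B = 1%:M -> v != 0 -> exists c : pt K, forall j, ev (lf B j) c = v 0 j.
Proof.
move=> CB v0; have [|c ec] := @exists_pt K (v *m C).
  by apply: contraNneq v0 => e; rewrite -[v]mulmx1 -CB mulmxA e mul0mx.
by exists c => j; rewrite ev_lf ec -mulmxA CB mulmx1.
Qed.

Section Reflexive.
Variables (K : closedFieldType) (L : set (pt K)) (d : nat).
Hypothesis K_fibers : has_infinite_fibers K.
Notation e := (2 - d%:Z).
Variables (F : omodule K) (i : omod_hom (twist 0) F)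
  (p : omod_hom F (itwist (ideal_of L) e)).
Hypotheses (rF : reflexive_sheaf F) (ex : short_exact i p).
Notation S := {mpoly K[4]}.
Implicit Types (U V W : open K).
Notation pv s := (proj_val p s).
Variables (B C : 'M[K]_4).
Hypotheses (CB : C *m B = 1%:M) (BC : B *m C = 1%:M).
Notation l := (lf B).
Hypothesis (LB : forall c, L c <-> ev (l o0) c = 0 /\ ev (l o1) c = 0).
Variables (sx sy : omod_hom (twist (e - 1)) F).
Hypotheses (sxP : forall U (b : reg (e - 1) U) c, pv (sx U b) c = ev (l o0) (sval c) * b c)
  (syP : forall U (b : reg (e - 1) U) c, pv (sy U b) c = ev (l o1) (sval c) * b c).

Definition lochom_eval V (phi : lochom F (twist 0) V) (s : F V) : reg 0 V :=
  lochom_fam phi V (fun _ Vx => Vx) s.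

Lemma lochom_eval_linear V (phi : lochom F (twist 0) V) a s t :
  lochom_eval phi (a *: s + t) = (a *: (lochom_eval phi s : twist 0 V) + lochom_eval phi t : twist 0 V).
Proof. by have /asboolP[_ h] := lochomP phi; exact: h. Qed.

Lemma lochom_eval0 V (phi : lochom F (twist 0) V) : lochom_eval phi 0 = 0.
Proof.
have := lochom_eval_linear phi (-1) 0 0; rewrite scaler0 addr0 => ->.
by rewrite scaleN1r addNr.
Qed.

Lemma lochom_evalZ V (phi : lochom F (twist 0) V) a s :
  lochom_eval phi (a *: s) = (a *: (lochom_eval phi s : twist 0 V) : twist 0 V).
Proof. by rewrite -[a *: s]addr0 lochom_eval_linear lochom_eval0 addr0. Qed.

Lemma lochom_eval_res V W (h : W <<= V) (phi : lochom F (twist 0) V) s :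
  lochom_eval (lochom_res h phi) (res F h s) = reg_res h (lochom_eval phi s).
Proof.
have /asboolP[cphi _] := lochomP phi; rewrite /lochom_eval /= /fam_res.
exact: cphi.
Qed.

(* If the extension class vanishes, then [sx] and [sy] agree on the sections of
   [I_L(1 - d)] and extend to a section of [F] lifting a nonvanishing section of
   [O(2 - d)] across [L]. *)
Lemma syzygy_nonzero :
  ~ (forall U (g : dom U -> K), regular (e - 2) g -> syz (l o0) (l o1) sx sy g = 0).
Proof.
move=> syz0; have [[sF _] bij] := rF.
(* [Z] is nonzero at some point of [L], and its powers trivialise the twisting sheaves over [U]. *)
pose Z := l o2; have hZ : Z \is 1.-homog by exact: lf_homog.
pose U := basic Z.
have Z0 V (h : V <<= U) (c : dom V) : ev Z (sval c) != 0 by have [] := h _ (svalP c).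
pose zp k V : reg k V := toreg k (fun c : dom V => ev Z (sval c) ^ k).
have zpE k V (h : V <<= U) c : zp k V c = ev Z (sval c) ^ k.
  by rewrite toregE //; exact: regular_lpow.
have zp_res k V W (hV : V <<= U) (h : W <<= V) : reg_res h (zp k V) = zp k W.
  by apply: reg_ext => c; rewrite reg_resE !zpE //; exact: sub_open_trans hV h.
(* [g] is the value of [phi] on the section still to be found, which becomes [sx (Z ^ (e - 1))] and
   [sy (Z ^ (e - 1))] after multiplication by [x / Z] and [y / Z]. Such a [g] exists by division,
   because the vanishing syzygy makes the two values of [phi] proportional to [x] and [y]. *)
pose G V (phi : lochom F (twist 0) V) (g : reg 0 V) := forall c,
  lochom_eval phi (sx V (zp (e - 1) V)) c = ev (l o0) (sval c) * (g c / ev Z (sval c)) /\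
  lochom_eval phi (sy V (zp (e - 1) V)) c = ev (l o1) (sval c) * (g c / ev Z (sval c)).
have ratio V (h : V <<= U) (q : S) : q \is 1.-homog ->
    exists a : OP3 V, forall c, a c = ev q (sval c) / ev Z (sval c).
  move=> hq; exists (toreg 0 (fun c : dom V => ev q (sval c) / ev Z (sval c))) => c.
  have /= := regular_ratio hZ hq h; under [X in regular _ X]funext do rewrite expr1.
  by move=> hr; rewrite toregE.
have Gex V (h : V <<= U) phi : exists g, @G V phi g.
  have zpR : regular (e - 2) (fun c : dom V => ev Z (sval c) ^ (e - 2)) by exact: regular_lpow.
  have [ax axE] := ratio V h (l o0) (lf_homog B o0).
  have [ay ayE] := ratio V h (l o1) (lf_homog B o1).
  have ms j (a : OP3 V) : (forall c, a c = ev (l j) (sval c) / ev Z (sval c)) ->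
      mulsec (l j) (e - 1) (fun c : dom V => ev Z (sval c) ^ (e - 2)) = (a *: (zp (e - 1) V) : reg _ _).
    move=> aE; apply: reg_ext => c; rewrite regZE aE zpE // (mulsecE _ (lf_homog B j) _ zpR); last by lia.
    rewrite -mulrA; congr (_ * _); rewrite -exprN1 -expfzDr ?(Z0 V h) //; congr (_ ^ _); ring.
  have [||||h' hh' eh] := @regular_divide K B C K_fibers CB BC o0 o1 0 V
     (lochom_eval phi (sx V (zp (e - 1) V))) (lochom_eval phi (sy V (zp (e - 1) V))).
  - by [].
  - exact: regP.
  - exact: regP.
  - move=> c; have /eqP := syz0 V _ zpR; rewrite /syz (ms _ _ axE) (ms _ _ ayE) subr_eq0.
    rewrite !homZ => /eqP /(congr1 (lochom_eval phi)); rewrite !lochom_evalZ.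
    move=> /(congr1 (fun r : reg 0 V => r c)); rewrite !regZE axE ayE.
    by rewrite ![_ / _ * _]mulrAC => /(mulIf (invr_neq0 (Z0 V h c))).
  exists (toreg 0 (fun c => ev Z (sval c) * h' c)) => c.
  rewrite toregE; first by have [-> ->] := eh c; rewrite mulrAC divff ?mul1r ?(Z0 V h).
  by apply: (regular_mulp hZ _ hh'); lia.
have Guniq V (h : V <<= U) phi g g' : @G V phi g -> @G V phi g' -> g = g'.
  move=> hg hg'; apply: reg_ext => c; apply/eqP; rewrite -subr_eq0; apply/eqP.
  apply: (regular_eq0 K_fibers (regP (g - g')) (frame_neq0 K_fibers CB o0)) => c' lc'.
  have [e1 _] := hg c'; have [e2 _] := hg' c'; rewrite e1 in e2.
  move/(mulfI lc')/(mulIf (invr_neq0 (Z0 V h c'))): e2 => e2.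
  by rewrite regDE regNE e2 subrr.
(* [Phi] is an element of the double dual; reflexivity turns it into the section [t]. *)
pose Phi : fam (odual F) (twist 0) U := fun V h phi => projT1 (cid (Gex V h phi)).
have PhiP V h phi : G V phi (Phi V h phi) := projT2 (cid (Gex V h phi)).
have Phi_lochom : is_lochom (odual F) (twist 0) U Phi.
  apply/asboolP; split.
    move=> V W h h' h'' phi; apply: (Guniq W h'' (lochom_res h' phi)); first exact: PhiP.
    move=> c; have := PhiP V h phi (dom_sub h' c).
    rewrite -!(reg_resE h') -!lochom_eval_res -!hom_res.
    by rewrite -[res (twist _) h' _]/(reg_res h' (zp (e - 1) V)) (zp_res _ _ _ h).
  move=> V h a phi psi; apply: (Guniq V h (a *: (phi : odual F V) + psi)).
    exact: PhiP.
  move=> c; have [e1 e2] := PhiP V h phi c; have [e3 e4] := PhiP V h psi c.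
  have E s : lochom_eval (a *: (phi : odual F V) + psi) s c =
      a c * lochom_eval phi s c + lochom_eval psi s c.
    congr (_ * _ + _); congr (regfun a _); exact: dom_inj.
  by rewrite !E e1 e2 e3 e4 regDE regZE; split; ring.
have [inv bmK invK] := bij U.
pose t : F U := inv (Lochom Phi_lochom).
have tP V (h : V <<= U) phi : lochom_eval phi (res F h t) = Phi V h phi.
  have := congr1 (fun f : lochom (odual F) (twist 0) U => lochom_fam f V h phi) (invK (Lochom Phi_lochom)).
  by [].
have [ax axE] := ratio U (@sub_open_refl _ _) (l o0) (lf_homog B o0).
(* Both sides have the same image in the double dual. Dividing their projections by [x / Z] on a
   dense set shows that [t] projects to [Z ^ e]. *)
have et : ax *: t = sx U (zp (e - 1) U).
  apply: (can_inj bmK); apply: val_inj; apply: fam_ext => V h phi.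
  rewrite /bidual_map /= /bidual_fam -!/(lochom_eval _ _).
  apply: reg_ext => c; rewrite resZ lochom_evalZ tP regZE -hom_res.
  rewrite -[res (twist _) h _]/(reg_res h (zp (e - 1) U)) (zp_res _ _ _ (@sub_open_refl _ _)).
  by have [-> _] := PhiP V h phi c; rewrite reg_resE axE mulrAC mulrA.
have pt c : pv t c = ev Z (sval c) ^ e.
  apply/eqP; rewrite -subr_eq0; apply/eqP.
  have hr : regular e (pv t - zp e U : reg e U) by exact: regP.
  have := regular_eq0 K_fibers hr (frame_neq0 K_fibers CB o0).
  rewrite -(zpE e U (@sub_open_refl _ _)); move=> /(_ _ c); apply => c' lc'.
  have := congr1 (fun s => pv s c') et; rewrite pvZ sxP axE zpE // => e1.
  rewrite regDE regNE zpE //; apply/eqP; rewrite subr_eq0; apply/eqP.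
  apply: (mulfI (mulf_neq0 lc' (invr_neq0 (Z0 U (@sub_open_refl _ _) c')))).
  rewrite e1 -mulrA; congr (_ * _); rewrite -exprN1 -expfzDr ?(Z0 U) //; congr (_ ^ _); ring.
(* At this point of [L] a section of the twisted ideal vanishes, while [Z ^ e] does not. *)
have [|c hc] := @frame_pt K B C (delta_mx 0 o2) CB.
  by apply/eqP => /(congr1 (fun v : 'rV[K]_4 => v 0 o2)); rewrite !mxE !eqxx => /eqP; rewrite oner_eq0.
have Uc : U c by split; [exists 1%N|rewrite hc mxE !eqxx oner_neq0].
have Lc : L c by apply/LB; rewrite !hc !mxE.
have := pt (at_pt Uc); rewrite /proj_val itwist_vanish // => /esym/eqP.
by apply/negP; rewrite expfz_neq0 //; have [] := Uc.
Qed.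

End Reflexive.

(** * Frames adapted to the line and the extension class *)

Section Frames.
Variable K : closedFieldType.
Notation S := {mpoly K[4]}.

Lemma mev_scale m (p : S) s (c : 'rV[K]_4) : p \is m.-homog ->
  mev p (s *: c) = s ^+ m * mev p c.
Proof.
move=> hp; rewrite /mev !mevalE mulr_sumr big_seq [RHS]big_seq.
apply: eq_bigr => a ap; rewrite mulrCA; congr (_ * _).
have -> : m = (\sum_i a i)%N by rewrite -mdegE; exact/esym/(dhomog_mf hp ap).
rewrite -prodrXr -big_split /=; apply: eq_bigr => j _.
by rewrite mxE exprMn.
Qed.

(** [row_ebase] completes a basis of the row space of [A], on which the last two coordinates vanish;
    a permutation moves these two to the front. *)
Lemma line_frame (L : set (pt K)) : is_line L -> exists B C : 'M[K]_4,
  [/\ C *m B = 1%:M, B *m C = 1%:M &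
    forall c, L c <-> ev (lf B o0) c = 0 /\ ev (lf B o1) c = 0].
Proof.
move=> [A rA ->].
pose E := row_ebase A; have uE : E \in unitmx by exact: row_ebase_unit.
pose s : {perm 'I_4} := (tperm o0 o2 * tperm o1 o3)%g.
have s0 : s o0 = o2 by rewrite permM (tpermL o0 o2) tpermD.
have s1 : s o1 = o3 by rewrite permM (_ : tperm o0 o2 o1 = o1) ?tpermL // tpermD.
pose P : 'M[K]_4 := perm_mx s; pose P' : 'M[K]_4 := perm_mx s^-1%g.
have PP' : P *m P' = 1%:M by rewrite -perm_mxM mulgV perm_mx1.
have P'P : P' *m P = 1%:M by rewrite -perm_mxM mulVg perm_mx1.
exists (invmx E *m P'), (P *m E); split.
- by rewrite mulmxA mulmxK.
- by rewrite mulmxA -[_ *m P' *m P]mulmxA P'P mulmx1 mulVmx.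
move=> c; rewrite !ev_lf !mulmxA.
have cE (v : 'rV[K]_4) j : (v *m P') 0 j = v 0 (s j).
  by rewrite /P' -col_permE mxE.
rewrite !cE s0 s1 /=.
rewrite submxE /cokermx rA /copid_mx mulmxA -/E.
move: (val c *m invmx E) => v.
have rVB (u w : 'rV[K]_4) j : (u - w) 0 j = u 0 j - w 0 j by rewrite !mxE.
split=> [/eqP h|[h2 h3]].
  have h' (j : 'I_4) : (v *m (1%:M - pid_mx 2)) 0 j = 0 by rewrite h mxE.
  have vE (j : 'I_4) : (1 < j)%N -> v 0 j = 0.
    move=> j1; rewrite -[RHS](h' j) mulmxBr mulmx1 rVB.
    rewrite [X in _ - X](_ : _ = 0) ?subr0 // mxE big1 // => k _.
    rewrite mxE; set t := (_ && _); have -> : t = false by apply/negbTE/negP => /andP[/eqP ek]; rewrite ek ltnNge j1.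
    by rewrite mulr0.
  by split; apply: vE.
apply/eqP/rowP => j; rewrite mulmxBr mulmx1 rVB [RHS]mxE.
rewrite [X in _ - X](_ : _ = if (j < 2)%N then v 0 j else 0); last first.
  rewrite mxE (bigD1 j) //= big1 ?addr0 => [|k kj].
    by rewrite mxE eqxx /=; case: ifP => _; rewrite ?mulr1 ?mulr0.
  have kj' : (k == j :> nat) = false by exact: negPf kj.
  by rewrite mxE kj' mulr0.
case: ltnP => [_|j2]; first by rewrite subrr.
rewrite subr0; case: j j2 => [[|[|[|[|//]]]] hj] // _.
  by rewrite -[RHS]h2; congr (v 0 _); exact: val_inj.
by rewrite -[RHS]h3; congr (v 0 _); exact: val_inj.
Qed.

Section Reduce.
Hypothesis K_fibers : has_infinite_fibers K.
Variables (B C : 'M[K]_4) (d : nat) (f : S).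
Hypotheses (CB : C *m B = 1%:M) (BC : B *m C = 1%:M) (d_gt0 : (0 < d)%N).
Hypotheses (f_homog : f \is d.-homog)
  (fL : forall a b, f <> lf B o0 * a + lf B o1 * b).

(* A frame in which the third coordinate vanishes at a point of the line where
   [f] does not; then [f] is replaced by its restriction to the line, a form in
   the last two coordinates. *)
Lemma reduce_frame : exists B' C' : 'M[K]_4, exists g a b : S,
  [/\ C' *m B' = 1%:M /\ B' *m C' = 1%:M,
    lf B' o0 = lf B o0 /\ lf B' o1 = lf B o1,
    [/\ g \is d.-homog, a \is d.-1.-homog, b \is d.-1.-homog &
      f = g + lf B' o0 * a + lf B' o1 * b],
    (forall q, g <> lf B' o2 * q) /\ (forall q r, g <> lf B' o0 * q + lf B' o1 * r) &
    forall c, ev g c = 0 -> ev (lf B' o2) c = 0 -> ev (lf B' o3) c = 0].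
Proof.
(* Otherwise [f * lf B o3] vanishes on the line, whose ideal is prime and contains neither
   factor. *)
have [c0 [c00 c01 fc0 c03]] : exists c0 : 'rV[K]_4, [/\ (c0 *m B) 0 o0 = 0,
    (c0 *m B) 0 o1 = 0, mev f c0 != 0 & (c0 *m B) 0 o3 != 0].
  apply: contrapT => nc.
  have [|q [r e]] := @frame_vanish2 K K_fibers B C CB BC o0 o1 (f * lf B o3).
    move=> c e0 e1; apply: contrapT => /eqP.
    rewrite /mev mevalM mulf_eq0 negb_or -!/(mev _ c) mev_lf => /andP[h1 h2].
    by apply: nc; exists c.
  case: (frame_vanish2_prime K_fibers CB BC e) => [[a [b /fL //]]|[a [b e3]]].
  have : mev (lf B o3) (delta_mx 0 o3 *m C) = 0.
    rewrite e3 /mev mevalD !mevalM -!/(mev _ _) !mev_lf -mulmxA CB mulmx1 !mxE /=.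
    by rewrite !mul0r addr0.
  by rewrite mev_lf -mulmxA CB mulmx1 mxE !eqxx => /eqP; rewrite oner_eq0.
(* Adding [s] times the fourth coordinate to the third makes the third vanish at [c0]. *)
pose s := - ((c0 *m B) 0 o2 / (c0 *m B) 0 o3).
pose D : 'M[K]_4 := delta_mx o3 o2.
have DD : D *m D = 0 by rewrite /D mul_delta_mx_0.
pose M t : 'M[K]_4 := 1%:M + t *: D.
have MM t : M t *m M (- t) = 1%:M.
  rewrite /M mulmxDl mul1mx mulmxDr mulmx1 -scalemxAl -scalemxAr DD !scaler0 addr0.
  by rewrite -addrA -scalerDl addNr scale0r addr0.
have cM (v : 'rV[K]_4) t j : (v *m M t) 0 j = v 0 j + (if j == o2 then t * v 0 o3 else 0).
  rewrite /M mulmxDr mulmx1 mxE; congr (_ + _); rewrite -scalemxAr mxE.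
  have -> : (v *m D) 0 j = if j == o2 then v 0 o3 else 0.
    rewrite mxE (bigD1 o3) //= big1 ?addr0 => [|k k3].
      by rewrite mxE eqxx /=; case: eqP => _; rewrite ?mulr1 ?mulr0.
    by rewrite mxE (negPf k3) mulr0.
  by case: eqP => _; rewrite ?mulr0.
pose B' := B *m M s; pose C' := M (- s) *m C.
have C'B' : C' *m B' = 1%:M.
  rewrite /C' /B' mulmxA -(mulmxA (M (- s))) CB mulmx1.
  by have := MM (- s); rewrite opprK.
have B'C' : B' *m C' = 1%:M by rewrite /C' /B' mulmxA -(mulmxA B) MM mulmx1.
have lB' j : j != o2 -> lf B' j = lf B j.
  move=> j2; apply: (mev_ext K_fibers) => c.
  by rewrite !mev_lf mulmxA cM (negPf j2) addr0.
have c02' : (c0 *m B') 0 o2 = 0.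
  by rewrite mulmxA cM eqxx /s mulNr divfK // subrr.
have c0j j : j != o2 -> (c0 *m B') 0 j = (c0 *m B) 0 j.
  by move=> j2; rewrite mulmxA cM (negPf j2) addr0.
pose T : 'M[K]_4 := \matrix_(a, b) if (a == b) && (1 < a)%N then 1 else 0.
have cT (v : 'rV[K]_4) (j : 'I_4) : (v *m T) 0 j = if (1 < j)%N then v 0 j else 0.
  rewrite mxE (bigD1 j) //= big1 ?addr0 => [|k kj].
    by rewrite mxE eqxx /=; case: ifP => _; rewrite ?mulr1 ?mulr0.
  by rewrite mxE (negPf kj) mulr0.
(* The projection onto the line in the new frame; the pullback of [f] along it involves only the
   last two coordinates. *)
pose E := B' *m T *m C'.
have cE (v : 'rV[K]_4) j : (v *m E *m B') 0 j = if (1 < j)%N then (v *m B') 0 j else 0.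
  rewrite /E (mulmxA v (B' *m T) C') -(mulmxA _ C' B') C'B' mulmx1.
  by rewrite (mulmxA v B' T) cT.
have B'inj (u v : 'rV[K]_4) : (forall j, (u *m B') 0 j = (v *m B') 0 j) -> u = v.
  move=> h; have e : u *m B' = v *m B' by apply/rowP.
  by rewrite -[u]mulmx1 -[v]mulmx1 -B'C' (mulmxA u) (mulmxA v) e.
pose g := subst E f.
have gE c : mev g c = mev f (c *m E) by exact: mev_subst.
have g_homog : g \is d.-homog by exact: subst_homog.
have c0E : c0 *m E = c0.
  apply: B'inj => j; rewrite cE; case: ifP => // j1.
  by case: j j1 => [[|[|//]] hj] // _; rewrite c0j //; [rewrite -[LHS]c00|rewrite -[LHS]c01];
    congr ((c0 *m B) 0 _); exact: val_inj.
have gc0 : mev g c0 != 0 by rewrite gE c0E.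
have [q [r e]] : exists q r, f - g = lf B' o0 * q + lf B' o1 * r.
  apply: (frame_vanish2 K_fibers C'B' B'C') => c e0 e1.
  rewrite /mev mevalB -!/(mev _ c) gE.
  suff -> : c *m E = c by rewrite subrr.
  apply: B'inj => j; rewrite cE; case: ifP => // j1.
  by case: j j1 => [[|[|//]] hj] // _; [rewrite -[LHS]e0|rewrite -[LHS]e1];
    congr ((c *m B') 0 _); exact: val_inj.
exists B', C', g, (pihomog [measure of mdeg] d.-1 q), (pihomog [measure of mdeg] d.-1 r).
split.
- by [].
- by split; apply: lB'.
- split=> //; try exact: pihomogP.
  rewrite -addrA -[LHS](subrKC g); congr (_ + _).
  have hfg : f - g \is d.-homog by apply: rpredB.
  have ed : d = (1 + d.-1)%N by lia.
  rewrite -(pihomog_dE hfg) e raddfD /= {1 2}ed.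
  by rewrite !(pihomogM _ _ (lf_homog B' _)).
- split=> [q' eg|q' r' eg].
    by move: gc0; rewrite eg /mev mevalM -!/(mev _ _) mev_lf c02' mul0r eqxx.
  move: gc0; rewrite eg /mev mevalD !mevalM -!/(mev _ _) !mev_lf !c0j //.
  by rewrite c00 c01 !mul0r addr0 eqxx.
move=> c; rewrite -[ev g c]/(mev g (val c)) gE !ev_lf => gc c2.
have c03' : (c0 *m B') 0 o3 != 0 by rewrite c0j.
(* With its third coordinate zero, [c] projects to a multiple of [c0], where [f] does not vanish; so
   [g] vanishes at [c] only if the multiple is zero. *)
have ec : val c *m E = ((val c *m B') 0 o3 / (c0 *m B') 0 o3) *: c0.
  have sc t (u : 'rV[K]_4) j : (t *: u) 0 j = t * u 0 j by rewrite mxE.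
  apply: B'inj => j; rewrite cE -scalemxAl sc.
  case: j => [[|[|[|[|//]]]] hj] /=.
  - have -> : Ordinal hj = o0 by exact: val_inj.
    by rewrite (c0j o0) // c00 mulr0.
  - have -> : Ordinal hj = o1 by exact: val_inj.
    by rewrite (c0j o1) // c01 mulr0.
  - have -> : Ordinal hj = o2 by exact: val_inj.
    by rewrite c02' mulr0.
  - have -> : Ordinal hj = o3 by exact: val_inj.
    by rewrite divfK.
move: gc; rewrite ec (mev_scale _ _ f_homog) => /eqP.
rewrite mulf_eq0 (negPf fc0) orbF expf_eq0 d_gt0 /= mulf_eq0 invr_eq0 (negPf c03') orbF.
by move/eqP.
Qed.

End Reduce.
End Frames.

(** * Normalised lifts and local generators *)

Section Presentation.
Variables (K : closedFieldType) (L : set (pt K)) (d : nat).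
Hypotheses (K_fibers : has_infinite_fibers K) (d_gt0 : (0 < d)%N).
Notation e := (2 - d%:Z).
Variables (F : omodule K) (i : omod_hom (twist 0) F)
  (p : omod_hom F (itwist (ideal_of L) e)).
Hypothesis (ex : short_exact i p).
Notation S := {mpoly K[4]}.
Implicit Types (U V W : open K).
Notation pv s := (proj_val p s).

(** A lift may be changed by any homomorphism from [O(1 - d)] to the structure sheaf, for instance
    by a form of degree [d - 1]. *)
Lemma perturb (s : omod_hom (twist (e - 1)) F) (q : S) : q \is d.-1.-homog ->
  exists s' : omod_hom (twist (e - 1)) F,
    forall U (b : reg (e - 1) U), s' U b = s U b + i U (mulsec q 0 b).
Proof.
move=> hq; have mE U (b : reg (e - 1) U) c : mulsec q 0 b c = ev q (sval c) * b c.
  by rewrite (mulsecE _ hq _ (regP b)) //; lia.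
pose f U (b : twist (e - 1) U) : F U := s U b + i U (mulsec q 0 (b : reg (e - 1) U)).
have f_lin U : linear (@f U).
  move=> a b b'; rewrite /f hom_linear.
  have -> : mulsec q 0 (a *: b + b') = (a *: (mulsec q 0 b : twist 0 U) + mulsec q 0 b' : twist 0 U).
    by apply: reg_ext => c; rewrite regDE regZE !mE regDE regZE mulrDr mulrCA.
  by rewrite hom_linear scalerDr addrACA.
have f_res U V (h : V <<= U) (b : twist (e - 1) U) : f V (res (twist (e - 1)) h b) = res F h (f U b).
  rewrite /f resD -!hom_res; congr (_ + i V _); apply: reg_ext => c.
  by rewrite reg_resE !mE.
by exists (Defs.Hom f_lin f_res).
Qed.

(** Adding [b] to [sx] and subtracting [a] from [sy] subtracts [x * a + y * b] from the syzygy;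
    hence [f] matters only modulo [(x, y)]. *)
Lemma modify (x y a b f g : S) (sx sy : omod_hom (twist (e - 1)) F) :
  x \is 1.-homog -> y \is 1.-homog -> f \is d.-homog -> g \is d.-homog ->
  a \is d.-1.-homog -> b \is d.-1.-homog -> f = g + x * a + y * b ->
  (forall U (b : reg (e - 1) U) c, pv (sx U b) c = ev x (sval c) * b c) ->
  (forall U (b : reg (e - 1) U) c, pv (sy U b) c = ev y (sval c) * b c) ->
  (forall U (h : dom U -> K), regular (e - 2) h -> syz x y sx sy h = i U (mulsec f 0 h)) ->
  exists sx' sy' : omod_hom (twist (e - 1)) F,
  [/\ forall U (b : reg (e - 1) U) c, pv (sx' U b) c = ev x (sval c) * b c,
    forall U (b : reg (e - 1) U) c, pv (sy' U b) c = ev y (sval c) * b c &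
    forall U (h : dom U -> K), regular (e - 2) h ->
      syz x y sx' sy' h = i U (mulsec g 0 h)].
Proof.
move=> hx hy hf hg ha hb efg sxP syP syzP.
have [sx' sx'E] := perturb sx hb.
have [|sy' sy'E] := @perturb sy (- a); first by rewrite dhomogN.
exists sx', sy'; split=> [U c z|U c z|U h hh].
- by rewrite sx'E pvD (pv_i ex) addr0.
- by rewrite sy'E pvD (pv_i ex) addr0.
have := syzP U h hh; rewrite /syz sx'E sy'E => e1.
rewrite opprD addrACA e1 -!homB -homD; congr (i U _); apply: reg_ext => c.
have xh : regular (e - 1) (mulsec x (e - 1) h) by exact: regP.
have yh : regular (e - 1) (mulsec y (e - 1) h) by exact: regP.
rewrite !regDE regNE (mulsecE _ hf _ hh); last by lia.
rewrite (mulsecE _ hg _ hh); last by lia.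
rewrite (mulsecE _ hb _ yh); last by lia.
rewrite (@mulsecE K d.-1 (e - 1) 0 (- a) U _ c _ _ xh); [|by rewrite dhomogN|by lia].
rewrite (mulsecE _ hx _ hh); last by lia.
rewrite (mulsecE _ hy _ hh); last by lia.
by rewrite efg !evD !evM evN; ring.
Qed.

(* [sx] and [sy] lift to [F] the multiplications by the equations [l o0] and [l o1]
   of [L], as maps from [O(1 - d)] to [I_L(2 - d)]; the form [f] is their syzygy. *)
Definition presentation (B C : 'M[K]_4) (f : S) (sx sy : omod_hom (twist (e - 1)) F) : Prop :=
  [/\ (C *m B = 1%:M /\ B *m C = 1%:M) /\
      forall c, L c <-> ev (lf B o0) c = 0 /\ ev (lf B o1) c = 0,
    (forall U (b : reg (e - 1) U) c, pv (sx U b) c = ev (lf B o0) (sval c) * b c) /\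
      (forall U (b : reg (e - 1) U) c, pv (sy U b) c = ev (lf B o1) (sval c) * b c),
    (forall U (h : dom U -> K), regular (e - 2) h ->
      syz (lf B o0) (lf B o1) sx sy h = i U (mulsec f 0 h)),
    f \is d.-homog &
    [/\ forall q, f <> lf B o2 * q, forall q r, f <> lf B o0 * q + lf B o1 * r &
    forall c, ev f c = 0 -> ev (lf B o2) c = 0 -> ev (lf B o3) c = 0]].

Lemma presentation_exists : is_line L -> reflexive_sheaf F ->
  exists B C f sx sy, presentation B C f sx sy.
Proof.
move=> hL rF; have sF : is_sheaf F by have [[]] := rF.
have [B [C [CB BC LB]]] := line_frame hL.
have hl j : lf B j \is 1.-homog by exact: lf_homog.
have [|sx sxP] := @global_lift K L e K_fibers F i p sF ex (lf B o0) (hl _).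
  by move=> c /LB[].
have [|sy syP] := @global_lift K L e K_fibers F i p sF ex (lf B o1) (hl _).
  by move=> c /LB[].
have [f f_homog syzP] := @syzygy K L d K_fibers F i p sF ex _ _ sx sy (hl o0) (hl o1) sxP syP.
have projh (q : S) : pihomog [measure of mdeg] d.-1 q \is d.-1.-homog by exact: pihomogP.
(* If [f] were in this ideal, modified lifts would have syzygy zero, against [syzygy_nonzero]. *)
have fL a b : f <> lf B o0 * a + lf B o1 * b.
  move=> ef; have h0 : (0 : S) \is d.-homog by exact: rpred0.
  pose a' := pihomog [measure of mdeg] d.-1 a; pose b' := pihomog [measure of mdeg] d.-1 b.
  have ef' : f = 0 + lf B o0 * a' + lf B o1 * b'.
    have ed : d = (1 + d.-1)%N by lia.
    rewrite add0r -(pihomog_dE f_homog) ef raddfD /= {1 2}ed.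
    by rewrite !(pihomogM _ _ (lf_homog B _)).
  have [sx' [sy' [sxP' syP' syzP']]] := modify (hl o0) (hl o1) f_homog h0 (projh a) (projh b) ef' sxP syP syzP.
  have := @syzygy_nonzero K L d K_fibers F p rF B C CB BC LB sx' sy' sxP'.
  apply.
  move=> U g hg; rewrite syzP' // -[RHS](hom0 i U); congr (i U _); apply: reg_ext => c.
  by rewrite (mulsecE _ h0 _ hg) ?ev0 ?mul0r //; lia.
have [B' [C' [g [a [b [[CB' BC'] [e0 e1] [hg ha hb ef] [gz gL] gv]]]]]] :=
  reduce_frame K_fibers CB BC d_gt0 f_homog fL.
rewrite -e0 in sxP syzP LB; rewrite -e1 in syP syzP LB.
have hl' j : lf B' j \is 1.-homog by exact: lf_homog.
have [sx' [sy' [sxP' syP' syzP']]] := modify (hl' o0) (hl' o1) f_homog hg ha hb ef sxP syP syzP.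
by exists B', C', g, sx', sy'; split.
Qed.

Section Decomposition.
Variables (B C : 'M[K]_4) (f : S) (sx sy : omod_hom (twist (e - 1)) F).
Hypothesis pres : presentation B C f sx sy.
Hypothesis sF : is_sheaf F.
Notation l := (lf B).

(** The projection of [s] is locally a fraction vanishing on [L], hence a combination of [l o0] and
    [l o1]; subtracting the corresponding values of [sx] and [sy] leaves an element of the
    kernel. *)
Lemma local_decomposition U (s : F U) : locally (fun V (h : V <<= U) =>
  exists a b c, res F h s = i V a + sx V b + sy V c).
Proof.
move=> z Uz; have [[[CB BC] LB] [sxP syP] syzP f_homog [fz fL fv]] := pres.
have [n [q [P [dn hq qz qU hP]]]] := @common_denominator K U (at_pt Uz) 1 (fun=> e)
  (fun=> pv s : dom U -> K) d (fun=> regP (pv s)).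
have [m [hm em eP]] := hP ord0; move: (P ord0) hm eP => {hP}P hm eP.
have inU y : ev q y != 0 -> U y by move=> qy; apply: qU; split=> //; exists n.
(* The factor [q] is needed because the numerator is known to vanish only at the points of [L] where
   the denominator does not. *)
have [b [c ebc]] : exists b c, P * q = l o0 * b + l o1 * c.
  apply: (frame_vanish2 K_fibers CB BC) => v v0 v1.
  have [->|vn] := eqVneq v 0.
    rewrite /mev mevalM; have -> : q.@[fun j => (0 : 'rV[K]_4) 0 j] = 0; last by rewrite mulr0.
    rewrite (@meval_eq _ _ _ (fun=> 0)) => [|j]; last by rewrite mxE.
    have [n0|n0] := posnP n; first by lia.
    exact: meval0_homog hq n0.
  have [y ey] := exists_pt vn; rewrite -ey -[mev _ _]/(ev (P * q) y) evM.
  have [->|qy] := eqVneq (ev q y) 0; first by rewrite mulr0.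
  have := eP (at_pt (inU y qy)) qy; rewrite /proj_val itwist_vanish.
    by move/esym/eqP; rewrite mulf_eq0 invr_eq0 (negPf qy) orbF => /eqP ->; rewrite mul0r.
  by apply/LB; rewrite !ev_lf /= ey.
have hPq : P * q \is (m + n)%N.-homog by exact: dhomogM.
pose b' := pihomog [measure of mdeg] (m + n).-1 b.
pose c' := pihomog [measure of mdeg] (m + n).-1 c.
have ebc' : P * q = l o0 * b' + l o1 * c'.
  have ed : (m + n = 1 + (m + n).-1)%N by lia.
  rewrite -(pihomog_dE hPq) ebc raddfD /= {1 2}ed.
  by rewrite !(pihomogM _ _ (lf_homog B _)).
pose V := basic q; have Vq : V z by split=> //; exists n.
have V0 (y : dom V) : ev q (sval y) != 0 by have [] := svalP y.
have rr (t : S) : t \is (m + n).-1.-homog ->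
    regular (e - 1) (fun y : dom V => ev t (sval y) / ev q (sval y) ^+ 2).
  move=> ht; apply: (regularE ht (q := q ^+ 2) (n := (n * 2)%N)).
  - exact: dhomogMn.
  - by lia.
  - by move=> y; rewrite evX expf_neq0.
  - by move=> y; rewrite evX.
pose bs : reg (e - 1) V := toreg _ (fun y : dom V => ev b' (sval y) / ev q (sval y) ^+ 2).
pose cs : reg (e - 1) V := toreg _ (fun y : dom V => ev c' (sval y) / ev q (sval y) ^+ 2).
have [|a ea] := @pv_ker K L e F i p sF ex V (res F qU s - sx V bs - sy V cs).
  move=> y; rewrite !pvB pv_res sxP syP !toregE; try by apply: rr; exact: pihomogP.
  rewrite (eP (dom_sub qU y)) //=.
  have := congr1 (fun t => ev t (sval y)) ebc'; rewrite evM evD !evM => e1.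
  have := V0 y; move: e1.
  move: (ev P _) (ev q _) (ev b' _) (ev c' _) (ev (l o0) _) (ev (l o1) _) => p1 q1 b1 c1 l0 l1 e1 q0.
  have -> : p1 / q1 = (l0 * b1 + l1 * c1) / q1 ^+ 2 by rewrite -e1 expr2 invfM mulrA mulfK.
  by field.
exists V, qU; split=> //; exists a, bs, cs.
by rewrite ea addrAC !subrK.
Qed.

End Decomposition.
End Presentation.

Lemma mderiv_homog (K : fieldType) k n j (p : {mpoly K[k]}) : p \is n.-homog ->
  p^`M(j) \is n.-1.-homog.
Proof.
move=> hp; apply/dhomogP => m; rewrite mcoeff_msupp mcoeff_deriv => h.
have /(dhomog_mf hp) : (m + U_(j))%MM \in msupp p.
  by rewrite mcoeff_msupp; apply: contraNneq h => ->; rewrite mul0rn.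
by rewrite /= mdegD mdeg1 addn1 => <-.
Qed.

Lemma mderivXU (K : fieldType) k (i j : 'I_k) :
  ('X_i : {mpoly K[k]})^`M(j) = (i == j)%:R.
Proof.
rewrite mderivX mnm1E; case: eqP => [->|_]; last by rewrite scale0r.
rewrite scale1r (_ : (U_(j) - U_(j))%MM = 0%MM) ?mpolyX0 //.
by apply/mnmP => l; rewrite mnmBE subnn mnm0E.
Qed.

Lemma quotient_rule_uniq (K : fieldType) (P Pj Q Qj P' Pj' Q' Qj' : K) :
  Q != 0 -> Q' != 0 -> P * Q' = P' * Q ->
  Pj * Q' + P * Qj' = Pj' * Q + P' * Qj ->
  (Pj * Q - P * Qj) / Q ^+ 2 = (Pj' * Q' - P' * Qj') / Q' ^+ 2.
Proof.
move=> q0 q0' e e1.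
have eP : P = P' * Q / Q' by rewrite -e mulfK.
have eP1 : Pj = (Pj' * Q + P' * Qj - P * Qj') / Q' by rewrite -e1 addrK mulfK.
by rewrite eP1 eP; field; rewrite q0 q0'.
Qed.

(** * Vector fields in homogeneous coordinates *)

Section Derivatives.
Variable K : closedFieldType.
Hypothesis K_fibers : has_infinite_fibers K.
Notation S := {mpoly K[4]}.
Implicit Types (U V W : open K).

Definition fraction_at U (f : dom U -> K) (c : dom U) (p q : S) : Prop :=
  ev q (sval c) != 0 /\
  forall y : dom U, ev q (sval y) != 0 -> f y = ev p (sval y) / ev q (sval y).

Definition pdv_val (j : 'I_4) (p q : S) (c : pt K) : K :=
  (ev p^`M(j) c * ev q c - ev p c * ev q^`M(j) c) / ev q c ^+ 2.

(** The partial derivative in homogeneous coordinates, by the quotient rule on an arbitrary fraction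
    for [f] at [c]; the default 0 is taken only if there is none. *)
Definition pdv j U (f : dom U -> K) (c : dom U) : K :=
  xget 0 [set t | exists p q, fraction_at f c p q /\ t = pdv_val j p q (sval c)].

(** Two fractions for [f] agree on a dense set, so cross-multiplication is an identity of
    polynomials, which may be differentiated. *)
Lemma pdvE j U (f : dom U -> K) c p q : fraction_at f c p q ->
  pdv j f c = pdv_val j p q (sval c).
Proof.
move=> hpq; rewrite /pdv.
have : [set t | exists p q, fraction_at f c p q /\ t = pdv_val j p q (sval c)]
   (xget 0 [set t | exists p q, fraction_at f c p q /\ t = pdv_val j p q (sval c)]).
  by apply: xgetPex; exists (pdv_val j p q (sval c)), p, q.
move=> [p' [q' [hpq' ->]]].
have [qc hf] := hpq; have [qc' hf'] := hpq'.
have [n [h [hh hc hU]]] := basic_nbhd (svalP c).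
have e : p' * q = p * q'.
  apply/eqP; rewrite -subr_eq0; apply/eqP.
  apply: (@ev_ext0_on K K_fibers _ (h * q * q')).
    by rewrite !mulf_neq0 ?(ev_neq0 hc) ?(ev_neq0 qc) ?(ev_neq0 qc').
  move=> y; rewrite !evM !mulf_eq0 !negb_or -andbA => /and3P[hy qy qy'].
  have Uy : U y by apply: hU; split=> //; exists n.
  have := hf (at_pt Uy) qy; rewrite (hf' (at_pt Uy)) //= => e1.
  by rewrite evB !evM; apply/eqP; rewrite subr_eq0 -eqr_div // e1.
apply: quotient_rule_uniq => //; first by rewrite -!evM e.
have := congr1 (mderiv j) e; rewrite !mderivM => e1.
by rewrite -!evM -!evD e1.
Qed.

Lemma fraction_exists U (f : dom U -> K) c : regular 0 f ->
  exists n p q, [/\ p \is n.+1.-homog, q \is n.+1.-homog & fraction_at f c p q].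
Proof.
move=> hf; have [m [n [p [q [hp hq em qc hy]]]]] := hf c.
have {em} em : m = n by lia.
rewrite {}em in hp; have [k ck] := pt_coord (sval c).
have hX (r : S) : r \is n.-homog -> r * 'X_k \is n.+1.-homog.
  by move=> hr; rewrite -[n.+1]addn1; apply: dhomogM => //; exact: X_homog.
exists n, (p * 'X_k), (q * 'X_k); split; [exact: hX|exact: hX|].
split=> [|y]; first by rewrite evM evXU mulf_neq0.
by rewrite !evM mulf_eq0 negb_or => /andP[qy ky]; rewrite hy // -mulf_div divff // mulr1.
Qed.

Lemma fraction_near U (f : dom U -> K) c p q y : fraction_at f c p q ->
  ev q (sval y) != 0 -> fraction_at f y p q.
Proof. by move=> [_ h]; split. Qed.

Lemma pdv_regular j U (f : dom U -> K) : regular 0 f -> regular (-1) (pdv j f).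
Proof.
move=> hf c; have [n [p [q [hp hq hpq]]]] := fraction_exists c hf.
exists (n + n.+1)%N, (n.+1 * 2)%N, (p^`M(j) * q - p * q^`M(j)), (q ^+ 2); split.
- apply: rpredB; first by apply: dhomogM => //; exact: mderiv_homog hp.
  by rewrite addnC; apply: dhomogM => //; exact: mderiv_homog hq.
- exact: dhomogMn.
- by lia.
- by rewrite evX expf_neq0 //; have [] := hpq.
move=> y; rewrite evX expf_eq0 /= => qy.
by rewrite (pdvE j (fraction_near hpq qy)) evB !evM.
Qed.

Lemma pdv_sub j U V (h : V <<= U) (f : dom U -> K) c : regular 0 f ->
  pdv j (f \o dom_sub h) c = pdv j f (dom_sub h c).
Proof.
move=> hf; have [n [p [q [_ _ hpq]]]] := fraction_exists (dom_sub h c) hf.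
rewrite (pdvE j hpq) (@pdvE _ _ _ _ (p) (q)) //.
by have [qc hy] := hpq; split=> // y qy; rewrite /= hy.
Qed.

Lemma pdvD j U (f g : dom U -> K) c : regular 0 f -> regular 0 g ->
  pdv j (fun x => f x + g x) c = pdv j f c + pdv j g c.
Proof.
move=> hf hg; have [n [p [q [_ _ hpq]]]] := fraction_exists c hf.
have [n' [p' [q' [_ _ hpq']]]] := fraction_exists c hg.
have [qc hy] := hpq; have [qc' hy'] := hpq'.
rewrite (pdvE j hpq) (pdvE j hpq') (@pdvE _ _ _ _ (p * q' + p' * q) (q * q')).
  rewrite /pdv_val !mderivD !mderivM !evD !evM; field.
  by rewrite qc qc'.
split=> [|y]; first by rewrite evM mulf_neq0.
rewrite evM mulf_eq0 negb_or => /andP[qy qy'].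
by rewrite hy // hy' // evD !evM addf_div.
Qed.

Lemma pdvM j U (f g : dom U -> K) c : regular 0 f -> regular 0 g ->
  pdv j (fun x => f x * g x) c = f c * pdv j g c + g c * pdv j f c.
Proof.
move=> hf hg; have [n [p [q [_ _ hpq]]]] := fraction_exists c hf.
have [n' [p' [q' [_ _ hpq']]]] := fraction_exists c hg.
have [qc hy] := hpq; have [qc' hy'] := hpq'.
rewrite (pdvE j hpq) (pdvE j hpq') (@pdvE _ _ _ _ (p * p') (q * q')).
  rewrite /pdv_val !mderivM !evD !evM hy // hy' //; field.
  by rewrite qc qc'.
split=> [|y]; first by rewrite evM mulf_neq0.
rewrite evM mulf_eq0 negb_or => /andP[qy qy'].
by rewrite hy // hy' // !evM mulf_div.
Qed.

Lemma pdv_const j U (f : dom U -> K) (a : K) c : (forall x, f x = a) -> pdv j f c = 0.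
Proof.
move=> fa; rewrite (@pdvE _ _ _ _ (a%:MP) 1).
  by rewrite /pdv_val -mpolyC1 !mderivC !ev0 mul0r mulr0 subrr mul0r.
split=> [|y _]; first by rewrite ev1 oner_neq0.
by rewrite ev1 divr1 /ev mevalC.
Qed.

(** The middle term of the Euler sequence: coefficients of degree 1 against derivatives of degree -1
    act on functions of degree 0. *)
Definition vfam U (v : 'I_4 -> reg 1 U) : fam (twist 0) (twist 0) U :=
  fun V h f => toreg 0 (fun c => \sum_j v j (dom_sub h c) * pdv j (f : reg 0 V) c).

Lemma regular_sum k U n (f : 'I_n -> dom U -> K) : (forall j, regular k (f j)) ->
  regular k (fun c => \sum_j f j c).
Proof.
elim: n f => [|n IH] f hf.
  by under [X in regular _ X]funext do rewrite big_ord0; exact: regular0.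
under [X in regular _ X]funext do rewrite big_ord_recl.
by apply: regularD => //; exact: IH.
Qed.

Lemma vfamE U (v : 'I_4 -> reg 1 U) V (h : V <<= U) (f : reg 0 V) c :
  (vfam v h f : reg 0 V) c = \sum_j v j (dom_sub h c) * pdv j f c.
Proof.
rewrite toregE //; apply: regular_sum => j.
apply: (regular_cast (k := 1 + (-1))) => //; apply: regularM.
  exact: regular_sub (regP (v j)).
exact/pdv_regular/regP.
Qed.

Lemma vfam_deriv U (v : 'I_4 -> reg 1 U) : is_deriv U (vfam v).
Proof.
apply/asboolP; split=> [V W h h' h'' s|V h].
  apply: reg_ext => c; rewrite [RHS]reg_resE !vfamE; apply: eq_bigr => j _.
  congr (_ * _); first by congr (regfun (v j) _); exact: dom_inj.
  exact: (pdv_sub _ _ _ (regP s)).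
split=> [a b|a b hb|a b]; apply: reg_ext => c.
- rewrite regDE !vfamE -big_split; apply: eq_bigr => j _ /=.
  by rewrite -mulrDr -(pdvD _ _ (regP a) (regP b)).
- by rewrite vfamE reg0E big1 // => j _; rewrite (pdv_const _ _ hb) mulr0.
- rewrite regDE !regZE !vfamE !mulr_sumr -big_split; apply: eq_bigr => j _ /=.
  have -> : pdv j (a * b : OP3 V) c = a c * pdv j b c + b c * pdv j a c.
    exact: (pdvM _ _ (regP a) (regP b)).
  by rewrite mulrDr; congr (_ + _); rewrite mulrCA.
Qed.

Definition vf U (v : 'I_4 -> reg 1 U) : vfield U := Vfield (vfam_deriv v).

Lemma vf_res U V (h : V <<= U) (v : 'I_4 -> reg 1 U) :
  vfield_res h (vf v) = vf (fun j => reg_res h (v j)).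
Proof.
apply: val_inj; apply: fam_ext => W k s; apply: reg_ext => c.
rewrite [LHS]vfamE [RHS]vfamE; apply: eq_bigr => j _; congr (_ * _).
by rewrite reg_resE; congr (regfun (v j) _); exact: dom_inj.
Qed.

Lemma vf_linear U a (v w : 'I_4 -> reg 1 U) :
  vf (fun j => a *: v j + w j) = a *: (vf v : tangentP3 K U) + vf w.
Proof.
apply: val_inj; apply: fam_ext => W k s; apply: reg_ext => c.
have -> : (val (a *: (vf v : tangentP3 K U) + vf w : vfield U)) W k s =
   (resO k a *: (vfam v k s : twist 0 W) + vfam w k s : twist 0 W) by [].
rewrite [LHS]vfamE regDE regZE !vfamE mulr_sumr -big_split; apply: eq_bigr => j _ /=.
transitivity ((a (dom_sub k c) * v j (dom_sub k c) + w j (dom_sub k c)) * pdv j (s : reg 0 W) c).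
  by [].
by rewrite mulrDl mulrA.
Qed.

Lemma ratioX_regular j k V : V <<= basic 'X_k ->
  regular 0 (fun c : dom V => val (sval c) 0 j / val (sval c) 0 k).
Proof.
move=> h; have := regular_ratio (X_homog K k) (X_homog K j) h.
by under [X in regular _ X]funext do rewrite expr1 !evXU.
Qed.

Definition ratioX j k V : reg 0 V := toreg 0 (fun c => val (sval c) 0 j / val (sval c) 0 k).

Lemma ratioXE j k V c : V <<= basic 'X_k ->
  ratioX j k V c = val (sval c) 0 j / val (sval c) 0 k.
Proof. by move=> h; rewrite toregE //; exact: ratioX_regular. Qed.

Lemma vf_ratio U (v : 'I_4 -> reg 1 U) V (h : V <<= U) j k (c : dom V) : V <<= basic 'X_k ->
  (vfam v h (ratioX j k V) : reg 0 V) c =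
  (v j (dom_sub h c) * val (sval c) 0 k - val (sval c) 0 j * v k (dom_sub h c)) /
    val (sval c) 0 k ^+ 2.
Proof.
move=> hk; have ck := basicXE hk c.
rewrite vfamE.
have pE a : pdv a (ratioX j k V) c = ((j == a)%:R * val (sval c) 0 k - val (sval c) 0 j * (k == a)%:R) / val (sval c) 0 k ^+ 2.
  rewrite (@pdvE _ _ _ _ ('X_j) ('X_k)); last first.
    by split=> [|y _]; rewrite ?evXU // ratioXE.
  have evb (b : bool) : ev (b%:R : S) (sval c) = b%:R by case: b; rewrite ?ev1 ?ev0.
  by rewrite /pdv_val !mderivXU !evb !evXU.
under eq_bigr do rewrite pE mulrA mulrBr.
rewrite -mulr_suml sumrB; congr ((_ - _) / _).
  rewrite (bigD1 j) //= eqxx mul1r big1 ?addr0 // => a aj.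
  by rewrite eq_sym (negPf aj) mul0r mulr0.
rewrite (bigD1 k) //= eqxx mulr1 big1 ?addr0 => [|a ak]; first by rewrite mulrC.
by rewrite eq_sym (negPf ak) mulr0 mulr0.
Qed.

End Derivatives.

(** * The Euler sequence *)

Section VectorFields.
Variable K : closedFieldType.
Hypothesis K_fibers : has_infinite_fibers K.
Notation S := {mpoly K[4]}.
Notation vf := (vf K_fibers).
Implicit Types (U V W : open K).

Definition vapp U (D : vfield U) V (h : V <<= U) (a : reg 0 V) : reg 0 V :=
  vfield_fam D V h a.

Lemma vapp_res U (D : vfield U) V W (h : V <<= U) (h' : W <<= V) (h'' : W <<= U) a :
  vapp D h'' (reg_res h' a) = reg_res h' (vapp D h a).
Proof. by have /asboolP[cD _] := vfieldP D; exact: cD. Qed.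

Lemma vappD U (D : vfield U) V (h : V <<= U) (a b : reg 0 V) :
  vapp D h (a + b) = vapp D h a + vapp D h b.
Proof. by have /asboolP[_ /(_ V h) [hD _ _]] := vfieldP D; exact: hD. Qed.

Lemma vapp_const U (D : vfield U) V (h : V <<= U) k (a : reg 0 V) :
  (forall x, a x = k) -> vapp D h a = 0.
Proof. by have /asboolP[_ /(_ V h) [_ hc _]] := vfieldP D; exact: hc. Qed.

Lemma vappM U (D : vfield U) V (h : V <<= U) (a b : OP3 V) c :
  vapp D h (a * b : OP3 V) c = a c * vapp D h b c + b c * vapp D h a c.
Proof.
have /asboolP[_ /(_ V h) [_ _ hm]] := vfieldP D.
have e : vapp D h (a * b : OP3 V) = a *: (vapp D h b : twist 0 V) + b *: (vapp D h a : twist 0 V).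
  exact: hm.
by rewrite e regDE !regZE.
Qed.

Lemma vfield_ext U (D E : vfield U) :
  (forall V (h : V <<= U) a c, vapp D h a c = vapp E h a c) -> D = E.
Proof.
by move=> e; apply: val_inj; apply: fam_ext => V h a; apply: reg_ext => c; exact: e.
Qed.

(** Derivations that agree on the affine coordinates [ratioX j k] agree on polynomials in them, and
    then on local fractions of such polynomials. *)
Lemma vfield_coordinates_ext V k (D E : vfield V) : V <<= basic 'X_k ->
  (forall j, vapp D (@sub_open_refl _ V) (ratioX j k V) = vapp E (@sub_open_refl _ V) (ratioX j k V)) ->
  D = E.
Proof.
move=> hk e; apply: vfield_ext => W h g c.
have hWk : W <<= basic 'X_k by exact: sub_open_trans hk h.
have eW W' (h' : W' <<= V) j : vapp D h' (ratioX j k W') = vapp E h' (ratioX j k W').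
  have -> : ratioX j k W' = reg_res h' (ratioX j k V).
    apply: reg_ext => y; rewrite reg_resE !ratioXE //.
    exact: sub_open_trans hk h'.
  by rewrite !(vapp_res _ (@sub_open_refl _ V) h' h') e.
have [m [n [p [q [hp hq emn qc hg]]]]] := regP g c.
have {emn} emn : m = n by lia.
rewrite {}emn in hp.
pose W' := openI W (basic q).
have W'q y (W'y : W' y) : ev q y != 0 by have [_ []] := W'y.
have W'c : W' (sval c) by split; [exact: svalP|split=> //; exists n].
have h1 : W' <<= W by exact: sub_openIl.
have h2 : W' <<= V by exact: sub_open_trans h h1.
have hk' : W' <<= basic 'X_k by exact: sub_open_trans hk h2.
(* The representative with coordinate [k] equal to 1, at which a form becomes a polynomial in the
   ratios. *)
pose dh (y : dom W') : 'rV[K]_4 := (val (sval y) 0 k)^-1 *: val (sval y).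
have poly (r : S) : exists a : OP3 W', (forall y, a y = mev r (dh y)) /\ vapp D h2 a = vapp E h2 a.
  have const (z : K) : exists a : OP3 W', (forall y, a y = z) /\ vapp D h2 a = vapp E h2 a.
    have hz : regular 0 (fun y : dom W' => z).
      apply: (@regularE K 0 W' _ 0 0 z%:MP 1); rewrite ?dhomog1 ?addr0 //.
      - by rewrite -alg_mpolyC; apply: rpredZ; rewrite dhomog1.
      - by move=> y; rewrite ev1 oner_neq0.
      - by move=> y; rewrite ev1 divr1 /ev mevalC.
    exists (toreg 0 (fun y : dom W' => z)); split=> [y|]; first by rewrite toregE.
    by rewrite !(@vapp_const _ _ _ h2 z) // => y; rewrite toregE.
  have add (r1 r2 : S) :
     (exists a : OP3 W', (forall y, a y = mev r1 (dh y)) /\ vapp D h2 a = vapp E h2 a) ->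
     (exists a : OP3 W', (forall y, a y = mev r2 (dh y)) /\ vapp D h2 a = vapp E h2 a) ->
     exists a : OP3 W', (forall y, a y = mev (r1 + r2) (dh y)) /\ vapp D h2 a = vapp E h2 a.
    move=> [a [ea da]] [b [eb db]]; exists (a + b); split=> [y|].
      by rewrite regDE ea eb /mev mevalD.
    by rewrite !vappD da db.
  have mul (r1 r2 : S) :
     (exists a : OP3 W', (forall y, a y = mev r1 (dh y)) /\ vapp D h2 a = vapp E h2 a) ->
     (exists a : OP3 W', (forall y, a y = mev r2 (dh y)) /\ vapp D h2 a = vapp E h2 a) ->
     exists a : OP3 W', (forall y, a y = mev (r1 * r2) (dh y)) /\ vapp D h2 a = vapp E h2 a.
    move=> [a [ea da]] [b [eb db]]; exists (a * b); split=> [y|].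
      by rewrite regME ea eb /mev mevalM.
    by apply: reg_ext => y; rewrite !vappM da db.
  rewrite (mpolyE r).
  pose Q (r : S) := exists a : OP3 W', (forall y, a y = mev r (dh y)) /\ vapp D h2 a = vapp E h2 a.
  apply: (big_ind Q); [|exact: add|].
    by have [a [ea da]] := const 0; exists a; split=> // y; rewrite ea /mev meval0.
  move=> u _; rewrite -mul_mpolyC; apply: (mul).
    by have [a [ea da]] := const r@_u; exists a; split=> // y; rewrite ea /mev mevalC.
  rewrite mpolyXE_id.
  apply: (big_ind Q); [|exact: mul|].
    by have [a [ea da]] := const 1; exists a; split=> // y; rewrite ea /mev meval1.
  move=> j _; elim: (u j) => [|t IH].
    by have [a [ea da]] := const 1; exists a; split=> // y; rewrite ea /mev expr0 meval1.
  rewrite exprS; apply: (mul) => //; exists (ratioX j k W'); split; last exact: eW.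
  by move=> y; rewrite ratioXE // /mev mevalXU mxE mulrC.
have [a [ea da]] := poly p; have [b [eb db]] := poly q.
have dhE (r : S) y : r \is n.-homog -> mev r (dh y) = ev r (sval y) / val (sval y) 0 k ^+ n.
  by move=> hr; rewrite /dh (mev_scale _ _ hr) exprVn mulrC.
have yk (y : dom W') : val (sval y) 0 k != 0 by exact: (basicXE hk').
have gb : (reg_res h1 g : OP3 W') * b = a.
  apply: reg_ext => y; rewrite regME reg_resE ea eb !dhE //.
  have qy : ev q (sval y) != 0 by apply: W'q; exact: svalP.
  have clear (P Q X : K) : Q != 0 -> P / Q * (Q / X) = P / X by move=> Q0; rewrite mulrA divfK.
  by rewrite (hg (dom_sub h1 y) qy); exact: clear.
have c'E : dom_sub h1 (at_pt W'c) = c by exact: dom_inj.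
(* The Leibniz rule for [g * b = a], solved for the derivative of [g]. *)
have key (X : vfield V) : vapp X h g c * b (at_pt W'c) =
    vapp X h2 a (at_pt W'c) - g c * vapp X h2 b (at_pt W'c).
  have := vappM X h2 (reg_res h1 g) b (at_pt W'c); rewrite gb (vapp_res X h h1 h2).
  by rewrite !reg_resE c'E => ->; rewrite addrC addKr mulrC.
have b0 : b (at_pt W'c) != 0.
  by rewrite eb dhE // mulf_neq0 ?invr_neq0 ?expf_neq0 // yk.
by apply: (mulIf b0); rewrite !key da db.
Qed.

(** Surjectivity in the Euler sequence on a chart: the coefficients are ['X_k] times the derivatives
    of the ratios, so the one at [k] is zero. *)
Lemma vf_rep U (D : vfield U) k : exists v : 'I_4 -> reg 1 (openI U (basic 'X_k)),
  vfield_res (@sub_openIl _ U (basic 'X_k)) D = vf v.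
Proof.
pose V := openI U (basic ('X_k : S)); pose h : V <<= U := @sub_openIl _ U (basic 'X_k).
have hk : V <<= basic 'X_k by exact: sub_openIr.
pose v j : reg 1 V := toreg 1 (fun c : dom V => val (sval c) 0 k * vapp D h (ratioX j k V) c).
have vE j c : v j c = val (sval c) 0 k * vapp D h (ratioX j k V) c.
  rewrite toregE //; apply: (regular_cast (k := 1 + 0)) => //; apply: regularM; last exact: regP.
  by have := @regular_poly K 1 V 'X_k (X_homog K k); congr (regular _ _); apply/funext => y; rewrite evXU.
exists v; apply: (vfield_coordinates_ext (k := k)) => // j; apply: reg_ext => c.
have ck := basicXE hk c.
rewrite [RHS](vf_ratio K_fibers _ _ j c hk) !vE.
have -> : dom_sub (@sub_open_refl _ V) c = c by exact: dom_inj.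
have -> : vapp D h (ratioX k k V) = 0.
  apply: (@vapp_const _ _ _ _ 1) => y; rewrite ratioXE // divff //.
  exact: (basicXE hk).
rewrite reg0E !mulr0 subr0 [X in X / _]mulrAC -expr2 mulrAC divff ?mul1r ?expf_neq0 //.
have -> : vapp (vfield_res h D) (@sub_open_refl _ V) (ratioX j k V) = vapp D h (ratioX j k V).
  by rewrite /vapp /= /fam_res; congr (vfield_fam D V _ _); exact: Prop_irrelevance.
by [].
Qed.

(** The kernel in the Euler sequence: applied to the ratios, a zero field has coefficients
    proportional to the coordinates. *)
Lemma vf_eq0 U (v : 'I_4 -> reg 1 U) : vf v = 0 ->
  forall (c : dom U) (j k : 'I_4), v j c * val (sval c) 0 k = val (sval c) 0 j * v k c.
Proof.
move=> v0.
have main (c : dom U) (j k : 'I_4) : val (sval c) 0 k != 0 -> v j c * val (sval c) 0 k = val (sval c) 0 j * v k c.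
  move=> ck; pose V := openI U (basic ('X_k : S)).
  have Vc : V (sval c) by split; [exact: svalP|exact: basicX].
  have hk : V <<= basic 'X_k by exact: sub_openIr.
  have := vf_ratio K_fibers v (@sub_openIl _ U (basic 'X_k)) j (at_pt Vc) hk.
  have -> : (vfam v (@sub_openIl _ U (basic 'X_k)) (ratioX j k V) : reg 0 V) = 0.
    have := congr1 (fun D : vfield U => vapp D (@sub_openIl _ U (basic 'X_k)) (ratioX j k V)) v0.
    by [].
  rewrite reg0E => /esym/eqP; rewrite mulf_eq0 invr_eq0 expf_eq0 /= (negPf ck) orbF subr_eq0.
  have -> : dom_sub (@sub_openIl _ U (basic 'X_k)) (at_pt Vc) = c by exact: dom_inj.
  by move/eqP.
move=> c j k; have [ck|] := eqVneq (val (sval c) 0 k) 0; last exact: main.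
have [cj|cj] := eqVneq (val (sval c) 0 j) 0; first by rewrite ck cj mulr0 mul0r.
by have := main c k j cj; rewrite mulrC => ->; rewrite mulrC.
Qed.

(** The Euler field kills all functions of degree 0; it is enough to see this on the ratios. *)
Lemma vf_eq U (v w : 'I_4 -> reg 1 U) (m : reg 0 U) :
  (forall j (c : dom U), v j c = w j c + m c * val (sval c) 0 j) -> vf v = vf w.
Proof.
move=> e; apply: vfield_ext => V h a c.
have [k ck] := pt_basicX (sval c); pose W := openI V (basic ('X_k : S)).
have Wc : W (sval c) by split; [exact: svalP|].
have hU : W <<= U by exact: sub_open_trans h (@sub_openIl _ V (basic 'X_k)).
have hk : W <<= basic 'X_k by exact: sub_openIr.
have red (D : vfield U) : vapp D h a c =
    vapp (vfield_res hU D) (@sub_open_refl _ W) (reg_res (@sub_openIl _ V (basic 'X_k)) a) (at_pt Wc).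
  have := vapp_res D h (@sub_openIl _ V (basic 'X_k)) (sub_open_trans hU (@sub_open_refl _ W)) a.
  move=> /(congr1 (fun r : reg 0 W => r (at_pt Wc))); rewrite reg_resE.
  have -> : dom_sub (@sub_openIl _ V (basic 'X_k)) (at_pt Wc) = c by exact: dom_inj.
  by move=> <-.
rewrite (red (vf v)) (red (vf w)).
suff -> : vfield_res hU (vf v) = vfield_res hU (vf w) by [].
rewrite !vf_res; apply: (vfield_coordinates_ext hk) => j; apply: reg_ext => y.
rewrite [LHS](vf_ratio K_fibers _ _ j y hk) [RHS](vf_ratio K_fibers _ _ j y hk) !reg_resE !e /=.
by congr (_ / _); ring.
Qed.

End VectorFields.

Lemma sum3_split (V : zmodType) (a b c a' b' c' : V) :
  a + a' + b + b' + c + c' = a + b + c + a' + b' + c'.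
Proof. by rewrite (addrAC a a' b) (addrAC (a + b + a')) (addrAC (a + b) a' c). Qed.

Section FrameFields.
Variable K : closedFieldType.
Hypothesis K_fibers : has_infinite_fibers K.
Variables (B C : 'M[K]_4).
Hypotheses (CB : C *m B = 1%:M) (BC : B *m C = 1%:M).
Notation l := (lf B).
Implicit Types (U V W : open K).

Lemma regular_cmul k U (a : K) (f : dom U -> K) : regular k f -> regular k (fun c => a * f c).
Proof.
move=> hf; apply: (regular_cast (k := 0 + k)); first by rewrite add0r.
apply: regularM => // c; exists 0%N, 0%N, a%:MP, 1; split=> //.
- by rewrite -alg_mpolyC; apply: rpredZ; rewrite dhomog1.
- by rewrite dhomog1.
- by rewrite ev1 oner_neq0.
- by move=> y _; rewrite ev1 divr1 /ev mevalC.
Qed.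

Definition change_coords (A : 'M[K]_4) k U (a : 'I_4 -> reg k U) (j : 'I_4) : reg k U :=
  toreg k (fun c => \sum_i a i c * A i j).

Lemma change_coordsE A k U (a : 'I_4 -> reg k U) j c :
  change_coords A a j c = \sum_i a i c * A i j.
Proof.
rewrite toregE //; apply: regular_sum => i.
by under [X in regular _ X]funext do rewrite mulrC; apply/regular_cmul/regP.
Qed.

Lemma change_coords_row A k U (a : 'I_4 -> reg k U) j c :
  change_coords A a j c = ((\row_i a i c) *m A) 0 j.
Proof. by rewrite change_coordsE mxE; apply: eq_bigr => i _; rewrite mxE. Qed.

Lemma change_coordsM A A' k U (a : 'I_4 -> reg k U) j c :
  change_coords A' (change_coords A a) j c = change_coords (A *m A') a j c.
Proof.
rewrite !change_coords_row mulmxA; congr ((_ *m _) 0 _).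
by apply/rowP => i; rewrite mxE change_coords_row.
Qed.

Lemma change_coords1 k U (a : 'I_4 -> reg k U) j c : change_coords 1%:M a j c = a j c.
Proof. by rewrite change_coords_row mulmx1 mxE. Qed.

(* The vector field with components [a] in the frame [B]. *)
Definition vff U (a : 'I_4 -> reg 1 U) : vfield U := vf K_fibers (change_coords C a).

Lemma vff_linear U r (a b : 'I_4 -> reg 1 U) :
  vff (fun j => r *: a j + b j) = r *: (vff a : tangentP3 K U) + vff b.
Proof.
rewrite /vff -vf_linear; congr (vf K_fibers _); apply/funext => j; apply: reg_ext => c.
rewrite regDE regZE !change_coordsE mulr_sumr -big_split; apply: eq_bigr => i _ /=.
transitivity ((r c * a i c + b i c) * C i j); first by [].
by rewrite mulrDl mulrA.
Qed.

Lemma vff_res U V (h : V <<= U) (a : 'I_4 -> reg 1 U) :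
  vfield_res h (vff a) = vff (fun j => reg_res h (a j)).
Proof.
rewrite /vff vf_res; congr (vf K_fibers _); apply/funext => j; apply: reg_ext => c.
by rewrite reg_resE !change_coordsE.
Qed.

Lemma vff_eq U (a b : 'I_4 -> reg 1 U) (m : reg 0 U) :
  (forall j (c : dom U), a j c = b j c + m c * ev (l j) (sval c)) -> vff a = vff b.
Proof.
move=> e; apply: (@vf_eq K K_fibers U _ _ m) => j c; rewrite !change_coords_row.
have -> : (\row_i a i c) = (\row_i b i c) + m c *: (val (sval c) *m B).
  by apply/rowP => i; rewrite !mxE e; congr (_ + _ * _); rewrite ev_lf mxE.
by rewrite mulmxDl mxE -scalemxAl -mulmxA BC mulmx1 [X in _ + X]mxE.
Qed.

Lemma vff_eq0 U (a : 'I_4 -> reg 1 U) : vff a = 0 ->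
  forall (c : dom U) j k, a j c * ev (l k) (sval c) = ev (l j) (sval c) * a k c.
Proof.
move=> /vf_eq0 h c j k.
pose u : 'rV[K]_4 := \row_i change_coords C a i c.
have uB i : (u *m B) 0 i = a i c.
  rewrite /u (_ : \row__ _ = (\row_i a i c) *m C).
    by rewrite -mulmxA CB mulmx1 mxE.
  by apply/rowP => i'; rewrite mxE change_coords_row.
rewrite -(uB j) -(uB k) !ev_lf [(u *m B) 0 j]mxE [(_ *m B) 0 j in RHS]mxE.
rewrite !mulr_suml; apply: eq_bigr => i _; rewrite mulrAC [RHS]mulrAC; congr (_ * _).
rewrite !mxE mulr_sumr [RHS]mulr_sumr; apply: eq_bigr => i' _.
by rewrite !mulrA; congr (_ * _); rewrite h; congr (_ * _); rewrite mxE.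
Qed.

Lemma vff_rep U (D : vfield U) k : exists a : 'I_4 -> reg 1 (openI U (basic 'X_k)),
  vfield_res (@sub_openIl _ U (basic 'X_k)) D = vff a.
Proof.
have [v ->] := vf_rep K_fibers D k; exists (change_coords B v).
rewrite /vff; congr (vf K_fibers _); apply/funext => j; apply: reg_ext => c.
by rewrite change_coordsM BC change_coords1.
Qed.

End FrameFields.

(** * Homomorphisms out of the reflexive sheaf *)

Section Maps.
Variables (K : closedFieldType) (L : set (pt K)) (d : nat).
Hypotheses (K_fibers : has_infinite_fibers K) (d_gt0 : (0 < d)%N).
Notation e := (2 - d%:Z).
Variables (F : omodule K) (i : omod_hom (twist 0) F)
  (p : omod_hom F (itwist (ideal_of L) e)).
Hypotheses (ex : short_exact i p) (sF : is_sheaf F).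
Notation S := {mpoly K[4]}.
Implicit Types (U V W : open K).
Notation pv s := (proj_val p s).
Variables (B C : 'M[K]_4) (f : S) (sx sy : omod_hom (twist (e - 1)) F).
Hypothesis pres : presentation i p B C f sx sy.
Notation l := (lf B).

Let CB : C *m B = 1%:M. Proof. by case: pres => [[[]]]. Qed.
Let BC : B *m C = 1%:M. Proof. by case: pres => [[[]]]. Qed.
Let sxP U (b : reg (e - 1) U) c : pv (sx U b) c = ev (l o0) (sval c) * b c.
Proof. by case: pres => [_ [h _]] *; exact: h. Qed.
Let syP U (b : reg (e - 1) U) c : pv (sy U b) c = ev (l o1) (sval c) * b c.
Proof. by case: pres => [_ [_ h]] *; exact: h. Qed.
Let syzP U (h : dom U -> K) : regular (e - 2) h ->
  syz (l o0) (l o1) sx sy h = i U (mulsec f 0 h).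
Proof. by case: pres => _ _ hh _ _; exact: hh. Qed.
Let f_homog : f \is d.-homog. Proof. by case: pres. Qed.
Let lh j : l j \is 1.-homog. Proof. exact: lf_homog. Qed.

(** The projection gives [x b + y c = 0], so [b] and [-c] are [y] and [x] times a common [h]; the
    syzygy then determines [a], as [i] is injective. *)
Lemma relation_solution U a b c : i U a + sx U b + sy U c = 0 ->
  exists h : dom U -> K, forall x, [/\ a x = ev f (sval x) * h x,
    b x = ev (l o1) (sval x) * h x & c x = - (ev (l o0) (sval x) * h x)].
Proof.
move=> e0.
have pv0 x : ev (l o0) (sval x) * b x = ev (l o1) (sval x) * (- c : reg (e - 1) U) x.
  have := congr1 (fun s => pv s x) e0; rewrite !pvD (pv_i ex) sxP syP add0r.
  have -> : pv (0 : F U) x = 0 by rewrite /proj_val hom0.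
  rewrite regNE mulrN => /eqP.
  by rewrite addr_eq0 => /eqP.
have [|h hh hP] := regular_divide K_fibers CB BC (i := o0) (j := o1) _ (regP (- c)) (regP b) pv0.
  by [].
have {}hh : regular (e - 2) h by apply: regular_cast hh; lia.
exists h => x; have [e1 e2] := hP x; split=> //; last by rewrite -e1 regNE opprK.
have eb : b = mulsec (l o1) (e - 1) h.
  by apply: reg_ext => y; rewrite (mulsecE _ (lh _) _ hh); [have [] := hP y|lia].
have ec : c = - mulsec (l o0) (e - 1) h.
  apply: reg_ext => y; rewrite regNE (mulsecE _ (lh _) _ hh); [|lia].
  by have [<- _] := hP y; rewrite regNE opprK.
have ea : a = mulsec f 0 h.
  apply: (i_inj ex); rewrite -syzP // /syz -eb.
  have -> : mulsec (l o0) (e - 1) h = - c by rewrite ec opprK.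
  rewrite homN; apply/eqP; rewrite -subr_eq0 opprB opprK.
  by rewrite addrA e0.
by rewrite ea (mulsecE _ f_homog _ hh) //; lia.
Qed.

(** The values [q], [r1], [r2] on the generators define a map as soon as they annihilate the single
    relation [(f, y, -x)]. *)
Lemma functional (q r1 r2 : S) : q \is 1.-homog -> r1 \is d.-homog -> r2 \is d.-homog ->
  q * f + r1 * l o1 - r2 * l o0 = 0 ->
  exists nu : omod_hom F (twist 1), forall U a b c x,
    (nu U (i U a + sx U b + sy U c) : reg 1 U) x =
      ev q (sval x) * a x + ev r1 (sval x) * b x + ev r2 (sval x) * c x.
Proof.
move=> hq hr1 hr2 e0.
pose T U (a : reg 0 U) (b c : reg (e - 1) U) : dom U -> K := fun x =>
  ev q (sval x) * a x + ev r1 (sval x) * b x + ev r2 (sval x) * c x.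
have TR U a b c : regular 1 (@T U a b c).
  apply: regularD; [apply: regularD|].
  - by apply: (regular_mulp hq _ (regP a)); lia.
  - by apply: (regular_mulp hr1 _ (regP b)); lia.
  - by apply: (regular_mulp hr2 _ (regP c)); lia.
pose Rel U (s : F U) (t : twist 1 U) := exists a b c,
  s = i U a + sx U b + sy U c /\ forall x, (t : reg 1 U) x = T U a b c x.
have [||||nu [_ nuP]] := @glue_hom K F (twist 1) Rel (@twist_sheaf _ _).
- move=> U V h s t [a [b [c [es et]]]].
  exists (reg_res h a), (reg_res h b), (reg_res h c); split.
    by rewrite es !resD -!hom_res.
  by move=> x; rewrite [LHS]reg_resE et.
- move=> U r s s' t t' [a [b [c [es et]]]] [a' [b' [c' [es' et']]]].
  exists (r *: (a : twist 0 U) + a'), (r *: b + b'), (r *: c + c'); split.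
    by rewrite !hom_linear es es' !scalerDr !addrA; exact/esym/sum3_split.
  by move=> x; rewrite regDE regZE et et' /T !regDE !regZE; ring.
- move=> U t [a [b [c [/esym es et]]]]; apply: reg_ext => x; rewrite et reg0E /T.
  have [h hP] := relation_solution es; have [-> -> ->] := hP x.
  have := congr1 (fun g => ev g (sval x)) e0; rewrite evB evD !evM ev0.
  move: (ev q _) (ev f _) (ev r1 _) (ev r2 _) (ev (l o0) _) (ev (l o1) _) (h x) => A0 A1 A2 A3 A4 A5 A6 eq.
  by transitivity ((A0 * A1 + A2 * A5 - A3 * A4) * A6); [ring|rewrite eq mul0r].
- move=> U s x Ux; have [V [h [Vx [a [b [c es]]]]]] := local_decomposition K_fibers d_gt0 ex pres sF s Ux.
  exists V, h; split=> //; exists (toreg 1 (T V a b c)), a, b, c; split=> // z.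
  by rewrite toregE.
exists nu => U a b c x.
rewrite (nuP U _ (toreg 1 (T U a b c))); first by rewrite toregE.
by exists a, b, c; split=> // z; rewrite toregE.
Qed.

End Maps.

Lemma ord4_ind (P : 'I_4 -> Prop) : P o0 -> P o1 -> P o2 -> P o3 -> forall j, P j.
Proof.
move=> h0 h1 h2 h3 [[|[|[|[|//]]]] hj].
- by have -> : Ordinal hj = o0 by exact: val_inj.
- by have -> : Ordinal hj = o1 by exact: val_inj.
- by have -> : Ordinal hj = o2 by exact: val_inj.
- by have -> : Ordinal hj = o3 by exact: val_inj.
Qed.

Definition quad (T : Type) (t0 t1 t2 t3 : T) (j : 'I_4) : T :=
  if j == o0 then t0 else if j == o1 then t1 else if j == o2 then t2 else t3.

Lemma form_clear (K : fieldType) (q f x y zd z w p0 p1 p2 p3 : K) : q != 0 ->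
  f * (z * (p3 / q) - w * (p2 / q)) + zd * (x * (p1 / q) - y * (p0 / q)) = 0 ->
  f * (z * p3 - w * p2) - zd * (y * p0 - x * p1) = 0.
Proof.
move=> q0 e; rewrite -[RHS](mulr0 q) -e; field.
by [].
Qed.

Lemma form_rearrange (R : comPzRingType) (x y f b c p0 p1 : R) :
  y * p0 - x * p1 = f * (x * b + y * c) -> x * (p1 + f * b) - y * (p0 - f * c) = 0.
Proof.
move=> e; transitivity (f * (x * b + y * c) - (y * p0 - x * p1)); first by ring.
by rewrite e subrr.
Qed.

(** * The twisted 1-form *)

Section Exactness.
Variables (K : closedFieldType) (L : set (pt K)) (d : nat).
Hypotheses (K_fibers : has_infinite_fibers K) (d_gt0 : (0 < d)%N).
Notation e := (2 - d%:Z).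
Variables (F : omodule K) (i : omod_hom (twist 0) F)
  (p : omod_hom F (itwist (ideal_of L) e)).
Hypotheses (ex : short_exact i p) (sF : is_sheaf F).
Notation S := {mpoly K[4]}.
Implicit Types (U V W : open K).
Notation pv s := (proj_val p s).
Variables (B C : 'M[K]_4) (f : S) (sx sy : omod_hom (twist (e - 1)) F).
Hypothesis pres : presentation i p B C f sx sy.
Notation l := (lf B).
Notation vff := (vff K_fibers C).

Let CB : C *m B = 1%:M. Proof. by case: pres => [[[]]]. Qed.
Let BC : B *m C = 1%:M. Proof. by case: pres => [[[]]]. Qed.
Let sxP U (b : reg (e - 1) U) c : pv (sx U b) c = ev (l o0) (sval c) * b c.
Proof. by case: pres => [_ [h _]] *; exact: h. Qed.
Let syP U (b : reg (e - 1) U) c : pv (sy U b) c = ev (l o1) (sval c) * b c.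
Proof. by case: pres => [_ [_ h]] *; exact: h. Qed.
Let f_homog : f \is d.-homog. Proof. by case: pres. Qed.
Let fz q : f <> l o2 * q. Proof. by case: pres => _ _ _ _ []. Qed.
Let fL q r : f <> l o0 * q + l o1 * r. Proof. by case: pres => _ _ _ _ []. Qed.
Let lh j : l j \is 1.-homog. Proof. exact: lf_homog. Qed.

(* The 1-form [f (z dw - w dz) + z^d (x dy - y dx)] evaluated on the vector field
   with components [a]. *)
Definition form_val U (a : 'I_4 -> reg 1 U) (c : dom U) : K :=
  ev f (sval c) * (ev (l o2) (sval c) * a o3 c - ev (l o3) (sval c) * a o2 c) +
  ev (l o2) (sval c) ^+ d * (ev (l o0) (sval c) * a o1 c - ev (l o1) (sval c) * a o0 c).

Let zd_homog : l o2 ^+ d \is d.-homog.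
Proof. by have := dhomogMn d (lh o2); rewrite mul1n. Qed.

Lemma form_regular U (a : 'I_4 -> reg 1 U) : regular (d%:Z + 2) (form_val a).
Proof.
have r2 j k : regular 2 (fun c => ev (l j) (sval c) * a k c).
  by apply: (regular_mulp (lh j) _ (regP (a k))).
apply: regularD.
  by apply: (regular_mulp (k := 2) f_homog) => //; apply: regularD => //; exact: regularN.
have : regular (d%:Z + 2) (fun c : dom U => ev (l o2 ^+ d) (sval c) *
    (ev (l o0) (sval c) * a o1 c - ev (l o1) (sval c) * a o0 c)).
  by apply: (regular_mulp (k := 2) zd_homog) => //; apply: regularD => //; exact: regularN.
by congr (regular _ _); apply/funext => c; rewrite evX.
Qed.

(** The value does not depend on the chosen components because the 1-form kills the Euler field. *)
Lemma form_exists : exists om : omod_hom (tangentP3 K) (twist (d%:Z + 2)),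
  forall U (a : 'I_4 -> reg 1 U) c, (om U (vff a) : reg _ U) c = form_val a c.
Proof.
pose Rel U (D : tangentP3 K U) (t : twist (d%:Z + 2) U) := exists a : 'I_4 -> reg 1 U,
  D = vff a /\ forall c, (t : reg _ U) c = form_val a c.
have [||||om [_ omP]] := @glue_hom K (tangentP3 K) (twist (d%:Z + 2)) Rel (@twist_sheaf _ _).
- move=> U V h D t [a [-> et]]; exists (fun j => reg_res h (a j)); split.
    exact: vff_res.
  by move=> c; rewrite [LHS]reg_resE et.
- move=> U r D D' t t' [a [-> et]] [b [-> et']]; exists (fun j => r *: a j + b j); split.
    by rewrite vff_linear.
  by move=> c; rewrite regDE regZE et et' /form_val !regDE !regZE; ring.
- move=> U t [a [/esym a0 et]]; apply: reg_ext => c; rewrite et reg0E /form_val.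
  have h := vff_eq0 CB a0 c.
  rewrite [ev (l o2) _ * a o3 c]mulrC (h o3 o2) [ev (l o0) _ * a o1 c]mulrC (h o1 o0).
  by rewrite !subrr !mulr0 addr0.
- move=> U D x Ux; have [k xk] := pt_basicX x.
  have [a ea] := vff_rep K_fibers BC D k.
  exists (openI U (basic 'X_k)), (@sub_openIl _ _ _); split=> //.
  exists (toreg _ (form_val a)), a; split; first exact: ea.
  by move=> c; rewrite toregE //; exact: form_regular.
exists om => U a c; rewrite (omP U _ (toreg _ (form_val a))).
  by rewrite toregE //; exact: form_regular.
by exists a; split=> // z; rewrite toregE //; exact: form_regular.
Qed.

(** As [f] is prime to [z^d], both brackets are multiples of a common [E], and regular sequences
    then give the four components. [M] is the multiple of the Euler field that a representative with
    vanishing third component would lack. *)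
Lemma form_syzygy n (P : 'I_4 -> S) : (d <= n)%N -> (forall j, P j \is n.+1.-homog) ->
  f * (l o2 * P o3 - l o3 * P o2) = l o2 ^+ d * (l o1 * P o0 - l o0 * P o1) ->
  exists A M b c, [/\ A \is n.-homog, M \is n.-homog, b \is (n.+1 - d)%N.-homog & c \is (n.+1 - d)%N.-homog] /\
    [/\ P o0 = l o0 * A + f * c, P o1 = l o1 * A - f * b, P o2 = l o2 * M &
       P o3 = l o2 ^+ d.-1 * (l o0 * b + l o1 * c) + l o3 * M].
Proof.
move=> dn hP eP.
have [E [e23 e01]] := frame_coprime K_fibers CB BC fz eP.
have zE : l o2 ^+ d * E = l o2 * (l o2 ^+ d.-1 * E) by rewrite mulrA -exprS prednK.
have [||M [e3 e2]] := @frame_regular2 K K_fibers B C CB BC o2 o3 1 (P o3 - l o2 ^+ d.-1 * E) (P o2).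
- by [].
- by rewrite !expr1 mulrBr -zE -e23 subKr.
rewrite !expr1 in e3 e2.
(* [f * E] lies in the prime ideal of [L] and [f] does not. *)
have [b [c eE]] : exists b c, E = l o0 * b + l o1 * c.
  have eE0 : f * E = l o0 * (- P o1) + l o1 * P o0 by rewrite mulrN addrC -e01.
  by case: (frame_vanish2_prime K_fibers CB BC eE0) => // [[b [c /fL]]].
have [||A [e1 e0]] := @frame_regular2 K K_fibers B C CB BC o0 o1 1 (P o1 + f * b) (P o0 - f * c).
- by [].
- rewrite !expr1; apply/eqP; rewrite -subr_eq0; apply/eqP.
  by move: e01; rewrite eE; exact: form_rearrange.
rewrite !expr1 in e1 e0.
have hE : pihomog [measure of mdeg] (n.+2 - d) E = l o0 * pihomog [measure of mdeg] (n.+1 - d) b + l o1 * pihomog [measure of mdeg] (n.+1 - d) c.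
  have -> : (n.+2 - d = 1 + (n.+1 - d))%N by lia.
  by rewrite eE raddfD /= !(pihomogM _ _ (lf_homog B _)).
exists (pihomog [measure of mdeg] n A), (pihomog [measure of mdeg] n M),
  (pihomog [measure of mdeg] (n.+1 - d) b), (pihomog [measure of mdeg] (n.+1 - d) c).
split; first by split; exact: pihomogP.
have n1 : n.+1 = (1 + n)%N by [].
have nd : n.+1 = (d + (n.+1 - d))%N by lia.
have nd1 : n.+1 = (d.-1 + (n.+2 - d))%N by lia.
have hl j r : pihomog [measure of mdeg] n.+1 (l j * r) = l j * pihomog [measure of mdeg] n r.
  by rewrite {1}n1 (pihomogM _ _ (lf_homog B j)).
have hf r : pihomog [measure of mdeg] n.+1 (f * r) = f * pihomog [measure of mdeg] (n.+1 - d) r.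
  by rewrite {1}nd (pihomogM _ _ f_homog).
have hz r : pihomog [measure of mdeg] n.+1 (l o2 ^+ d.-1 * r) = l o2 ^+ d.-1 * pihomog [measure of mdeg] (n.+2 - d) r.
  rewrite {1}nd1 pihomogM //.
  by have := dhomogMn d.-1 (lh o2); rewrite mul1n.
split.
- by rewrite -(pihomog_dE (hP o0)) -hl -hf -raddfD /= -e0 subrK.
- by rewrite -(pihomog_dE (hP o1)) -hl -hf -raddfB /= -e1 addrK.
- by rewrite -(pihomog_dE (hP o2)) e2 hl.
- by rewrite -hE -(pihomog_dE (hP o3)) -hl -hz -raddfD /= -e3 subrKC.
Qed.

Section Tangent.
Variables (nu mu : omod_hom F (twist 1)).
Hypothesis nuP : forall U a b c x, (nu U (i U a + sx U b + sy U c) : reg 1 U) x =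
  ev (l o0) (sval x) * a x + ev f (sval x) * c x.
Hypothesis muP : forall U a b c x, (mu U (i U a + sx U b + sy U c) : reg 1 U) x =
  ev (l o1) (sval x) * a x - ev f (sval x) * b x.

Definition comp3 U (s : F U) : reg 1 U :=
  toreg 1 (fun c => ev (l o2) (sval c) ^+ d.-1 * pv s c).

Lemma comp3E U (s : F U) c : comp3 s c = ev (l o2) (sval c) ^+ d.-1 * pv s c.
Proof.
have zh : l o2 ^+ d.-1 \is d.-1.-homog.
  by have := dhomogMn d.-1 (lh o2); rewrite mul1n.
rewrite toregE //; have : regular 1 (fun c : dom U => ev (l o2 ^+ d.-1) (sval c) * pv s c).
  by apply: (regular_mulp zh _ (regP (pv s))); lia.
by congr (regular _ _); apply/funext => c'; rewrite evX.
Qed.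

(** The last component is [z^(d-1)] times the projection of [s], which is [x] on [sx] and [y] on
    [sy]. *)
Definition comps U (s : F U) : 'I_4 -> reg 1 U := quad (nu U s) (mu U s) 0 (comp3 s).

Lemma comps_linear U r (s t : F U) : comps (r *: s + t) = (fun j => r *: comps s j + comps t j).
Proof.
apply/funext; apply: ord4_ind; apply: reg_ext => c; rewrite /comps /quad /=.
- by rewrite hom_linear.
- by rewrite hom_linear.
- by transitivity (r c * 0 + 0 : K); [rewrite mulr0 addr0|].
- transitivity (r c * comp3 s c + comp3 t c); last by [].
  by rewrite !comp3E pvD pvZ mulrDr mulrCA.
Qed.

Lemma comps_res U V (h : V <<= U) (s : F U) :
  comps (res F h s) = (fun j => reg_res h (comps s j)).
Proof.
apply/funext; apply: ord4_ind; apply: reg_ext => c; rewrite /comps /quad /=.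
- by rewrite hom_res.
- by rewrite hom_res.
- by [].
- by transitivity (comp3 s (dom_sub h c)); [rewrite !comp3E pv_res|].
Qed.

Lemma incl_exists : exists phi : omod_hom F (tangentP3 K),
  forall U s, phi U s = vff (comps s).
Proof.
pose g U (s : F U) : tangentP3 K U := vff (comps s).
have g_lin U : linear (@g U).
  by move=> r s t; rewrite /g comps_linear vff_linear.
have g_res U V (h : V <<= U) (s : F U) : g V (res F h s) = res (tangentP3 K) h (g U s).
  by rewrite /g comps_res; exact/esym/vff_res.
by exists (Defs.Hom g_lin g_res).
Qed.

Lemma comps_decomposed U a b c x :
  let s := i U a + sx U b + sy U c in
  [/\ comps s o0 x = ev (l o0) (sval x) * a x + ev f (sval x) * c x,
      comps s o1 x = ev (l o1) (sval x) * a x - ev f (sval x) * b x,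
      comps s o2 x = 0 &
      comps s o3 x = ev (l o2) (sval x) ^+ d.-1 *
         (ev (l o0) (sval x) * b x + ev (l o1) (sval x) * c x)].
Proof.
split; rewrite /comps /quad /=; [exact: nuP|exact: muP|by []|].
by rewrite comp3E !pvD (pv_i ex) sxP syP add0r.
Qed.

Lemma form_comps U (s : F U) x : form_val (comps s) x = 0.
Proof.
have [V [h [Vx [a [b [c es]]]]]] := local_decomposition K_fibers d_gt0 ex pres sF s (svalP x).
have [e0 e1 e2 e3] := comps_decomposed a b c (at_pt Vx).
have xE : dom_sub h (at_pt Vx) = x by exact: dom_inj.
have ec j : comps s j x = comps (i V a + sx V b + sy V c) j (at_pt Vx).
  by rewrite -es comps_res reg_resE xE.
have zd (t : K) : t ^+ d = t * t ^+ d.-1 by rewrite -exprS prednK.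
rewrite /form_val !ec e0 e1 e2 e3 /= zd.
by move: (ev f _) (ev (l o0) _) (ev (l o1) _) (ev (l o2) _) (ev (l o3) _) (_ ^+ _) (a _) (b _) (c _) => *; ring.
Qed.

(** Components of a zero field are proportional to the coordinates; since the third is 0, all
    vanish. The fourth then kills the projection of [s], and the first kills the remaining multiple
    of the section 1. *)
Lemma comps_inj U (s : F U) : vff (comps s) = 0 -> s = 0.
Proof.
move=> /(vff_eq0 CB) h.
have zero j : forall x : dom U, comps s j x = 0.
  apply: (regular_eq0 K_fibers (regP (comps s j)) (frame_neq0 K_fibers CB o2)) => y zy.
  have := h y j o2; rewrite [comps s o2]/comps /quad /= mulr0 => /eqP.
  by rewrite mulf_eq0 (negPf zy) orbF => /eqP.
have pv0 : forall x : dom U, pv s x = 0.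
  have zn : l o2 ^+ d.-1 != 0 by rewrite expf_neq0 // (frame_neq0 K_fibers CB).
  apply: (regular_eq0 K_fibers (regP (pv s)) zn) => y; rewrite evX => zy.
  have := zero o3 y; rewrite /comps /quad /= comp3E => /eqP.
  by rewrite mulf_eq0 (negPf zy) => /eqP.
have [a ea] := pv_ker sF ex pv0; rewrite -ea.
suff -> : a = 0 by rewrite hom0.
apply: reg_ext; apply: (regular_eq0 K_fibers (regP a) (frame_neq0 K_fibers CB o0)) => y xy.
have := zero o0 y; rewrite -ea /comps /quad /=.
have := nuP a 0 0 y; rewrite !hom0 !addr0 => -> /eqP.
by rewrite reg0E mulr0 addr0 mulf_eq0 (negPf xy) => /eqP.
Qed.

(** Over a common denominator the condition is an equation between forms, solved by [form_syzygy];
    its cofactors are the coefficients of the section of [F]. *)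
Lemma form_exact U (a : 'I_4 -> reg 1 U) : (forall c, form_val a c = 0) ->
  locally (fun V (h : V <<= U) => exists s : F V, vfield_res h (vff a) = vff (comps s)).
Proof.
move=> a0 x0 Ux.
have [n [q [P [dn hq qx qU hP]]]] := @common_denominator K U (at_pt Ux) 4 (fun=> 1)
  (fun j => a j) d (fun j => regP (a j)).
have hPn j : P j \is n.+1.-homog.
  by have [m [hm em _]] := hP j; have -> : n.+1 = m by lia.
have aE j (y : dom U) : ev q (sval y) != 0 -> a j y = ev (P j) (sval y) / ev q (sval y).
  by have [m [_ _]] := hP j; apply.
have inU y : ev q y != 0 -> U y by move=> qy; apply: qU; split=> //; exists n.
have eP : f * (l o2 * P o3 - l o3 * P o2) = l o2 ^+ d * (l o1 * P o0 - l o0 * P o1).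
  apply/eqP; rewrite -subr_eq0; apply/eqP.
  apply: (ev_ext0_on K_fibers (ev_neq0 qx)) => y qy.
  have := a0 (at_pt (inU y qy)); rewrite /form_val !aE //=.
  rewrite !evB !evM !evX !evB !evM; move: (ev f y) (ev (l o0) y) (ev (l o1) y) (ev (l o2) y ^+ d) (ev (l o2) y) (ev (l o3) y) => A0 A1 A2 A3 A4 A5 e1.
  exact: form_clear qy e1.
have [A [M [b [c [[hA hM hb hc] [e0 e1 e2 e3]]]]]] := form_syzygy dn hPn eP.
pose V := basic q; have Vx : V x0 by split=> //; exists n.
have V0 (y : dom V) : ev q (sval y) != 0 by have [] := svalP y.
have rq k m (t : S) : t \is m.-homog -> m%:Z = n%:Z + k ->
    regular k (fun y : dom V => ev t (sval y) / ev q (sval y)).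
  by move=> ht em; apply: (regularE ht hq em).
(* Removing [M] times the Euler field makes the third component zero, as in [comps], and turns [A]
   into [A - M]. *)
pose as_ : reg 0 V := toreg 0 (fun y : dom V => ev (A - M) (sval y) / ev q (sval y)).
pose bs : reg (e - 1) V := toreg (e - 1) (fun y : dom V => ev b (sval y) / ev q (sval y)).
pose cs : reg (e - 1) V := toreg (e - 1) (fun y : dom V => ev c (sval y) / ev q (sval y)).
pose ms : reg 0 V := toreg 0 (fun y : dom V => ev M (sval y) / ev q (sval y)).
have asE y : as_ y = ev (A - M) (sval y) / ev q (sval y).
  by rewrite toregE //; apply: (rq 0 n); [apply: rpredB|lia].
have bsE y : bs y = ev b (sval y) / ev q (sval y).
  by rewrite toregE //; apply: (rq _ _ _ hb); lia.
have csE y : cs y = ev c (sval y) / ev q (sval y).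
  by rewrite toregE //; apply: (rq _ _ _ hc); lia.
have msE y : ms y = ev M (sval y) / ev q (sval y).
  by rewrite toregE //; apply: (rq 0 n); [|lia].
exists V, qU; split=> //; exists (i V as_ + sx V bs + sy V cs).
rewrite vff_res; apply: (@vff_eq K K_fibers B C BC V _ _ ms) => j y.
have [c0 c1 c2 c3] := comps_decomposed as_ bs cs y.
rewrite reg_resE aE; last exact: V0.
have q0 := V0 y.
elim/ord4_ind: j.
- rewrite c0 e0 asE csE msE evB evD !evM -[sval (dom_sub qU y)]/(sval y).
  by move: (ev q _) q0 (ev A _) (ev M _) (ev f _) (ev (l o0) _) (ev c _) => Q Q0 *; field.
- rewrite c1 e1 asE bsE msE !evB !evM -[sval (dom_sub qU y)]/(sval y).
  by move: (ev q _) q0 (ev A _) (ev M _) (ev f _) (ev (l o1) _) (ev b _) => Q Q0 *; field.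
- rewrite c2 e2 msE evM add0r -[sval (dom_sub qU y)]/(sval y).
  by move: (ev q _) q0 (ev M _) (ev (l o2) _) => Q Q0 *; field.
- rewrite c3 e3 bsE csE msE evD !evM evX evD !evM -[sval (dom_sub qU y)]/(sval y).
  move: (ev q _) q0 (ev M _) (ev (l o2) _ ^+ _) (ev (l o3) _) (ev b _) (ev c _) (ev (l o0) _) (ev (l o1) _) => Q Q0 *.
  by field.
Qed.

End Tangent.

Lemma tangent_sequence : exists (phi : omod_hom F (tangentP3 K))
    (om : omod_hom (tangentP3 K) (twist (d%:Z + 2))),
  [/\ forall U, injective (phi U),
      forall U s, om U (phi U s) = 0,
      forall U (D : tangentP3 K U), om U D = 0 ->
        locally (fun V (h : V <<= U) => exists s : F V, phi V s = res (tangentP3 K) h D),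
      forall U s, exists a : 'I_4 -> reg 1 U, phi U s = vff a &
      forall U (a : 'I_4 -> reg 1 U) c, (om U (vff a) : reg _ U) c = form_val a c].
Proof.
have f_h := f_homog.
have [||||nu nuP] := @functional K L d K_fibers d_gt0 F i p ex sF B C f sx sy pres (l o0) 0 f.
- exact: lh.
- exact: rpred0.
- exact: f_h.
- by rewrite mul0r addr0 mulrC subrr.
have [||||mu muP] := @functional K L d K_fibers d_gt0 F i p ex sF B C f sx sy pres (l o1) (- f) 0.
- exact: lh.
- by rewrite dhomogN.
- exact: rpred0.
- by rewrite mul0r subr0 mulNr mulrC subrr.
have {}nuP U a b c x : (nu U (i U a + sx U b + sy U c) : reg 1 U) x =
    ev (l o0) (sval x) * a x + ev f (sval x) * c x.
  by rewrite nuP ev0 mul0r addr0.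
have {}muP U a b c x : (mu U (i U a + sx U b + sy U c) : reg 1 U) x =
    ev (l o1) (sval x) * a x - ev f (sval x) * b x.
  by rewrite muP ev0 mul0r addr0 evN mulNr.
have [phi phiE] := incl_exists nu mu; have [om omE] := form_exists.
exists phi, om; split.
- move=> U s t est; apply/eqP; rewrite -subr_eq0; apply/eqP.
  have h0 : vff (comps nu mu (s - t)) = 0 by rewrite -phiE homB est subrr.
  exact: (comps_inj nuP h0).
- by move=> U s; rewrite phiE; apply: reg_ext => c; rewrite omE (form_comps nuP muP).
- move=> U D oD x Ux; have [k xk] := pt_basicX x.
  have [a ea] := vff_rep K_fibers BC D k.
  pose V := openI U (basic ('X_k : S)); pose hV : V <<= U := @sub_openIl _ U (basic 'X_k).
  have a0 c : form_val a c = 0.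
    rewrite -omE -ea -[vfield_res _ _]/(res (tangentP3 K) hV D) hom_res oD.
    by rewrite res0.
  have Vx : V x by [].
  have [W [h [Wx [s es]]]] := form_exact nuP muP a0 Vx.
  exists W, (sub_open_trans hV h); split=> //; exists s.
  by rewrite phiE -es -ea; exact: vfield_res_comp.
- by move=> U s; exists (comps nu mu s).
- exact: omE.
Qed.

End Exactness.

(** * The singular scheme *)

Section ImageIdeal.
Variables (K : closedFieldType) (T : omodule K) (k : int) (om : omod_hom T (twist k)).
Implicit Types (U V W : open K).

Definition omv U (D : T U) : dom U -> K := (om U D : reg k U).

Lemma omvP U (D : T U) : regular k (omv D). Proof. exact: regP. Qed.
Lemma omvD U (D E : T U) c : omv (D + E) c = omv D c + omv E c.
Proof. by rewrite /omv homD. Qed.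
Lemma omvZ U a (D : T U) c : omv (a *: D) c = a c * omv D c.
Proof. by rewrite /omv homZ. Qed.
Lemma omv0 U c : omv (0 : T U) c = 0.
Proof. by rewrite /omv hom0. Qed.
Lemma omv_res U V (h : V <<= U) (D : T U) c : omv (res T h D) c = omv D (dom_sub h c).
Proof. by rewrite /omv hom_res. Qed.

(* Membership in the ideal [I] for which [I(k)] is the image of [om]. *)
Definition image_mem U (a : OP3 U) : Prop := locally (fun V (h : V <<= U) =>
  exists (D : T V) (r : reg (- k) V), forall x, a (dom_sub h x) = r x * omv D x).

(** On a chart the section of [O(-k)] can be normalised to ['X_j ^ (- k)], its ratio to this power
    being absorbed into [D]; elements of the image can then be added. *)
Lemma image_mem_pow j U (a : OP3 U) x : image_mem a -> U x -> basic 'X_j x ->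
  exists V (h : V <<= U) (D : T V), [/\ V x, V <<= basic 'X_j &
    forall y, a (dom_sub h y) = omv D y * val (sval y) 0 j ^ (- k)].
Proof.
move=> ha Ux xj; have [V [h [Vx [D [r e]]]]] := ha x Ux.
pose W := openI V (basic ('X_j : {mpoly K[4]})).
have hV : W <<= V := @sub_openIl _ V _; have hj : W <<= basic 'X_j := @sub_openIr _ V _.
pose u : OP3 W := toreg 0 (fun y => r (dom_sub hV y) * val (sval y) 0 j ^ k).
have uE y : u y = r (dom_sub hV y) * val (sval y) 0 j ^ k.
  rewrite toregE //; apply: (regular_cast (k := - k + k)); first by rewrite addNr.
  by apply: regularM; [exact: regular_sub (regP r)|exact: regular_pow].
exists W, (sub_open_trans h hV), (u *: res T hV D); split=> // y.
rewrite omvZ omv_res uE mulrAC -[_ * _ ^ k * _]mulrA -expfzDr ?(basicXE hj) // subrr mulr1.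
by rewrite -e; congr (regfun a _); exact: dom_inj.
Qed.

Lemma image_mem_intro U (a : OP3 U) : (forall x, U x -> exists V (h : V <<= U) (D : T V) j,
    [/\ V x, V <<= basic 'X_j &
    forall y, a (dom_sub h y) = omv D y * val (sval y) 0 j ^ (- k)]) -> image_mem a.
Proof.
move=> ha x Ux; have [V [h [D [j [Vx hj e]]]]] := ha x Ux.
exists V, h; split=> //; exists D, (toreg (- k) (fun y => val (sval y) 0 j ^ (- k))) => y.
by rewrite e toregE 1?mulrC //; exact: regular_pow.
Qed.

Lemma image_mem0 U : image_mem (0 : OP3 U).
Proof.
move=> x Ux; exists U, (@sub_open_refl _ U); split=> //; exists 0, 0 => y.
by rewrite omv0 mulr0.
Qed.

Lemma image_memD U (a b : OP3 U) : image_mem a -> image_mem b -> image_mem (a + b).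
Proof.
move=> ha hb; apply: image_mem_intro => x Ux; have [j xj] := pt_basicX x.
have [V [h [D [Vx hj e]]]] := image_mem_pow ha Ux xj.
have [V' [h' [D' [Vx' _ e']]]] := image_mem_pow hb Ux xj.
pose W := openI V V'; have hl : W <<= V := @sub_openIl _ V V'; have hr : W <<= V' := @sub_openIr _ V V'.
exists W, (sub_open_trans h hl), (res T hl D + res T hr D'), j; split=> // [|y].
  exact: sub_open_trans hj hl.
rewrite omvD !omv_res mulrDl.
have := e (dom_sub hl y); have := e' (dom_sub hr y); rewrite /= => <- <-.
pose z := dom_sub (sub_open_trans h hl) y; transitivity (a z + b z); first by [].
by congr (regfun a _ + regfun b _); exact: dom_inj.
Qed.

Lemma image_memM U (a b : OP3 U) : image_mem b -> image_mem (a * b).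
Proof.
move=> hb x Ux; have [V [h [Vx [D [r e]]]]] := hb x Ux.
exists V, h; split=> //; exists D, (resO h a *: r) => y.
by rewrite regME e regZE -mulrA; congr (_ * _).
Qed.

Lemma image_mem_res U V (h : V <<= U) (a : OP3 U) : image_mem a -> image_mem (resO h a).
Proof.
move=> ha x Vx; have [W [k' [Wx [D [r e]]]]] := ha x (h x Vx).
have hV : openI V W <<= V := @sub_openIl _ V W; have hW : openI V W <<= W := @sub_openIr _ V W.
exists (openI V W), hV; split=> //; exists (res T hW D), (reg_res hW r) => y.
rewrite omv_res !reg_resE -e; congr (regfun a _); exact: dom_inj.
Qed.

Lemma image_mem_local U (a : OP3 U) :
  locally (fun V (h : V <<= U) => image_mem (resO h a)) -> image_mem a.
Proof.
move=> ha x Ux; have [V [h [Vx /(_ x Vx) [W [h' [Wx [D [r e]]]]]]]] := ha x Ux.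
exists W, (sub_open_trans h h'); split=> //; exists D, r => y.
by rewrite -e reg_resE; congr (regfun a _); exact: dom_inj.
Qed.

Definition image_ideal : ideal K := Ideal image_mem0 image_memD image_memM
  image_mem_res image_mem_local.

(** A finite sum of products collapses to one section of [T], since its coefficients become
    functions on the chart and are absorbed into the sections. *)
Lemma image_twist_local j l U (s : itwist_sec image_ideal l U) x : U x -> basic 'X_j x ->
  exists V (h : V <<= U) (D : T V), [/\ V x, V <<= basic 'X_j &
    forall y, s (dom_sub h y) = omv D y * val (sval y) 0 j ^ (l - k)].
Proof.
move=> Ux xj; have /asboolP/(_ x Ux) [W [hW [Wx [n [a [t [Ia es]]]]]]] := itwist_secP s.
suff [V [h [D [Vx hj e]]]] : exists V (h : V <<= W) (D : T V), [/\ V x, V <<= basic 'X_j &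
    forall y, (\sum_i a i *: t i) (dom_sub h y) = omv D y * val (sval y) 0 j ^ (l - k)].
  exists V, (sub_open_trans hW h), D; split=> // y; rewrite -e -es reg_resE.
  by congr (regfun s _); exact: dom_inj.
elim: n a t Ia {es} => [|n IH] a t Ia.
  exists (openI W (basic 'X_j)), (@sub_openIl _ _ _), 0; split=> // [|y].
    exact: sub_openIr.
  by rewrite big_ord0 omv0 mul0r.
have [V [h [D [Vx hj e]]]] := IH (fun i => a (lift ord0 i)) (fun i => t (lift ord0 i)) (fun i => Ia (lift ord0 i)).
have [V' [h' [D' [Vx' _ e']]]] := image_mem_pow (Ia ord0) Wx xj.
pose Y := openI V V'; have hl : Y <<= V := @sub_openIl _ V V'; have hr : Y <<= V' := @sub_openIr _ V V'.
have hY : Y <<= basic 'X_j by exact: sub_open_trans hj hl.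
have hYW : Y <<= W by exact: sub_open_trans h hl.
pose u : OP3 Y := toreg 0 (fun y => t ord0 (dom_sub hYW y) * val (sval y) 0 j ^ (- l)).
have uE y : u y = t ord0 (dom_sub hYW y) * val (sval y) 0 j ^ (- l).
  rewrite toregE //; apply: (regular_cast (k := l + - l)); first by rewrite subrr.
  by apply: regularM; [exact: regular_sub (regP (t ord0))|exact: regular_pow].
exists Y, hYW, (u *: res T hr D' + res T hl D); split=> // y.
have y0 := basicXE hY y.
rewrite big_ord_recl regDE regZE omvD omvZ !omv_res mulrDl uE; congr (_ + _).
  have := e' (dom_sub hr y); rewrite (_ : dom_sub h' _ = dom_sub hYW y); last exact: dom_inj.
  move=> ->; rewrite (addrC l) expfzDr // -[val (sval (dom_sub hr y))]/(val (sval y)).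
  have : val (sval y) 0 j ^ (- l) * val (sval y) 0 j ^ l = 1 by rewrite -expfzDr // addNr.
  move: (_ ^ (- l)) (_ ^ l) (_ ^ (- k)) (t _ _) (omv _ _) => A B C0 t0 w AB.
  transitivity (t0 * w * C0 * (A * B)); first by rewrite AB; ring.
  by ring.
by rewrite -[LHS]/(regfun _ _) -e; congr (regfun _ _); exact: dom_inj.
Qed.

Lemma image_twist_section j l U (D : T U) : U <<= basic 'X_j ->
  exists s : itwist_sec image_ideal l U, forall y, s y = omv D y * val (sval y) 0 j ^ (l - k).
Proof.
move=> hj.
have r1 : regular l (fun y : dom U => omv D y * val (sval y) 0 j ^ (l - k)).
  apply: (regular_cast (k := k + (l - k))); first by rewrite addrC subrK.
  by apply: regularM; [exact: omvP|exact: regular_pow].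
suff hs : in_itwist image_ideal l U (toreg l (fun y : dom U => omv D y * val (sval y) 0 j ^ (l - k))).
  by exists (ItwistSec hs) => y /=; rewrite toregE.
apply/asboolP => x Ux; exists U, (@sub_open_refl _ U); split=> //.
have r2 : regular 0 (fun y : dom U => omv D y * val (sval y) 0 j ^ (- k)).
  apply: (regular_cast (k := k + - k)); first by rewrite subrr.
  by apply: regularM; [exact: omvP|exact: regular_pow].
exists 1%N, (fun=> toreg 0 (fun y : dom U => omv D y * val (sval y) 0 j ^ (- k))),
  (fun=> toreg l (fun y : dom U => val (sval y) 0 j ^ l)); split=> [_|].
  apply: image_mem_intro => z Uz; exists U, (@sub_open_refl _ U), D, j; split=> // y.
  by rewrite toregE //=; congr (omv D _ * _); exact: dom_inj.
rewrite big_ord1; apply: reg_ext => y; rewrite reg_resE regZE !toregE //; last exact: regular_pow.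
rewrite /= -mulrA -expfzDr ?(basicXE hj) // (addrC (- k)).
by congr (omv D _ * _); exact: dom_inj.
Qed.

Lemma image_hom : exists g : omod_hom T (itwist image_ideal k),
  forall U (D : T U) c, (g U D : itwist_sec _ _ U) c = omv D c.
Proof.
have mem U (D : T U) : in_itwist image_ideal k U (om U D : reg k U).
  apply/asboolP => x Ux; have [j xj] := pt_basicX x.
  pose V := openI U (basic ('X_j : {mpoly K[4]})); pose h : V <<= U := @sub_openIl _ U _.
  have [s es] := @image_twist_section j k V (res T h D) (@sub_openIr _ U _).
  have Vx : V x by [].
  have /asboolP/(_ x Vx) [W [h' [Wx [n [a [t [Ia e]]]]]]] := itwist_secP s.
  exists W, (sub_open_trans h h'); split=> //; exists n, a, t; split=> //.
  rewrite -e; apply: reg_ext => y; rewrite !reg_resE es subrr expr0z mulr1 omv_res.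
  by rewrite /omv; congr (regfun _ _); exact: dom_inj.
pose g U (D : T U) : itwist image_ideal k U := ItwistSec (mem U D).
have g_lin U : linear (@g U).
  by move=> a s t; apply: val_inj; rewrite /g /= hom_linear.
have g_res U V (h : V <<= U) (s : T U) : g V (res T h s) = res (itwist image_ideal k) h (g U s).
  by apply: val_inj; rewrite /g /= hom_res.
by exists (Defs.Hom g_lin g_res).
Qed.

Lemma zero_locus_image U (D : T U) c : zero_locus image_ideal (sval c) -> omv D c = 0.
Proof.
move=> h; have [j xj] := pt_basicX (sval c).
pose V := openI U (basic ('X_j : {mpoly K[4]})); have hj : V <<= basic 'X_j := @sub_openIr _ U _.
pose k' : V <<= U := @sub_openIl _ U (basic 'X_j).
have Vc : V (sval c) by split=> //; exact: svalP.
pose a : OP3 V := toreg 0 (fun y => omv (res T k' D) y * val (sval y) 0 j ^ (- k)).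
have aE y : a y = omv (res T k' D) y * val (sval y) 0 j ^ (- k).
  rewrite toregE //; apply: (regular_cast (k := k + - k)); first by rewrite subrr.
  by apply: regularM; [exact: omvP|exact: regular_pow].
have Ia : image_ideal V a.
  apply: image_mem_intro => z Uz; exists V, (@sub_open_refl _ V), (res T k' D), j; split=> // y.
  by rewrite aE; congr (omv _ _ * _); exact: dom_inj.
have /eqP := h V a Ia (at_pt Vc) erefl; rewrite aE omv_res.
have -> : dom_sub k' (at_pt Vc) = c by exact: dom_inj.
by rewrite mulf_eq0 expfz_eq0 (negPf (basicXE hj (at_pt Vc))) andbF orbF => /eqP.
Qed.

(** Surjectivity holds by the choice of the ideal; exactness in the middle passes from [om] to its
    corestriction. *)
Lemma image_short_exact (G : omodule K) (phi : omod_hom G T) :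
  (forall U, injective (phi U)) -> (forall U s, om U (phi U s) = 0) ->
  (forall U (D : T U), om U D = 0 ->
    locally (fun V (h : V <<= U) => exists s : G V, phi V s = res T h D)) ->
  exists g : omod_hom T (itwist image_ideal k), short_exact phi g.
Proof.
move=> inj comp ker; have [g gE] := image_hom; exists g; split=> // [U D|U s].
  split=> [g0|h].
    apply: ker; apply: reg_ext => c.
    by rewrite -[LHS]/(omv D c) -gE g0.
  apply: val_inj; apply: reg_local_ext => x Ux; have [V [h' [Vx [s es]]]] := h x Ux.
  exists V, h'; split=> //; apply: reg_ext => y.
  rewrite -[LHS]/((res (itwist image_ideal k) h' (g U D) : itwist_sec _ _ V) y) -hom_res.
  by rewrite gE -es /omv comp.
move=> x Ux; have [j xj] := pt_basicX x.
have [V [h [D [Vx hj e]]]] := image_twist_local (s : itwist_sec _ _ U) Ux xj.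
exists V, h; split=> //; exists D; apply: val_inj; apply: reg_ext => y.
by rewrite -[LHS]/((g V D : itwist_sec _ _ V) y) gE -[RHS]/(s (dom_sub h y)) e subrr expr0z mulr1.
Qed.

Lemma image_section_sum j l Y U (hY : Y <<= U) n (v : 'I_n -> T U)
    (s : 'I_n -> itwist image_ideal l Y) V (h : V <<= Y) (h' : V <<= U) (a : 'I_n -> OP3 V) y :
  (forall i y, (s i : itwist_sec _ _ Y) y = omv (v i) (dom_sub hY y) * val (sval y) 0 j ^ (l - k)) ->
  (\sum_i a i *: res (itwist image_ideal l) h (s i) : itwist_sec _ _ V) y =
  omv (\sum_i a i *: res T h' (v i)) y * val (sval y) 0 j ^ (l - k).
Proof.
elim: n v s a => [|n IH] v s a sE; first by rewrite !big_ord0 omv0 mul0r.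
rewrite !big_ord_recl omvD omvZ mulrDl.
have := IH (fun i => v (lift ord0 i)) (fun i => s (lift ord0 i)) (fun i => a (lift ord0 i))
  (fun i => sE (lift ord0 i)) => <-.
pose t := \sum_i a (lift ord0 i) *: res (itwist image_ideal l) h (s (lift ord0 i)).
transitivity (a ord0 y * (s ord0 : itwist_sec _ _ Y) (dom_sub h y) + (t : itwist_sec _ _ V) y).
  by [].
congr (_ + _); rewrite sE omv_res mulrA.
by congr (_ * omv _ _ * _); exact: dom_inj.
Qed.

(** On a chart, multiplication by ['X_j ^ (- k)] identifies the image of [om] with the ideal, so a
    local presentation of [T] modulo the kernel of [om] carries over. *)
Lemma image_coherent :
  (forall x, exists U (m n : nat) (v : 'I_n -> T U) (r : 'I_m -> 'I_n -> OP3 U),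
    U x /\ forall V (h : V <<= U),
      (forall D : T V, locally (fun W (k' : W <<= V) => exists a : 'I_n -> OP3 W,
         res T k' D = \sum_j a j *: res T (sub_open_trans h k') (v j))) /\
      (forall a : 'I_n -> OP3 V, om V (\sum_j a j *: res T h (v j)) = 0 <->
         locally (fun W (k' : W <<= V) => exists b : 'I_m -> OP3 W, forall j,
           resO k' (a j) = \sum_i b i * resO (sub_open_trans h k') (r i j)))) ->
  coherent (itwist image_ideal 0).
Proof.
move=> fp; split=> [|x]; first exact: itwist_sheaf.
have [U [m [n [v [r [Ux hU]]]]]] := fp x; have [j xj] := pt_basicX x.
pose Y := openI U (basic ('X_j : {mpoly K[4]})); have hj : Y <<= basic 'X_j := @sub_openIr _ U _.
pose hY : Y <<= U := @sub_openIl _ U (basic 'X_j).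
pose s0 i := projT1 (cid (@image_twist_section j 0 Y (res T hY (v i)) hj)).
pose s i : itwist image_ideal 0 Y := s0 i.
have sE i y : (s i : itwist_sec _ _ Y) y = omv (v i) (dom_sub hY y) * val (sval y) 0 j ^ (0 - k).
  by rewrite /s /s0; case: cid => t /= ->; rewrite omv_res.
have sumE V (h : V <<= Y) (h' : V <<= U) (a : 'I_n -> OP3 V) y := image_section_sum h h' a y sE.
exists Y, m, n, s, (fun i' i => resO hY (r i' i)); split=> // V h.
have h' : V <<= U by exact: sub_open_trans hY h.
have [gen rel] := hU V h'; split=> [t|a].
  move=> z Vz; have zj : basic 'X_j z by exact: hj (h z Vz).
  have [W [k' [D [Wz hW eD]]]] := image_twist_local (t : itwist_sec _ _ V) Vz zj.
  have [_] := hU W (sub_open_trans h' k'); move=> _.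
  have [gW _] := hU W (sub_open_trans h' k').
  have [W' [k'' [Wz' [a ea]]]] := gW D z Wz.
  exists W', (sub_open_trans k' k''); split=> //; exists a; apply: val_inj; apply: reg_ext => y.
  rewrite [RHS](sumE _ _ (sub_open_trans (sub_open_trans h' k') k'')) -ea omv_res.
  rewrite -[RHS]/(omv D (dom_sub k'' y) * val (sval (dom_sub k'' y)) 0 j ^ (0 - k)) -eD.
  have -> : dom_sub k' (dom_sub k'' y) = dom_sub (sub_open_trans k' k'') y by exact: dom_inj.
  by [].
have e0 : (\sum_i a i *: res (itwist image_ideal 0) h (s i) = 0) <->
    om V (\sum_i a i *: res T h' (v i)) = 0.
  split=> [e|e].
    apply: reg_ext => y; have := sumE V h h' a y; rewrite e => /esym/eqP.
    rewrite -[X in X == _]/(_ * _) mulf_eq0 expfz_eq0 (negPf (basicXE hj (dom_sub h y))) andbF orbF.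
    by move/eqP.
  apply: val_inj; apply: reg_ext => y; rewrite [LHS](sumE V h h' a y).
  by rewrite /omv e mul0r.
have rE W (k' : W <<= V) i' i : resO (sub_open_trans h k') (resO hY (r i' i)) = resO (sub_open_trans h' k') (r i' i).
  by rewrite /resO; exact: (reg_res_comp hY).
split=> [/e0/rel hl z Vz|hl].
  have [W [k' [Wz [b eb]]]] := hl z Vz; exists W, k'; split=> //; exists b => i.
  by rewrite eb; apply: eq_bigr => i' _; rewrite rE.
apply/e0/rel => z Vz; have [W [k' [Wz [b eb]]]] := hl z Vz; exists W, k'; split=> //; exists b => i.
by rewrite eb; apply: eq_bigr => i' _; rewrite rE.
Qed.

End ImageIdeal.

(** * Coherence of the singular scheme *)

Lemma multiple_clear (K : fieldType) (a x s p q w : K) : x != 0 -> p != 0 ->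
  (a * x - s) * p = q * w -> a * x = w / p * (q / x) * x + s.
Proof.
move=> x0 p0 e; apply/eqP; rewrite -subr_eq (canRL (mulfK p0) e); apply/eqP; field.
by rewrite x0 p0.
Qed.

Lemma ord_cons (T : Type) n (x : T) (f : 'I_n -> T) :
  exists2 g : 'I_n.+1 -> T, g ord0 = x & forall i, g (lift ord0 i) = f i.
Proof.
exists (fun i => if unlift ord0 i is Some j then f j else x) => [|i].
  by rewrite unlift_none.
by rewrite liftK.
Qed.

Section Sums.
Variable K : closedFieldType.
Implicit Types (U V : open K).

Lemma hom_sum (F G : omodule K) (g : omod_hom F G) U n (b : 'I_n -> OP3 U) (s : 'I_n -> F U) :
  g U (\sum_i b i *: s i) = \sum_i b i *: g U (s i).
Proof.
elim: n b s => [|n IH] b s; first by rewrite !big_ord0 hom0.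
by rewrite !big_ord_recl hom_linear IH.
Qed.

Lemma res_sum (F : omodule K) U V (h : V <<= U) n (b : 'I_n -> OP3 U) (s : 'I_n -> F U) :
  res F h (\sum_i b i *: s i) = \sum_i resO h (b i) *: res F h (s i).
Proof.
elim: n b s => [|n IH] b s; first by rewrite !big_ord0 res0.
by rewrite !big_ord_recl res_linear IH.
Qed.

Lemma regsumE k U n (b : 'I_n -> OP3 U) (s : 'I_n -> reg k U) y :
  (\sum_i b i *: s i) y = \sum_i b i y * s i y.
Proof.
elim: n b s => [|n IH] b s; first by rewrite !big_ord0.
by rewrite !big_ord_recl regDE regZE IH.
Qed.

Lemma regsumME U n (b r : 'I_n -> OP3 U) y :
  regfun (\sum_i b i * r i : OP3 U) y = \sum_i b i y * r i y.
Proof.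
elim: n b r => [|n IH] b r; first by rewrite !big_ord0.
rewrite !big_ord_recl -IH; by [].
Qed.

Lemma frame_pt_neq0 (B C : 'M[K]_4) (c : pt K) : B *m C = 1%:M -> exists j, ev (lf B j) c != 0.
Proof.
move=> BC; apply: contrapT => nx; have /negP := valP c; apply; apply/eqP.
rewrite -[LHS]mulmx1 -BC mulmxA (_ : val c *m B = 0) ?mul0mx //.
apply/rowP => j; rewrite [RHS]mxE -ev_lf; apply/eqP; apply: contrapT => /negP xj.
by apply: nx; exists j.
Qed.

End Sums.

Section Quotient.
Variables (K : closedFieldType) (K_fibers : has_infinite_fibers K).
Variables (B C : 'M[K]_4) (k : int) (F : omodule K)
  (phi : omod_hom F (tangentP3 K)) (om : omod_hom (tangentP3 K) (twist k)).
Hypotheses (CB : C *m B = 1%:M) (BC : B *m C = 1%:M) (cF : coherent F).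
Notation l := (lf B).
Notation vff := (vff K_fibers C).
Notation TP := (tangentP3 K).
Hypotheses (comp : forall U s, om U (phi U s) = 0)
  (ker : forall U (D : TP U), om U D = 0 ->
    locally (fun V (h : V <<= U) => exists s : F V, phi V s = res TP h D))
  (phi_vff : forall U s, exists a : 'I_4 -> reg 1 U, phi U s = vff a).
Implicit Types (U V W : open K).

Lemma vff0 U : vff (fun=> 0 : reg 1 U) = 0.
Proof.
pose a : 'I_4 -> reg 1 U := fun=> 0.
have := vff_linear K_fibers C (-1) a a; rewrite scaleN1r addNr => <-.
by congr (vff _); apply/funext => j; rewrite /a scaler0 addr0.
Qed.

Lemma vff_sum U n (b : 'I_n -> OP3 U) (c : 'I_n -> 'I_4 -> reg 1 U) :
  vff (fun j => \sum_i b i *: c i j) = \sum_i b i *: (vff (c i) : TP U).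
Proof.
elim: n b c => [|n IH] b c.
  by rewrite big_ord0 -[RHS]vff0; congr (vff _); apply/funext => j; rewrite big_ord0.
rewrite big_ord_recl -IH -vff_linear; congr (vff _); apply/funext => j.
by rewrite big_ord_recl.
Qed.

Definition coord_sec j U : reg 1 U := toreg 1 (fun y => val (sval y) 0 j).

Lemma coord_secE j U y : coord_sec j U y = val (sval y) 0 j.
Proof.
rewrite toregE //; have := @regular_poly K 1 U 'X_j (X_homog K j).
by congr (regular _ _); apply/funext => z; rewrite evXU.
Qed.

(** The partial derivative along the frame coordinate [i], multiplied by ['X_j] to be of degree 0;
    on the chart [j] these four generate the tangent sheaf. *)
Definition frame_vf j U i : TP U := vff (fun i' => if i' == i then coord_sec j U else 0).

Lemma frame_vf_sum j U V (h : V <<= U) (a : 'I_4 -> OP3 V) :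
  \sum_i a i *: res TP h (frame_vf j U i) = vff (fun i => a i *: coord_sec j V).
Proof.
have e i : res TP h (frame_vf j U i) = vff (fun i' => if i' == i then coord_sec j V else 0).
  rewrite [LHS]vff_res; congr (vff _); apply/funext => i'; apply: reg_ext => y.
  by rewrite reg_resE; case: eqP => _ //; rewrite !coord_secE.
transitivity (\sum_i a i *: (vff (fun i' => if i' == i then coord_sec j V else 0) : TP V)).
  by apply: eq_bigr => i _; rewrite e.
rewrite -vff_sum; congr (vff _); apply/funext => i; rewrite (bigD1 i) //= eqxx.
by rewrite big1 ?addr0 // => i' ne; rewrite eq_sym (negPf ne) scaler0.
Qed.

(** The image of [om] is the tangent sheaf modulo [F], so it has four generators, with the Euler
    field and the images of local generators of [F] as relations. *)
Lemma quotient_presentation x : exists U (m n : nat) (v : 'I_n -> TP U) (r : 'I_m -> 'I_n -> OP3 U),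
    U x /\ forall V (h : V <<= U),
      (forall D : TP V, locally (fun W (k' : W <<= V) => exists a : 'I_n -> OP3 W,
         res TP k' D = \sum_j a j *: res TP (sub_open_trans h k') (v j))) /\
      (forall a : 'I_n -> OP3 V, om V (\sum_j a j *: res TP h (v j)) = 0 <->
         locally (fun W (k' : W <<= V) => exists b : 'I_m -> OP3 W, forall j,
           resO k' (a j) = \sum_i b i * resO (sub_open_trans h k') (r i j))).
Proof.
have [U0 [m0 [n [s [r0 [U0x hU0]]]]]] := cF.2 x; have [j xj] := pt_basicX x.
pose U := openI U0 (basic ('X_j : {mpoly K[4]})); have hj : U <<= basic 'X_j := @sub_openIr _ U0 _.
have hU : U <<= U0 := @sub_openIl _ U0 _.
pose cs i := projT1 (cid (phi_vff (res F hU (s i)))).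
have csP i : phi U (res F hU (s i)) = vff (cs i) := projT2 (cid (phi_vff (res F hU (s i)))).
pose lr i : reg 1 U := toreg 1 (fun y => ev (l i) (sval y)).
have lrE i y : lr i y = ev (l i) (sval y) by rewrite toregE //; exact: (regular_poly (lf_homog B i)).
(* Relation 0 is the Euler field, the others come from the generators of [F]; [r] divides them by
   ['X_j] to match [frame_vf]. *)
have [w w0 wS] := ord_cons lr cs.
pose r (i0 : 'I_n.+1) i' : OP3 U := toreg 0 (fun y => w i0 i' y * val (sval y) 0 j ^ (-1)).
have rE i0 i' y : r i0 i' y = w i0 i' y * val (sval y) 0 j ^ (-1).
  rewrite toregE //; apply: (regular_cast (k := 1 + (-1))) => //.
  by apply: regularM; [exact: regP|exact: regular_pow].
have xN V (h : V <<= U) (y : dom V) : val (sval y) 0 j != 0.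
  by exact: (basicXE (sub_open_trans hj h)).
have xV V (h : V <<= U) (y : dom V) : val (sval y) 0 j ^ (-1) * val (sval y) 0 j = 1.
  by rewrite exprN1 mulVf // (xN V h).
exists U, n.+1, 4%N, (frame_vf j U), r; split=> // V h; split=> [D|a].
  move=> z Vz; have [a ea] := vff_rep K_fibers BC D j.
  pose W := openI V (basic ('X_j : {mpoly K[4]})); pose k' : W <<= V := @sub_openIl _ V _.
  exists W, k'; split; first by split=> //; exact: hj (h z Vz).
  exists (fun i => toreg 0 (fun y => a i y * val (sval y) 0 j ^ (-1)) : OP3 W).
  rewrite (@frame_vf_sum j U W (sub_open_trans h k')) [LHS]ea; congr (vff _).
  apply/funext => i; apply: reg_ext => y; rewrite regZE coord_secE toregE.
    by rewrite -mulrA (xV W (sub_open_trans h k')) mulr1.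
  apply: (regular_cast (k := 1 + (-1))) => //.
  by apply: regularM; [exact: regP|apply: regular_pow; exact: sub_openIr].
have resD_ W (k' : W <<= V) : res TP k' (\sum_i a i *: res TP h (frame_vf j U i)) =
    vff (fun i => resO k' (a i) *: coord_sec j W).
  rewrite res_sum -(@frame_vf_sum j U W (sub_open_trans h k')).
  by apply: eq_bigr => i _; rewrite (res_comp _ _ (sub_open_trans h k')).
have phi_s W (k' : W <<= U) (k0 : W <<= U0) (b : 'I_n -> OP3 W) : phi W (\sum_i b i *: res F k0 (s i)) =
    vff (fun i' => \sum_i b i *: reg_res k' (cs i i')).
  rewrite hom_sum vff_sum; apply: eq_bigr => i _; congr (_ *: _).
  rewrite -(res_comp hU k' k0) hom_res csP; exact: vff_res.
split=> [om0 z Vz|hl].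
  have [W1 [k1 [W1z [t et]]]] := ker om0 Vz.
  have [gen _] := hU0 W1 (sub_open_trans hU (sub_open_trans h k1)).
  have [W2 [k2 [W2z [b eb]]]] := gen t z W1z.
  have kU : W2 <<= U by exact: sub_open_trans h (sub_open_trans k1 k2).
  (* The given combination minus the image of a section of [F]: a zero vector field, hence a
     multiple of the Euler field. *)
  pose wd i' : reg 1 W2 := - 1 *: (\sum_i b i *: reg_res kU (cs i i')) + resO (sub_open_trans k1 k2) (a i') *: coord_sec j W2.
  have wd0 : vff wd = 0.
    rewrite /wd vff_linear -(phi_s W2 kU (sub_open_trans (sub_open_trans hU (sub_open_trans h k1)) k2)).
    rewrite -eb hom_res et -resD_ (res_comp _ _ (sub_open_trans k1 k2)).
    by rewrite scaleN1r addNr.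
  have prop := vff_eq0 CB wd0.
  have [q lq] := @frame_pt_neq0 K B C z BC.
  pose W := openI W2 (basic (l q)); pose k3 : W <<= W2 := @sub_openIl _ W2 (basic (l q)).
  have hq : W <<= basic (l q) := @sub_openIr _ W2 _.
  have q0 (y : dom W) : ev (l q) (sval y) != 0 by have [] := hq _ (svalP y).
  (* The multiple is read off from a frame coordinate that does not vanish at [z]. *)
  pose m : OP3 W := toreg 0 (fun y => wd q (dom_sub k3 y) * ev (l q) (sval y) ^ (-1)).
  have mE y : m y = wd q (dom_sub k3 y) * ev (l q) (sval y) ^ (-1).
    rewrite toregE //; apply: (regular_cast (k := 1 + (-1))) => //.
    by apply: regularM; [exact: regular_sub (regP _)|apply: (regular_lpow _ (lf_homog B q))].
  have kW : W <<= V := sub_open_trans (sub_open_trans k1 k2) k3.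
  exists W, kW; split; first by split=> //; split=> //; exists 1%N; exact: lf_homog.
  have [bb bb0 bbS] := ord_cons m (fun i => resO k3 (b i)).
  exists bb => i'; apply: reg_ext => y; rewrite regsumME big_ord_recl bb0.
  under eq_bigr => i _ do rewrite bbS.
  have x0 := xN W (sub_open_trans h kW) y.
  apply: (mulIf x0); rewrite mulrDl mulr_suml.
  have eW : dom_sub (sub_open_trans h kW) y = dom_sub kU (dom_sub k3 y) by exact: dom_inj.
  have eV : dom_sub (sub_open_trans k1 k2) (dom_sub k3 y) = dom_sub kW y by exact: dom_inj.
  have := prop (dom_sub k3 y) i' q.
  have wdE : wd i' (dom_sub k3 y) = a i' (dom_sub kW y) * val (sval y) 0 j - \sum_i b i (dom_sub k3 y) * cs i i' (dom_sub kU (dom_sub k3 y)).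
    rewrite /wd regDE !regZE regsumE coord_secE !reg_resE eV addrC; congr (_ + _).
    by rewrite -[regfun _ _]/(-1 : K) mulN1r.
  rewrite wdE => e1.
  rewrite mE (reg_resE _ (r ord0 i')) rE w0 lrE.
  under eq_bigr => i _ do rewrite (reg_resE _ (r (lift ord0 i) i')) rE wS eW.
  have -> : \sum_(i < n) resO k3 (b i) y * (cs i i' (dom_sub kU (dom_sub k3 y)) *
      val (sval (dom_sub kU (dom_sub k3 y))) 0 j ^ (-1)) * val (sval y) 0 j =
      \sum_i b i (dom_sub k3 y) * cs i i' (dom_sub kU (dom_sub k3 y)).
    apply: eq_bigr => i _; rewrite -[sval (dom_sub kU (dom_sub k3 y))]/(sval y).
    by rewrite !exprN1 -!mulrA mulVf // mulr1.
  move: e1; rewrite -[sval (dom_sub k3 y)]/(sval y) -[sval (dom_sub (sub_open_trans h kW) y)]/(sval y) !exprN1.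
  exact: multiple_clear x0 (q0 y).
apply: reg_local_ext => z Vz; have [W [k' [Wz [b eb]]]] := hl z Vz.
exists W, k'; split=> //.
have kU : W <<= U by exact: sub_open_trans h k'.
rewrite -[LHS]/(res (twist k) k' (om V (\sum_i a i *: res TP h (frame_vf j U i)))) -hom_res resD_.
transitivity (om W (phi W (\sum_i b (lift ord0 i) *: res F (sub_open_trans hU kU) (s i)))); last first.
  by rewrite comp; exact: val_inj.
rewrite (phi_s W kU); congr (om W _).
apply: (@vff_eq K K_fibers B C BC W _ _ (b ord0)) => i' y.
rewrite regZE coord_secE eb regsumME regsumE big_ord_recl mulrDl addrC mulr_suml.
congr (_ + _).
  apply: eq_bigr => i _; rewrite !reg_resE rE wS.
  rewrite -mulrA -[sval (dom_sub _ y)]/(sval y) -mulrA (xV W kU) mulr1.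
  by congr (_ * regfun (cs i i') _); exact: dom_inj.
rewrite reg_resE rE w0 lrE -[sval (dom_sub _ y)]/(sval y).
by rewrite -mulrA -mulrA (xV W kU) mulr1.
Qed.

End Quotient.

(** * Codimension of the singular locus *)

Section LinearSubspaces.
Variables (K : closedFieldType) (K_fibers : has_infinite_fibers K) (B C : 'M[K]_4).
Hypotheses (CB : C *m B = 1%:M) (BC : B *m C = 1%:M).
Notation S := {mpoly K[4]}.
Notation l := (lf B).
Implicit Types (J : seq 'I_4).

Definition linear_set J : set (pt K) := [set c | forall j, j \in J -> ev (l j) c = 0].

Lemma linear_set_closed J : zariski_closed (linear_set J).
Proof.
exists (fun p => exists2 j, j \in J & p = l j); split=> [p [j _ ->]|c].
  by exists 1%N; exact: lf_homog.
split=> [/existsNP[j /not_implyP[jJ /eqP lj]]|[p [j jJ ->] /eqP lj]].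
  by exists (l j) => //; exists j.
by move=> /(_ j jJ).
Qed.

Definition linear_proj J : 'M[K]_4 := B *m diag_mx (\row_j (j \notin J)%:R) *m C.

Lemma linear_projE J (v : 'rV[K]_4) j : (v *m linear_proj J *m B) 0 j = (v *m B) 0 j * (j \notin J)%:R.
Proof.
rewrite -!mulmxA CB mulmx1 mulmxA mxE (bigD1 j) //= big1 ?addr0 => [|i ij].
  by congr (_ * _); rewrite !mxE eqxx mulr1n.
by rewrite [X in _ * X]mxE (negPf ij) mulr0n mulr0.
Qed.

Lemma linear_proj_id J (v : 'rV[K]_4) : (forall j, j \in J -> (v *m B) 0 j = 0) -> v *m linear_proj J = v.
Proof.
move=> hv; suff e : v *m linear_proj J *m B = v *m B.
  by rewrite -[LHS]mulmx1 -BC mulmxA e -mulmxA BC mulmx1.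
apply/rowP => j; rewrite linear_projE.
by have [/hv ->|_] := boolP (j \in J); rewrite ?mul0r ?mulr1.
Qed.

(** The set is the image of [linear_proj J], to which [vanish_on_prime] applies. The factor ['X_k]
    in the proof covers the vectors projected to zero, which give no point. *)
Lemma linear_set_irreducible J i : i \notin J -> irreducible_closed (linear_set J).
Proof.
move=> iJ; split; first exact: linear_set_closed.
  have [|c ec] := @frame_pt K B C (delta_mx 0 i) CB.
    by apply/eqP => /(congr1 (fun v : 'rV[K]_4 => v 0 i)) /eqP; rewrite !mxE !eqxx oner_eq0.
  by exists c => j jJ; rewrite ec mxE eqxx /=; case: eqP => // e; rewrite -e jJ in iJ.
move=> A1 A2 hA1 hA2 cov; apply: contrapT => /not_orP[/nonsubset[a [aJ aA]] /nonsubset[b [bJ bA]]].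
have [S1 [_ e1]] := hA1; have [S2 [_ e2]] := hA2.
have [p Sp pa] := (e1 a).1 aA; have [q Sq qb] := (e2 b).1 bA.
have [k ak] := pt_coord a.
have id_ (c : pt K) : linear_set J c -> val c *m linear_proj J = val c.
  by move=> hc; apply: linear_proj_id => j /hc; rewrite ev_lf.
have [v|h|h] := @vanish_on_prime K K_fibers (linear_proj J) (p * 'X_k) q.
- rewrite /mev !mevalM mevalXU.
  have [->|v0] := eqVneq (v *m linear_proj J) 0; first by rewrite mxE mulr0 mul0r.
  have [c ec] := exists_pt v0; rewrite -ec -[p.@[_]]/(ev p c) -[q.@[_]]/(ev q c).
  have : linear_set J c.
    by move=> j jJ; rewrite ev_lf ec linear_projE jJ mulr0.
  move=> /cov[cA|cA].
    have -> : ev p c = 0; last by rewrite !mul0r.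
    by apply/eqP; apply: contrapT => /negP pc; apply: ((e1 c).2 _ cA); exists p.
  have -> : ev q c = 0; last by rewrite mulr0.
  by apply/eqP; apply: contrapT => /negP pc; apply: ((e2 c).2 _ cA); exists q.
- have /eqP := h (val a); rewrite id_ // /mev mevalM mevalXU mulf_eq0 (negPf ak) orbF.
  by rewrite -[p.@[_]]/(ev p a) (negPf pa).
- by have /eqP := h (val b); rewrite id_ // -[mev _ _]/(ev q b) (negPf qb).
Qed.

Lemma linear_set_proper J J' i : {subset J <= J'} -> i \in J' -> i \notin J ->
  linear_set J' `<` linear_set J.
Proof.
move=> JJ' iJ' iJ; split=> [c hc j /JJ'|]; first exact: hc.
have [|c ec] := @frame_pt K B C (delta_mx 0 i) CB.
  by apply/eqP => /(congr1 (fun v : 'rV[K]_4 => v 0 i)) /eqP; rewrite !mxE !eqxx oner_eq0.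
have hc : linear_set J c.
  by move=> j jJ; rewrite ec mxE eqxx /=; case: eqP => // e; rewrite -e jJ in iJ.
move=> /(_ c hc i iJ') /eqP; by rewrite ec mxE !eqxx oner_eq0.
Qed.

(** An irreducible closed subset of two lines lies in one of them, and linear subspaces complete the
    chain. *)
Lemma codim_lines i j i' j' (Z : set (pt K)) : i != j -> i' != j' ->
  Z `<=` linear_set [:: i; j] `|` linear_set [:: i'; j'] -> codim_ge Z 2.
Proof.
move=> ij ij' hZ W irW WZ.
suff main a b : a != b -> W `<=` linear_set [:: a; b] -> exists c : nat -> set (pt K),
      [/\ c 0%N = W, forall i, (i <= 2)%N -> irreducible_closed (c i) &
          forall i, (i < 2)%N -> c i `<` c i.+1].
  have [_ _ /(_ _ _ _ _ (fun z Wz => hZ z (WZ z Wz)))] := irW.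
  move=> /(_ (linear_set_closed _) (linear_set_closed _)) [Wl|Wl]; exact: main Wl.
move=> ab Wl.
have [z zab] : exists z, z \notin [:: a; b].
  apply: contrapT => nz; have : ((size (enum 'I_4)) <= size [:: a; b])%N.
    apply: uniq_leq_size (enum_uniq _) _ => z _; apply: contrapT => /negP zab.
    by apply: nz; exists z.
  by rewrite size_enum_ord.
have za : z \notin [:: a] by move: zab; rewrite !inE negb_or => /andP[].
have irr2 := linear_set_irreducible zab; have irr1 := linear_set_irreducible za.
have irr0 := @linear_set_irreducible [::] z isT.
have pr1 : linear_set [:: a; b] `<` linear_set [:: a].
  apply: (@linear_set_proper _ _ b); rewrite ?inE ?eqxx ?orbT //; last by rewrite eq_sym.
  by move=> y; rewrite !inE => ->.
have pr0 : linear_set [:: a] `<` linear_set [::].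
  by apply: (@linear_set_proper _ _ a); rewrite ?inE ?eqxx.
(* If [W] is the whole line, the chain continues with a plane and the space; otherwise with the line
   and a plane. *)
have [lW|nlW] := pselect (linear_set [:: a; b] `<=` W).
  have eW : W = linear_set [:: a; b] by exact/seteqP.
  by exists (nth W [:: W; linear_set [:: a]; linear_set [::]]); split=> //
    [[|[|[|//]]]|[|[|//]]] _ //=; rewrite eW.
by exists (nth W [:: W; linear_set [:: a; b]; linear_set [:: a]]); split=> //
    [[|[|[|//]]]|[|[|//]]] _ //=; split.
Qed.
End LinearSubspaces.

(** * The distribution *)

Section Construction.
Variables (K : closedFieldType) (L : set (pt K)) (d : nat).
Hypotheses (K_fibers : has_infinite_fibers K) (d_gt0 : (0 < d)%N).
Notation e := (2 - d%:Z).
Variables (F : omodule K) (i : omod_hom (twist 0) F)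
  (p : omod_hom F (itwist (ideal_of L) e)).
Notation l B := (lf B).

(** Evaluated on the four frame fields, the 1-form gives [z^d y = z^d x = f w = f z = 0] at a zero.
    If [z] is nonzero then [x = y = 0]; otherwise [w = 0], directly or because [f = z = 0] forces
    it. *)
Lemma form_zeros B C f (k : int) (om : omod_hom (tangentP3 K) (twist k)) :
  (forall c, ev f c = 0 -> ev (lf B o2) c = 0 -> ev (lf B o3) c = 0) ->
  (forall U (a : 'I_4 -> reg 1 U) c, omv om (vff K_fibers C a : tangentP3 K U) c = form_val d B f a c) ->
  zero_locus (image_ideal om) `<=` linear_set B [:: o0; o1] `|` linear_set B [:: o2; o3].
Proof.
move=> fv omE c hc; have [j xj] := pt_coord c.
pose U := basic ('X_j : {mpoly K[4]}); have Uc : U c by exact: basicX.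
have xc : coord_sec j U (at_pt Uc) = val c 0 j by rewrite coord_secE.
have aE (b b' : 'I_4) : (if b' == b then coord_sec j U else 0) (at_pt Uc) =
    (if b' == b then val c 0 j else 0) by case: ifP.
pose t (b b' : 'I_4) := if b' == b then val c 0 j else 0.
have eq0 b : ev f c * (ev (lf B o2) c * t b o3 - ev (lf B o3) c * t b o2) +
    ev (lf B o2) c ^+ d * (ev (lf B o0) c * t b o1 - ev (lf B o1) c * t b o0) = 0.
  rewrite /t -(aE b o3) -(aE b o2) -(aE b o1) -(aE b o0).
  transitivity (omv om (vff K_fibers C (fun b' => if b' == b then coord_sec j U else 0) : tangentP3 K U) (at_pt Uc)).
    by rewrite omE.
  exact: zero_locus_image.
have := eq0 o3; have := eq0 o2; have := eq0 o1; have := eq0 o0.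
rewrite /t /= !mulr0 ?sub0r ?subr0 ?oppr0 !mulr0 ?add0r ?addr0.
move=> /eqP; rewrite mulrN oppr_eq0 !mulf_eq0 (negPf xj) orbF expf_eq0 d_gt0 /= => h0.
move=> /eqP; rewrite !mulf_eq0 (negPf xj) orbF expf_eq0 d_gt0 /= => h1.
move=> /eqP; rewrite mulrN oppr_eq0 !mulf_eq0 (negPf xj) orbF => h2.
move=> /eqP; rewrite !mulf_eq0 (negPf xj) orbF => h3.
have [z0|z0] := eqVneq (ev (lf B o2) c) 0.
  right=> b; rewrite !inE => /orP[/eqP -> //|/eqP ->].
  by case/orP: h2 => /eqP // f0; exact: fv.
left=> b; rewrite !inE => /orP[/eqP ->|/eqP ->]; apply/eqP.
  by move: h1; rewrite (negPf z0).
by move: h0; rewrite (negPf z0).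
Qed.

Lemma distribution_exists : is_line L -> reflexive_sheaf F -> has_rank F 2 -> short_exact i p ->
  exists D : distribution K d, isomorphic (tangent D) F.
Proof.
move=> hL rF rkF ex; have [cF _] := rF; have [sF _] := cF.
have [B [C [f [sx [sy pres]]]]] := presentation_exists K_fibers d_gt0 ex hL rF.
have [phi [om [inj comp ker phiE omE]]] := tangent_sequence K_fibers d_gt0 ex sF pres.
have [[[CB BC] _] _ _ _ [_ _ fv]] := pres.
have [g exg] := image_short_exact inj comp ker.
have coh := image_coherent (quotient_presentation CB BC cF comp ker phiE).
have cod : codim_ge (zero_locus (image_ideal om)) 2.
  by apply: (codim_lines K_fibers CB BC _ _ (form_zeros fv omE)).
exists (Distribution rF rkF coh cod exg).
have id_lin U : linear (@idfun (F U)) by [].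
have id_res U V (h : V <<= U) (s : F U) : @idfun (F V) (res F h s) = res F h (idfun s) by [].
by exists (Defs.Hom id_lin id_res) => U; exists id.
Qed.

End Construction.

Theorem mainTheorem5 (R : realType) (d : nat) (hd : (3 <= d)%N)
    (L : set (pt R[i])) (hL : is_line L) (F : omodule R[i])
    (F_reflexive : reflexive_sheaf F) (F_rank : has_rank F 2)
    (i : omod_hom (twist 0) F) (p : omod_hom F (itwist (ideal_of L) (2 - d%:Z)))
    (F_exact : short_exact i p) :
  exists D : distribution R[i] d, isomorphic (tangent D) F.
Proof.
apply: (distribution_exists (@complex_infinite_fibers R) _ hL F_reflexive F_rank F_exact).
exact: leq_trans hd.
Qed.
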